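(* Let $T>0$ and let $v_0:\mathbb T^1\to\mathbb R$ be smooth with zero mean. Let $v^T$ be Brenier's shock-free substitute and let $q$ be the optimal flux, both associated with the inviscid Burgers equation $\partial_tv+\frac12\partial_x(v^2)=0$, $v(0)=v_0$, on $[0,T]\times\mathbb T^1$, as defined in the context. Then $$\langle\psi,v^T\mathcal L\rangle=\Big\langle\int_0^t\frac{\psi(s,\cdot)}{T-s}\,ds,\;q\Big\rangle$$ for any smooth test function $\psi:[0,T]\times\mathbb T^1\to\mathbb R$ that vanishes in a neighborhood of $\{T\}\times\mathbb T^1$.
   Context: Notation. $\Omega=\mathbb T^1=\mathbb R/\mathbb Z$; $\mathcal L=dx\,dt$ is Lebesgue measure on $[0,T]\times\Omega$; $\mathcal M(Q)$ denotes finite signed Radon measures on $Q$; $\langle f,\mu\rangle=\int_{[0,T]\times\Omega}f\,d\mu$. Shock-free substitute. Since $v_0$ has zero mean there is a smooth $1$-periodic $\varphi:\mathbb R\to\mathbb R$ with $\varphi'=v_0$. Let $\varphi^T:\mathbb R\to\mathbb R$ be such that $\frac{x^2}2+T\varphi^T(x)$ is the convex envelope of $\frac{x^2}2+T\varphi(x)$; $\varphi^T$ is $1$-periodic, and $v_0^T:=(\varphi^T)'$ is Lipschitz. The shock-free substitute $v^T$ is the entropy solution of the Burgers equation $\partial_tv^T+\frac12\partial_x((v^T)^2)=0$ on $[0,T]\times\Omega$ with initial datum $v^T(0,\cdot)=v_0^T$. It is bounded and Borel measurable on $[0,T]\times\Omega$ and continuous on $[0,T)\times\Omega$. Optimal pair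 $(q,\rho)$. Consider the dual problem (with weight $\mathfrak h\equiv1$) $$\sup\{-\langle v_0,E\rangle+\mathcal K(E,B)\}$$ over $(E,B)\in\mathcal M([0,T]\times\Omega)\times\mathcal M([0,T]\times\Omega)$ such that $\mathcal L+2B\ge0$ and $\langle\partial_t\Psi,B\rangle-\frac12\langle\partial_x\Psi,E\rangle=0$ for all smooth $\Psi:[0,T]\times\Omega\to\mathbb R$ with $\Psi(0,\cdot)=0$, where $$\mathcal K(E,B)=\inf\big\{\langle z,E\rangle+\tfrac12\langle M,\mathcal L+2B\rangle:\ z,M\in C([0,T]\times\Omega),\ z^2\le M\big\}.$$ For a maximizer $(E,B)$ set $q:=-E$ (the optimal flux) and $\rho:=\mathcal L+2B$ (so $\rho\ge0$ and $\partial_t\rho+\partial_xq=0$ in the sense of distributions on $(0,T)\times\Omega$). Known fact (Brenier): $q$ is absolutely continuous with respect to $\rho$, and $dq=v^T\,d\rho$. *)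

(* Defs.v *)
From HB Require Import structures.
From mathcomp Require Import all_boot all_order all_algebra.
From mathcomp Require Import all_classical all_reals all_analysis.

Set Implicit Arguments.
Unset Strict Implicit.
Unset Printing Implicit Defensive.

Import Order.TTheory GRing.Theory Num.Theory.
Import numFieldNormedType.Exports.

Local Open Scope classical_set_scope.
Local Open Scope ring_scope.

(* Conventions.  The circle R/Z is handled through its universal cover and its
   fundamental domain [0, 1): a function on [0, T] x R/Z is a function of
   (t, x) : R * R that is 1-periodic in x for t in [0, T], and a finite signed
   Radon measure on [0, T] x R/Z is a finite signed Borel measure on R * R
   concentrated on [0, T] x [0, 1). *)

Section SpaceTime.
Context {R : realType}.
Implicit Types (T : R) (f g : R * R -> R).

Definition strip T : set (R * R) := `[0, T] `*` setT.

Definition cell T : set (R * R) := `[0, T] `*` `[0, 1[.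

Definition space_periodic T f :=
  forall t x, t \in `[0, T] -> f (t, x + 1) = f (t, x).

Definition continuous_on_torus T f :=
  space_periodic T f /\ {within strip T, continuous f}.

Definition dt f : R * R -> R := fun p => 'D_(1, 0) f p.
Definition dx f : R * R -> R := fun p => 'D_(0, 1) f p.

Fixpoint differentiable_class (n : nat) f : Prop :=
  continuous f /\
  if n is m.+1 then
    [/\ forall p, derivable f p (1, 0), forall p, derivable f p (0, 1),
        differentiable_class m (dt f) & differentiable_class m (dx f)]
  else True.

(* Smoothness up to the boundary of [0, T] x R/Z is taken in the sense of
   restrictions of smooth functions. *)
Definition test_function T f :=
  space_periodic T f /\ forall n, differentiable_class n f.

Definition vanishes_near_final_time T f :=
  set_nbhs ([set T] `*` setT) [set p | strip T p -> f p = 0].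

Definition smooth (h : R -> R) :=
  forall n x, derivable (derive1n n h) x 1.

End SpaceTime.

(* R * R with its Borel sigma-algebra, on which lebesgue_measure \x
   lebesgue_measure lives. *)
Definition plane (R : realType) : measurableType _ :=
  (measurableTypeR R * measurableTypeR R)%type.

Section Measures.
Context {R : realType}.
Implicit Type T : R.

Definition area : {measure set (plane R) -> \bar R} :=
  (@lebesgue_measure R \x @lebesgue_measure R)%E.

Lemma measurable_cell T : measurable (cell T : set (plane R)).
Proof. exact: measurableX. Qed.

Lemma area_cell T : (area (cell T) < +oo)%E.
Proof.
have -> : area (cell T) =
    (lebesgue_measure (`[0%R, T] : set R) *
     lebesgue_measure (`[0%R, 1%R[ : set R))%E by exact: product_measure1E.
rewrite !lebesgue_measure_itv/=.
by do 2?case: ifP => _; rewrite ?mule0 ?mul0e// -!EFinD -EFinM ltry.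
Qed.

Definition Leb T : {finite_measure set (plane R) -> \bar R} :=
  mfrestr (measurable_cell T) (area_cell T).

Definition concentrated T (mu : {charge set (plane R) -> \bar R}) :=
  forall A : set (plane R), measurable A -> A `&` cell T = set0 -> mu A = 0%E.

(* Integral of f against the signed measure mu, through its Jordan
   decomposition; the latter does not depend on the Hahn decomposition (P, N)
   that is chosen. *)
Definition pairing T (f : R * R -> R) (mu : {charge set (plane R) -> \bar R}) : R :=
  let: exist P HP := cid (Hahn_decomposition mu) in
  let: exist N PN := cid HP in
  \int[jordan_pos PN]_(p in cell T) f p - \int[jordan_neg PN]_(p in cell T) f p.

End Measures.

Section Dual.
Context {R : realType}.
Variables (T : R) (v0 : R -> R).
Implicit Types (E B : {charge set (plane R) -> \bar R}).

Definition rho B : {charge set (plane R) -> \bar R} :=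
  cadd (charge_of_finite_measure (Leb T)) (cscale 2 B).

Definition flux E : {charge set (plane R) -> \bar R} := copp E.

Definition admissible E B :=
  [/\ concentrated T E, concentrated T B,
      forall A : set (plane R), measurable A -> (0 <= rho B A)%E &
      forall Psi, test_function T Psi -> (forall x, Psi (0, x) = 0) ->
        pairing T (dt Psi) B - 2^-1 * pairing T (dx Psi) E = 0].

Definition Kfun E B : \bar R :=
  ereal_inf [set k | exists z M : R * R -> R,
    [/\ continuous_on_torus T z, continuous_on_torus T M,
        forall p, strip T p -> z p ^+ 2 <= M p &
        k = (pairing T z E + 2^-1 * pairing T M (rho B))%:E]].

Definition dual_objective E B : \bar R :=
  ((- pairing T (fun p => v0 p.2) E)%:E + Kfun E B)%E.

Definition dual_maximizer E B :=
  admissible E B /\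
  forall E' B', admissible E' B' ->
    (dual_objective E' B' <= dual_objective E B)%E.

End Dual.

Section ShockFree.
Context {R : realType}.
Variable T : R.

Definition convex_envelope (f g : R -> R) :=
  [/\ convex_function [set: R^o] g, forall x, g x <= f x &
      forall h : R -> R, convex_function [set: R^o] h ->
        (forall x, h x <= f x) -> forall x, h x <= g x].

(* The initial datum u0 is attained through the boundary term at t = 0. *)
Definition entropy_solution (u0 : R -> R) (u : R * R -> R) :=
  [/\ space_periodic T u, measurable_fun (strip T : set (plane R)) u,
      exists C, forall p, strip T p -> `|u p| <= C &
      forall eta Q theta, smooth eta -> smooth Q ->
        convex_function [set: R^o] eta ->
        (forall y, derive1 Q y = y * derive1 eta y) ->
        test_function T theta -> vanishes_near_final_time T theta ->
        (forall p, strip T p -> 0 <= theta p) ->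
        0 <= \int[Leb T]_(p in cell T)
               (eta (u p) * dt theta p + Q (u p) * dx theta p)
             + \int[lebesgue_measure]_(x in `[0, 1[) (eta (u0 x) * theta (0, x))].

Definition shock_free_substitute (v0 : R -> R) (vT : R * R -> R) :=
  exists phi phiT : R -> R,
    [/\ smooth phi, periodic phi 1, derive1 phi =1 v0,
        convex_envelope (fun x => x ^+ 2 / 2 + T * phi x)
                        (fun x => x ^+ 2 / 2 + T * phiT x) &
        entropy_solution (derive1 phiT) vT].

End ShockFree.

(* Main.v *)
(* Let phi' = v0, let S_t be the Hopf-Lax semigroup, S_t g (y) = inf_a g(a) + (y - a)^2/(2t), and put
   phi_t = S_t phi^T.  Both sides of the identity are shown to be equal to - int int phi_t psi_x.

   For the left-hand side one shows that phi_t is a potential of v^T.  The weak formulation says that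
   P(t, x) = phi^T(x) - 1/2 int_0^t v^T(s, x)^2 ds satisfies P_x = v^T weakly.  Mollifying along lines of
   slope c gives P <= phi_t, while the dissipation of energy gives int P(t) >= int phi_t, because the
   convexity of x^2/2 + T phi^T makes int (S_t phi^T - phi^T) = - t/2 int (u_0)^2 as long as t <= T.

   For the right-hand side let k = psi/(T - t) and Phi = int_0^t k.  A discretized optimal transport
   towards the minimizers of the Hopf-Lax formula shows that the dual value is at least
   int (phi - S_T phi).  Testing this bound with z = v0 - Psi_x + Phi, where Psi = phi - chi for a
   function chi with chi(0) = phi and chi_t + (chi_x + Phi)^2/2 <= 0, yields
   <Phi, q> <= int S_T phi - int chi(T).  For eps Phi such a chi is obtained by averaging over s the
   evolution that restarts at time s from phi_s + eps T H_s, minus eps T H_s, where H_s' = k(s, .).  Since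
   int (S_r g - g) >= - r/2 int (g')^2 for every g, expanding the square gives
   int chi(T) >= int S_T phi + eps int int phi_t psi_x - O(eps^2), and letting eps tend to 0 from both
   sides yields <Phi, q> = - int int phi_t psi_x. *)

Require Import Defs.
From HB Require Import structures.
From mathcomp Require Import all_boot all_order all_algebra.
From mathcomp Require Import all_classical all_reals all_analysis.
From mathcomp Require Import measurable_realfun ring lra.

Set Implicit Arguments.
Unset Strict Implicit.
Unset Printing Implicit Defensive.

Import Order.TTheory GRing.Theory Num.Theory.
Import numFieldNormedType.Exports.

Local Open Scope classical_set_scope.
Local Open Scope ring_scope.

(** * Integrals on intervals *)

(** The weight 1/(T - s) reflects the remaining time: a profile restarted at time s evolves for T -
    s, so the first variation of its energy carries the factor T - s, which turns k(s, .) back into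
    psi(s, .). The factor T in eps T H_s compensates the average over s: at time t the layers with s
    <= t contribute the mean slope eps T (1/T) int_0^t k(s, .) ds = eps Phi. The obstacle is
    regularity, since Psi has to be smooth while Hopf-Lax functions are Lipschitz. Hence chi is
    built from discrete time slices, and being a subsolution is expressed without derivatives, by
    one inequality along each line of slope c with |c| <= C. These inequalities are affine in chi,
    so they survive averaging over s, mollification in x and Bernstein interpolation in t; the
    square reappears only at the end, when c = v0 - Psi_x + Phi is inserted. For v^T, the potential
    P is merely bounded and measurable. It is compared with phi_t through integrals against
    nonnegative periodic weights, and the upper bound together with the reverse inequality for the
    total mass forces equality. *)

Section IntervalIntegral.
Context {R : realType}.
Local Notation mu := (@lebesgue_measure R).
Implicit Types (f g : R -> R) (a b c x : R).

(** The common side condition of the integral identities: it is stable under sums and products,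
    which integrability alone is not, and it gives integrability on every compact interval. *)
Definition locbm f := measurable_fun setT f /\
  forall a b, exists M, forall x, a <= x <= b -> `|f x| <= M.

(* Oriented: at most one of the two terms is nonzero, the interval with reversed bounds being empty. *)
Definition intv a b f : R :=
  \int[mu]_(x in `[a, b]) f x - \int[mu]_(x in `[b, a]) f x.

Lemma locbm_cont f : continuous f -> locbm f.
Proof.
move=> cf; split; first exact: continuous_measurable_fun.
move=> a b; have [ab|ba] := leP a b; last first.
  by exists 0 => x /andP[ax xb]; have := le_lt_trans (le_trans ax xb) ba; rewrite ltxx.
have cf' : {within `[a, b], continuous f} by apply: continuous_subspaceT.
have [c _ hc] := EVT_max ab cf'.
have [d _ hd] := EVT_min ab cf'.
exists (`|f c| + `|f d|) => x xab.
have h1 := hc x; have h2 := hd x; rewrite in_itv/= in h1 h2.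
have {}h1 := h1 xab; have {}h2 := h2 xab.
rewrite ler_norml; apply/andP; split.
  rewrite lerNl; have := ler_norm (- f d); rewrite normrN; have := normr_ge0 (f c); lra.
have := ler_norm (f c); have := normr_ge0 (f d); lra.
Qed.

Lemma locbm_cst c : locbm (fun=> c).
Proof. by apply: locbm_cont => ?; exact: cvg_cst. Qed.

Lemma locbmD f g : locbm f -> locbm g -> locbm (fun x => f x + g x).
Proof.
move=> [mf bf] [mg bg]; split; first exact: measurable_funD.
move=> a b; have [M hM] := bf a b; have [N hN] := bg a b.
exists (M + N) => x h; rewrite (le_trans (ler_normD _ _))// lerD//; [exact: hM|exact: hN].
Qed.

Lemma locbmM f g : locbm f -> locbm g -> locbm (fun x => f x * g x).
Proof.
move=> [mf bf] [mg bg]; split; first exact: measurable_funM.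
move=> a b; have [M hM] := bf a b; have [N hN] := bg a b.
by exists (M * N) => x h; rewrite normrM ler_pM//; [exact: hM|exact: hN].
Qed.

Lemma locbmZ k f : locbm f -> locbm (fun x => k * f x).
Proof. by move=> hf; apply: locbmM => //; exact: locbm_cst. Qed.

Lemma locbmN f : locbm f -> locbm (fun x => - f x).
Proof.
by move=> /(locbmZ (-1)) h; under eq_fun do rewrite -mulN1r.
Qed.

Lemma locbmB f g : locbm f -> locbm g -> locbm (fun x => f x - g x).
Proof. by move=> hf /locbmN; exact: locbmD. Qed.

Lemma locbm_int f a b : locbm f -> mu.-integrable `[a, b] (EFin \o f).
Proof.
move=> [mf bf]; have [M hM] := bf a b.
apply: measurable_bounded_integrable => //.
- by rewrite /= lebesgue_measure_itv/=; case: ifP => _; rewrite ?ltry// -EFinD ltry.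
- exact: measurable_funTS.
- exists M; split; first exact: num_real.
  by move=> y My x /=; rewrite in_itv/= => /hM h; exact: le_trans h (ltW My).
Qed.

Lemma intvE a b f : a <= b -> intv a b f = \int[mu]_(x in `[a, b]) f x.
Proof.
rewrite /intv le_eqVlt => /predU1P[->|ab].
  by rewrite set_itv1 Rintegral_set1 subr0.
by rewrite [X in _ - X](_ : _ = 0) ?subr0// set_itv_ge ?Rintegral_set0// bnd_simp -ltNge.
Qed.

Lemma intv_co a b f : a <= b -> locbm f -> \int[mu]_(x in `[a, b[) f x = intv a b f.
Proof.
move=> ab hf; rewrite intvE// Rintegral_itv_bndo_bndc//.
by apply: integrableS (locbm_int a b hf) => //; apply: subset_itvl; rewrite bnd_simp.
Qed.

Lemma intvC a b f : intv a b f = - intv b a f.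
Proof. by rewrite /intv opprB. Qed.

Lemma intv_eq a b f g : a <= b -> (forall x, a <= x <= b -> f x = g x) ->
  intv a b f = intv a b g.
Proof.
move=> ab fg; rewrite !intvE//; apply: eq_Rintegral => x; rewrite inE/= in_itv/=.
exact: fg.
Qed.

Lemma intv_ext a b f g : f =1 g -> intv a b f = intv a b g.
Proof. by move=> /funext ->. Qed.

Lemma intvZ a b k f : locbm f -> intv a b (fun x => k * f x) = k * intv a b f.
Proof.
by move=> hf; rewrite /intv !RintegralZl//; try exact: locbm_int; rewrite mulrBr.
Qed.

Lemma intvD a b f g : locbm f -> locbm g ->
  intv a b (fun x => f x + g x) = intv a b f + intv a b g.
Proof.
by move=> hf hg; rewrite /intv !RintegralD//; try exact: locbm_int; ring.
Qed.

Lemma intvN a b f : locbm f -> intv a b (fun x => - f x) = - intv a b f.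
Proof.
move=> hf; rewrite -mulN1r -intvZ//; apply: intv_ext => x; ring.
Qed.

Lemma intvB a b f g : locbm f -> locbm g ->
  intv a b (fun x => f x - g x) = intv a b f - intv a b g.
Proof. by move=> hf hg; rewrite intvD ?intvN//; exact: locbmN. Qed.

Lemma intv_cst a b c : intv a b (fun=> c) = c * (b - a).
Proof.
have H u v : fine (mu `[u, v]) = if u < v then v - u else 0.
  by rewrite lebesgue_measure_itv/= lte_fin; case: ifP.
have HR u v : \int[mu]_(_ in `[u, v]) c = c * (if u < v then v - u else 0).
  by rewrite Rintegral_cst//=; congr (_ * _); exact: H.
by rewrite /intv !HR; case: (ltgtP a b) => [?|?|->] /=; ring.
Qed.

Lemma le_intv a b f g : a <= b -> locbm f -> locbm g ->
  (forall x, a <= x <= b -> f x <= g x) -> intv a b f <= intv a b g.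
Proof.
move=> ab hf hg fg; rewrite !intvE//; by apply: le_Rintegral => //; exact: locbm_int.
Qed.

Lemma intv_ge0 a b f : a <= b -> (forall x, a <= x <= b -> 0 <= f x) ->
  0 <= intv a b f.
Proof.
move=> ab f0; rewrite intvE//; apply: Rintegral_ge0 => x; rewrite /= in_itv/=.
exact: f0.
Qed.

Lemma intvxx a f : intv a a f = 0.
Proof. by rewrite /intv subrr. Qed.

Lemma intv_cat_le a b c f : a <= b -> b <= c -> locbm f ->
  intv a b f + intv b c f = intv a c f.
Proof.
move=> ab bc hf; rewrite !intvE//; last exact: le_trans bc.
have := @Rintegral_itvB R f (BLeft a) (BRight c) b (locbm_int a c hf).
rewrite !bnd_simp => /(_ ab bc); rewrite Rintegral_itv_obnd_cbnd => [<-|]; first by ring.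
by apply: integrableS (locbm_int b c hf) => //; apply: subset_itvr; rewrite bnd_simp.
Qed.

Lemma intv_cat b a c f : locbm f -> intv a b f + intv b c f = intv a c f.
Proof.
move=> hf.
have H x y z : x <= y -> y <= z -> intv x y f + intv y z f = intv x z f.
  by move=> *; exact: intv_cat_le.
wlog ac : a c / a <= c => [W|].
  have [ac|/ltW ca] := leP a c; first exact: W.
  by rewrite (intvC a c) -(W _ _ ca) (intvC a b) (intvC b c); ring.
have [ab|/ltW ba] := leP a b; last by rewrite -(H _ _ _ ba ac) (intvC a b); ring.
have [bc|/ltW cb] := leP b c; first exact: H.
by rewrite -(H _ _ _ ac cb) (intvC b c); ring.
Qed.

Lemma intv_norm_le a b f M : a <= b -> locbm f ->
  (forall x, a <= x <= b -> `|f x| <= M) -> `|intv a b f| <= M * (b - a).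
Proof.
move=> ab hf hM; rewrite -intv_cst ler_norml; apply/andP; split.
  rewrite -intvN; last exact: locbm_cst.
  apply: le_intv => //; first exact: locbm_cst.
  by move=> x /hM; rewrite ler_norml => /andP[].
apply: le_intv => //; first exact: locbm_cst.
by move=> x /hM; rewrite ler_norml => /andP[].
Qed.

Lemma intv_is_derive a f x : locbm f -> {for x, continuous f} ->
  is_derive x 1 (fun y => intv a y f) (f x).
Proof.
(* The base point is moved strictly to the left of both [a] and [x], so that [x] is interior to the
   interval of integration; the constant [intv c a f] is subtracted afterwards. *)
move=> hf cf; pose c := Num.min a x - 1.
have cx : c < x.
  by rewrite /c ltrBlDr (@le_lt_trans _ _ x)// ?ltrDl// ge_min lexx orbT.
have ca : c < a.
  by rewrite /c ltrBlDr (@le_lt_trans _ _ a)// ?ltrDl// ge_min lexx.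
have xu : x < x + 1 by rewrite ltrDl.
have [d1 d2] := @continuous_FTC1_closed R f c x (x + 1) xu (locbm_int _ _ hf) cx cf.
have D : is_derive x 1 (fun y => \int[mu]_(t in `[c, y]) f t) (f x).
  by apply: DeriveDef; [exact: d1|rewrite -derive1E; exact: d2].
have E : \forall y \near x, \int[mu]_(t in `[c, y]) f t - intv c a f = intv a y f.
  near=> y; rewrite -(intv_cat c a y hf) (intvC a c) -(@intvE c y).
    by rewrite addrC.
  by apply: ltW; near: y; exact: lt_nbhsr.
have D2 := is_deriveB D (is_derive_cst (intv c a f) x 1); rewrite subr0 in D2.
exact: near_eq_is_derive E D2.
Unshelve. all: by end_near.
Qed.

Lemma derive_cont f f' : (forall x, is_derive x 1 f (f' x)) -> continuous f.
Proof.
by move=> df x; apply/differentiable_continuous/derivable1_diffP; have [] := df x.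
Qed.

Lemma derive_eq0_cst f : (forall x, is_derive x 1 f 0) -> forall x y, f x = f y.
Proof. by move=> df x y; exact: is_derive_0_is_cst. Qed.

Lemma intv_FTC a b F f : continuous f -> (forall x, is_derive x 1 F (f x)) ->
  intv a b f = F b - F a.
Proof.
move=> cf dF; have hf := locbm_cont cf.
have H x : is_derive x 1 (fun y => intv a y f - F y) 0.
  rewrite -(subrr (f x)); exact: (is_deriveB (intv_is_derive a hf (cf x)) (dF x)).
by have /= := derive_eq0_cst H b a; rewrite intvxx; lra.
Qed.

End IntervalIntegral.

(** * Integrals on the plane *)

Section PlaneIntegral.
Context {R : realType}.
Local Notation mu := (@lebesgue_measure R).
Implicit Types (f g : R * R -> R) (a b c d x t r : R).

(** The sigma-algebra of [plane] is the product one, so the open set is written as the countable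
    union of the rational boxes that it contains. *)
Lemma open_measurable_plane (U : set (R * R)) : open U -> measurable (U : set (plane R)).
Proof.
move=> oU.
pose box (q q' s : rat) : set (R * R) :=
  `]ratr q - ratr s, ratr q + ratr s[ `*` `]ratr q' - ratr s, ratr q' + ratr s[.
pose V q q' s : set (R * R) := if `[< box q q' s `<=` U >] then box q q' s else set0.
have -> : U = \bigcup_q \bigcup_q' \bigcup_s V q q' s.
  apply/seteqP; split=> [[t x] Utx|p [q _ [q' _ [s _]]]]; last first.
    by rewrite /V; case: asboolP => // BU; exact: BU.
  have /nbhs_ballP[e /= e0 eU] : nbhs (t, x) U by apply: open_nbhs_nbhs.
  have e20 : 0 < e / 2 by rewrite divr_gt0.
  have [s] := rat_in_itvoo e20; rewrite in_itv/= => /andP[s0 se].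
  have [q] := @rat_in_itvoo R (t - ratr s) (t + ratr s) ltac:(lra).
  rewrite in_itv/= => /andP[q1 q2].
  have [q'] := @rat_in_itvoo R (x - ratr s) (x + ratr s) ltac:(lra).
  rewrite in_itv/= => /andP[q1' q2'].
  exists q => //; exists q' => //; exists s => //.
  rewrite /V; case: asboolP => [_|].
    by split; rewrite /= in_itv/=; apply/andP; split; lra.
  case=> -[t' x'] [/=]; rewrite !in_itv/= => /andP[h1 h2] /andP[h3 h4].
  by apply: eU; split; rewrite /ball/= ltr_norml; apply/andP; split; lra.
do 3 (apply: bigcupT_measurable_rat => ?).
rewrite /V; case: ifP => _ //.
by apply: measurableX; exact: measurable_itv.
Qed.

Lemma cont2_measurable f : continuous f -> measurable_fun setT (f : plane R -> R).
Proof.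
move=> /continuousP cf; apply: (measurability _ (RGenOpens.measurableE R)).
move=> _ [_ [a [b ->] <-]]; rewrite setTI; apply: open_measurable_plane.
exact/cf/interval_open.
Qed.

Definition locbm2 f := measurable_fun setT (f : plane R -> R) /\
  forall r, exists M, forall t x, `|t| <= r -> `|x| <= r -> `|f (t, x)| <= M.

Lemma cont2_bounded f r : continuous f ->
  exists M, forall t x, `|t| <= r -> `|x| <= r -> `|f (t, x)| <= M.
Proof.
move=> cf.
have K : compact (`[- r, r] `*` `[- r, r] : set (R * R)).
  by apply: compact_setX; exact: segment_compact.
have := continuous_compact (continuous_subspaceT cf) K.
move=> /compact_bounded[M [_ hM]]; exists (M + 1) => t x ht hx.
apply: (hM (M + 1)); first by rewrite ltrDl.
by exists (t, x) => //; split; rewrite /= in_itv/= -ler_norml.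
Qed.

Lemma locbm2_cont f : continuous f -> locbm2 f.
Proof. by move=> cf; split; [exact: cont2_measurable|move=> r; exact: cont2_bounded]. Qed.

Lemma locbm2D f g : locbm2 f -> locbm2 g -> locbm2 (fun p => f p + g p).
Proof.
move=> [mf bf] [mg bg]; split; first exact: measurable_funD.
move=> r; have [M hM] := bf r; have [N hN] := bg r.
exists (M + N) => t x h1 h2; rewrite (le_trans (ler_normD _ _))// lerD//; [exact: hM|exact: hN].
Qed.

Lemma locbm2M f g : locbm2 f -> locbm2 g -> locbm2 (fun p => f p * g p).
Proof.
move=> [mf bf] [mg bg]; split; first exact: measurable_funM.
move=> r; have [M hM] := bf r; have [N hN] := bg r.
by exists (M * N) => t x h1 h2; rewrite normrM ler_pM//; [exact: hM|exact: hN].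
Qed.

Lemma locbm2_cst c : locbm2 (fun=> c).
Proof. by apply: locbm2_cont => ?; exact: cvg_cst. Qed.

Lemma locbm2Z k f : locbm2 f -> locbm2 (fun p => k * f p).
Proof. by move=> hf; apply: locbm2M => //; exact: locbm2_cst. Qed.

Lemma locbm2N f : locbm2 f -> locbm2 (fun p => - f p).
Proof. by move=> /(locbm2Z (-1)) h; under eq_fun do rewrite -mulN1r. Qed.

Lemma locbm2B f g : locbm2 f -> locbm2 g -> locbm2 (fun p => f p - g p).
Proof. by move=> hf /locbm2N; exact: locbm2D. Qed.

Lemma locbm2_fst (h : R -> R) : locbm h -> locbm2 (fun p => h p.1).
Proof.
move=> [mh bh]; split; first exact: (measurableT_comp mh measurable_fst).
by move=> r; have [M hM] := bh (- r) r; exists M => t x ht hx; apply: hM; rewrite -ler_norml.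
Qed.

Lemma locbm2_snd (h : R -> R) : locbm h -> locbm2 (fun p => h p.2).
Proof.
move=> [mh bh]; split; first exact: (measurableT_comp mh measurable_snd).
by move=> r; have [M hM] := bh (- r) r; exists M => t x ht hx; apply: hM; rewrite -ler_norml.
Qed.

Lemma locbm2_comp (h : R -> R) f : locbm h -> locbm2 f -> locbm2 (fun p => h (f p)).
Proof.
move=> [mh bh] [mf bf]; split; first exact: (measurableT_comp mh mf).
move=> r; have [M hM] := bf r; have [N hN] := bh (- M) M.
by exists N => t x ht hx; apply: hN; rewrite -ler_norml; exact: hM.
Qed.

Lemma locbm2_swap f : locbm2 f -> locbm2 (fun p => f (p.2, p.1)).
Proof.
move=> [mf bf]; split.
  exact: (measurableT_comp mf (measurable_fun_pair measurable_snd measurable_fst)).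
by move=> r; have [M hM] := bf r; exists M => t x ht hx; exact: hM.
Qed.

Let absitv a b t : a <= t <= b -> `|t| <= `|a| + `|b|.
Proof.
move=> /andP[at_ tb]; rewrite ler_norml; apply/andP; split.
  have := normr_ge0 b; have := ler_norm (- a); rewrite normrN; lra.
have := normr_ge0 a; have := ler_norm b; lra.
Qed.

Lemma locbm2_slice1 f t : locbm2 f -> locbm (fun x => f (t, x)).
Proof.
move=> [mf bf]; split.
  apply: (measurableT_comp mf); exact: measurable_fun_pair.
move=> a b; have [M hM] := bf (`|t| + (`|a| + `|b|)).
exists M => x /absitv hx; apply: hM; first by rewrite lerDl addr_ge0.
by rewrite (le_trans hx)// lerDr.
Qed.

Lemma locbm2_slice2 f x : locbm2 f -> locbm (fun t => f (t, x)).
Proof. by move=> /locbm2_swap/(@locbm2_slice1 _ x). Qed.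

(** No integrability is assumed: positive and negative parts depend measurably on the parameter by
    Tonelli, and [fine] brings their difference back to the reals. The parameter space is general
    because it is later the whole plane. *)
Lemma measurable_param (dX : measure_display) (X : measurableType dX) (D : set R) (f : X * measurableTypeR R -> R) :
  measurable D -> measurable_fun setT f ->
  measurable_fun setT (fun u => \int[mu]_(x in D) f (u, x)).
Proof.
move=> mD mf.
pose g (p : X * measurableTypeR R) := f p * \1_D p.2.
have mg : measurable_fun setT g.
  apply: measurable_funM => //; apply: (measurableT_comp _ measurable_snd).
  exact: measurable_indic.
have -> : (fun u => \int[mu]_(x in D) f (u, x)) = (fun u => \int[mu]_x g (u, x)).
  apply/funext => u; rewrite Rintegral_mkcond; apply: eq_Rintegral => x _.
  by rewrite patchE /g indicE/=; case: ifPn => _; rewrite ?mulr1 ?mulr0.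
have mEg : measurable_fun setT (EFin \o g) by exact/measurable_EFinP.
have E u : (\int[mu]_x (g (u, x))%:E = \int[mu]_x (maxe (g (u, x))%:E 0) -
    \int[mu]_x (maxe (- (g (u, x))%:E) 0))%E.
  by rewrite integralE; congr (_ - _)%E; apply: eq_integral => x _;
    rewrite ?funeposE ?funenegE.
apply: (measurableT_comp (@fine_measurable _ _ measurableT)) => //.
under eq_fun do rewrite E.
apply: emeasurable_funB.
- apply: (@measurable_fun_fubini_tonelli_F _ _ _ _ _ mu (fun p => maxe (g p)%:E 0)%E).
  + exact: measurable_maxe.
  + by move=> p /=; rewrite le_max lexx orbT.
- apply: (@measurable_fun_fubini_tonelli_F _ _ _ _ _ mu (fun p => maxe (- (g p)%:E) 0)%E).
  + by apply: measurable_maxe => //; exact: measurableT_comp.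
  + by move=> p /=; rewrite le_max lexx orbT.
Qed.

Lemma locbm2_intv2 f c d : locbm2 f -> locbm (fun t => intv c d (fun x => f (t, x))).
Proof.
move=> hf; have [mf bf] := hf; split.
  by apply: measurable_funB; apply: measurable_param.
move=> a b; have [M hM] := bf (`|a| + `|b| + (`|c| + `|d|)).
exists (M * `|d - c|) => t /absitv ht.
wlog cd : c d hM / c <= d => [W|].
  have [cd|/ltW dc] := leP c d; first exact: W.
  rewrite intvC normrN (distrC d c); apply: W => //.
  by move=> t' x; rewrite (addrC `|d|); exact: hM.
rewrite (ger0_norm (_ : 0 <= d - c)) ?subr_ge0//; apply: intv_norm_le => //.
  exact: locbm2_slice1.
move=> x /absitv hx; apply: hM.
  by rewrite (le_trans ht)// lerDl addr_ge0.
by rewrite (le_trans hx)// lerDr addr_ge0.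
Qed.

(** The second factor [D] is left general in order to cover both closed intervals and the half-open
    fundamental domain. *)
Lemma area_fubini f (D : set R) a b c d : locbm2 f -> measurable D -> D `<=` `[c, d] ->
  \int[area]_(p in `[a, b] `*` D) f p = \int[mu]_(t in `[a, b]) \int[mu]_(x in D) f (t, x)
  /\ \int[area]_(p in `[a, b] `*` D) f p = \int[mu]_(x in D) \int[mu]_(t in `[a, b]) f (t, x).
Proof.
move=> hf mD Dcd; have [mf bf] := hf.
pose E : set (plane R) := `[a, b] `*` D.
have mE : measurable E by exact: measurableX.
have finE : (@area R E < +oo)%E.
  have -> : @area R E = (mu `[a, b] * mu D)%E by exact: product_measure1E.
  have h1 : (mu `[a, b] < +oo)%E.
    by rewrite /= lebesgue_measure_itv/=; case: ifP => _; rewrite ?ltry// -EFinD ltry.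
  have h2 : (mu D < +oo)%E.
    apply: (@le_lt_trans _ _ (mu `[c, d])); first by apply: le_measure; rewrite ?inE.
    by rewrite /= lebesgue_measure_itv/=; case: ifP => _; rewrite ?ltry// -EFinD ltry.
  by rewrite lte_mul_pinfty// ge0_fin_numE.
have iE : area.-integrable E (EFin \o f).
  apply: measurable_bounded_integrable => //; first exact: measurable_funTS.
  have [M hM] := bf (`|a| + `|b| + (`|c| + `|d|)).
  exists M; split; first exact: num_real.
  move=> y My -[t x] [/= + /Dcd]; rewrite !in_itv/= => /absitv ht /absitv hx.
  apply: le_trans (ltW My); apply: hM; first by rewrite (le_trans ht)// lerDl addr_ge0.
  by rewrite (le_trans hx)// lerDr addr_ge0.
have iT : area.-integrable setT ((EFin \o f) \_ E) by apply/integrable_restrict => //; rewrite setTI.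
have iD1 t : mu.-integrable D (EFin \o (fun x => f (t, x))).
  by apply: integrableS (locbm_int c d (locbm2_slice1 t hf)).
have iD2 x : mu.-integrable `[a, b] (EFin \o (fun t => f (t, x))).
  exact: locbm_int (locbm2_slice2 x hf).
split.
- rewrite {1}/Rintegral integral_mkcond -(integral12_prod_meas1 iT) /Rintegral.
  rewrite [in RHS]integral_mkcond; congr fine; apply: eq_integral => t _.
  rewrite /fubini_F patchE; case: ifPn => [tab|/negP tab].
    rewrite fineK; last exact: integrable_fin_num (iD1 t).
    rewrite [RHS]integral_mkcond; apply: eq_integral => x _.
    rewrite !patchE; rewrite inE in tab; case: ifPn => [|/negP h].
      by rewrite inE => -[_ xD]; rewrite mem_set.
    rewrite memNset// => xD; apply: h; rewrite inE; by split.
  rewrite integral0_eq// => x _; rewrite patchE memNset// => -[h _]; apply: tab.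
  by rewrite inE.
- rewrite {1}/Rintegral integral_mkcond -(integral21_prod_meas1 iT) /Rintegral.
  rewrite [in RHS]integral_mkcond; congr fine; apply: eq_integral => x _.
  rewrite /fubini_G patchE; case: ifPn => [xD|/negP xD].
    rewrite fineK; last exact: integrable_fin_num (iD2 x).
    rewrite [RHS]integral_mkcond; apply: eq_integral => t _.
    rewrite !patchE; rewrite inE in xD; case: ifPn => [|/negP h].
      by rewrite inE => -[tab _]; rewrite mem_set.
    rewrite memNset// => tab; apply: h; rewrite inE; by split.
  rewrite integral0_eq// => t _; rewrite patchE memNset// => -[_ h]; apply: xD.
  by rewrite inE.
Qed.

Lemma intv_fubini f a b c d : locbm2 f ->
  intv a b (fun t => intv c d (fun x => f (t, x))) =
  intv c d (fun x => intv a b (fun t => f (t, x))).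
Proof.
move=> hf; have hf' := locbm2_swap hf.
have H a' b' c' d' : a' <= b' -> c' <= d' ->
    intv a' b' (fun t => intv c' d' (fun x => f (t, x))) =
    intv c' d' (fun x => intv a' b' (fun t => f (t, x))).
  move=> ab cd; rewrite (intvE _ ab) (intvE _ cd).
  under eq_Rintegral do rewrite (intvE _ cd).
  under [in RHS]eq_Rintegral do rewrite (intvE _ ab).
  have [<- <-] := @area_fubini f `[c', d'] a' b' c' d' hf (measurable_itv _) (@subset_refl _ _).
  by [].
have G a' b' c' d' : a' <= b' ->
    intv a' b' (fun t => intv c' d' (fun x => f (t, x))) =
    intv c' d' (fun x => intv a' b' (fun t => f (t, x))).
  move=> ab; have [cd|/ltW dc] := leP c' d'; first exact: H.
  rewrite [RHS]intvC -H// -intvN; last exact: locbm2_intv2.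
  by apply: intv_ext => t; rewrite intvC.
have [ab|/ltW ba] := leP a b; first exact: G.
rewrite intvC G// -intvN; last exact: (locbm2_intv2 _ _ hf').
by apply: intv_ext => t; rewrite intvC opprK.
Qed.

Lemma Leb_integral T f : 0 <= T -> locbm2 f ->
  \int[Leb T]_(p in cell T) f p = intv 0 T (fun t => intv 0 1 (fun x => f (t, x))).
Proof.
move=> T0 hf.
transitivity (\int[area]_(p in cell T) f p).
  apply: (congr1 fine); apply: eq_measure_integral => A mA AD.
  have E : Leb T A = area (A `&` cell T) by [].
  by apply: (etrans E); rewrite (setIidl AD).
have D01 : `[0, 1[ `<=` (`[0, 1] : set R) by apply: subset_itvl; rewrite bnd_simp.
rewrite (intvE _ T0).
transitivity (\int[mu]_(t in `[0, T]) \int[mu]_(x in `[0, 1[) f (t, x)).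
  exact: (@area_fubini f _ 0 T 0 1 hf (measurable_itv _) D01).1.
apply: eq_Rintegral => t _; exact: (intv_co ler01 (locbm2_slice1 t hf)).
Qed.

End PlaneIntegral.

(** * Smooth functions *)

Section Smoothness.
Context {R : realType}.
Implicit Types (f g : R -> R) (x t e d h l : R).

Lemma is_derive_eps f x l :
  (forall e, 0 < e -> exists2 d, 0 < d &
     forall h, `|h| < d -> `|f (x + h) - f x - h * l| <= e * `|h|) ->
  is_derive x 1 f l.
Proof.
move=> H.
have C : (fun h => h^-1 *: ((f \o shift x) (h *: (1 : R)) - f x)) @ 0^' --> l.
  apply/cvgrPdist_le => e e0; have [d d0 hd] := H e e0.
  near=> h => /=.
  have h0 : h != 0 by near: h; exact: nbhs_dnbhs_neq.
  have hd' : `|h| < d by near: h; apply: dnbhs0_lt.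
  have := hd h hd'; rewrite -(ler_pM2l (_ : 0 < `|h|^-1)); last by rewrite invr_gt0 normr_gt0.
  rewrite -normfV -normrM mulrCA -normrM mulVf// normr1 mulr1.
  congr (_ <= _); rewrite -normrN; congr `|_|.
  rewrite /GRing.scale/= mulr1 (addrC h x); field.
  by [].
by apply: DeriveDef; [apply/cvg_ex; exists l | exact: cvg_lim].
Unshelve. all: by end_near.
Qed.

Lemma is_deriveP_eps f x l : is_derive x 1 f l ->
  forall e, 0 < e -> exists2 d, 0 < d &
     forall h, `|h| < d -> `|f (x + h) - f x - h * l| <= e * `|h|.
Proof.
move=> [dv lE] e e0; have := dv => /cvg_ex[l' hl'].
have El : l' = l by rewrite -lE; apply/esym/cvg_lim.
move: hl'; rewrite El => /cvgrPdist_le/(_ e e0).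
rewrite near_withinE near_nbhs => -[d /= d0 hd].
exists d => // h hh; have [->|h0] := eqVneq h 0.
  by rewrite addr0 subrr mul0r subr0 normr0 mulr0.
have := hd h; rewrite /ball/= sub0r normrN => /(_ hh h0).
rewrite -(ler_pM2r (_ : 0 < `|h|)) ?normr_gt0// -normrM; apply: le_trans.
rewrite le_eqVlt; apply/orP; left; apply/eqP; rewrite -normrN; congr `|_|.
by rewrite /GRing.scale/= mulr1 (addrC h x); field.
Qed.

Lemma is_derive_congr f g x l m : is_derive x 1 f l -> f =1 g -> l = m ->
  is_derive x 1 g m.
Proof. by move=> df /funext <- <-. Qed.

Lemma smooth_is_derive f x : smooth f -> is_derive x 1 f (derive1 f x).
Proof.
by move=> sf; apply: DeriveDef; [exact: (sf 0%N)|rewrite derive1E].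
Qed.

Lemma smooth_derive1 f : smooth f -> smooth (derive1 f).
Proof. by move=> sf n x; rewrite -derive1Sn; exact: sf. Qed.

Lemma smooth_cont f : smooth f -> continuous f.
Proof. by move=> sf; apply: derive_cont => x; exact: smooth_is_derive. Qed.

(** Coinduction for smoothness: a class of functions that contains a derivative of each of its
    members consists of smooth functions. The smoothness proofs below exhibit such a class. *)
Lemma smooth_coind (F : set (R -> R)) f : F f ->
  (forall g, F g -> exists2 g', F g' & forall x, is_derive x 1 g (g' x)) -> smooth f.
Proof.
move=> Ff HF n.
suff : forall n, F (derive1n n f) by move=> /(_ n)/HF[g' _ dg'] x; have [] := dg' x.
elim=> [//|m IH]; have [g' Fg' dg'] := HF _ IH.
rewrite derive1nS (_ : derive1 _ = g')//; apply/funext => x.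
by rewrite derive1E; have [_ ->] := dg' x.
Qed.

Lemma is_derive1_E f x l : is_derive x 1 f l -> derive1 f x = l.
Proof. by move=> [_ <-]; rewrite derive1E. Qed.

(** The class fed to [smooth_coind] for sums, products and compositions: by the product and chain
    rules it is closed under differentiation. *)
Inductive smooth_alg : (R -> R) -> Prop :=
| salg_base f : smooth f -> smooth_alg f
| salg_add f g : smooth_alg f -> smooth_alg g -> smooth_alg (fun x => f x + g x)
| salg_mul f g : smooth_alg f -> smooth_alg g -> smooth_alg (fun x => f x * g x)
| salg_comp f g : smooth f -> smooth_alg g -> smooth_alg (fun x => f (g x)).

Lemma smooth_alg_smooth f : smooth_alg f -> smooth f.
Proof.
move=> hf; apply: (smooth_coind hf) => {f hf} f; elim=> {f}.
- move=> f sf; exists (derive1 f) => [|x]; first exact/salg_base/smooth_derive1.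
  exact: smooth_is_derive.
- move=> f g _ [f' sf' df] _ [g' sg' dg]; exists (fun x => f' x + g' x) => [|x].
    exact: salg_add.
  exact: (is_deriveD (df x) (dg x)).
- move=> f g sf [f' sf' df] sg [g' sg' dg].
  exists (fun x => f x * g' x + g x * f' x) => [|x].
    by apply: salg_add; apply: salg_mul.
  exact: (is_deriveM (df x) (dg x)).
- move=> f g sf sg [g' sg' dg]; exists (fun x => derive1 f (g x) * g' x) => [|x].
    by apply: (salg_mul (salg_comp (smooth_derive1 sf) sg) sg').
  exact: (is_derive1_comp (smooth_is_derive (g x) sf) (dg x)).
Qed.

Lemma smoothD f g : smooth f -> smooth g -> smooth (fun x => f x + g x).
Proof. by move=> *; apply/smooth_alg_smooth/salg_add; exact: salg_base. Qed.

Lemma smoothM f g : smooth f -> smooth g -> smooth (fun x => f x * g x).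
Proof. by move=> *; apply/smooth_alg_smooth/salg_mul; exact: salg_base. Qed.

Lemma smooth_comp f g : smooth f -> smooth g -> smooth (fun x => f (g x)).
Proof. by move=> *; apply/smooth_alg_smooth/salg_comp => //; exact: salg_base. Qed.

Lemma smooth_cst c : smooth (fun _ : R => c).
Proof.
apply: (@smooth_coind [set f | exists k, f = fun=> k]); first by exists c.
move=> g [k ->]; exists (fun=> 0) => [|x]; first by exists 0.
exact: is_derive_cst.
Qed.

Lemma smooth_id : smooth (fun x : R => x).
Proof.
apply: (@smooth_coind [set f | f = id \/ smooth f]); first by left.
move=> g [->|sg].
  by exists (fun=> 1) => [|x]; [right; exact: smooth_cst|exact: is_derive_id].
exists (derive1 g) => [|x]; first by right; exact: smooth_derive1.
exact: smooth_is_derive.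
Qed.

Lemma smoothZ k f : smooth f -> smooth (fun x => k * f x).
Proof. by move=> sf; exact: (smoothM (@smooth_cst k) sf). Qed.

Lemma smooth_aff a b : smooth (fun x : R => a + b * x).
Proof. by apply: smoothD; [exact: smooth_cst|apply: smoothZ; exact: smooth_id]. Qed.

Lemma smooth_cos : smooth (@cos R).
Proof.
apply: (@smooth_coind [set f | exists a b, f = fun x => a * cos x + b * sin x]).
  by exists 1, 0; apply/funext => x; rewrite mul1r mul0r addr0.
move=> g [a [b ->]]; exists (fun x => b * cos x + (- a) * sin x) => [|x].
  by exists b, (- a).
have := is_deriveD (is_deriveZ a (is_derive_cos x)) (is_deriveZ b (is_derive_sin x)).
by move/is_derive_congr; apply=> //; rewrite /GRing.scale/=; ring.
Qed.

(** For k = 0 this is the classical flat function exp(-1/x). The factors x^-k are what its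
    derivatives produce. *)
Definition flat (k : nat) x : R := if 0 < x then x ^- k * expR (- x^-1) else 0.

(** With y = 1/x, the bound exp y >= y^(k+1)/(k+1)! absorbs the pole x^-k and leaves one factor x to
    spare. *)
Lemma flat_bound k x : 0 < x -> x ^- k * expR (- x^-1) <= k.+1`!%:R * x.
Proof.
move=> x0; rewrite expRN.
have y0 : 0 < x^-1 by rewrite invr_gt0.
have F0 : 0 < k.+1`!%:R :> R by rewrite ltr0n fact_gt0.
have h1 : x^-1 ^+ k.+1 / k.+1`!%:R <= expR x^-1.
  by apply: le_trans (expR_ge1Dxn k (ltW y0)); rewrite lerDr.
rewrite -exprVn ler_pdivrMr ?expR_gt0// -mulrA.
rewrite ler_pdivrMr// in h1.
have h2 : x * (x^-1 ^+ k.+1) <= x * (expR x^-1 * k.+1`!%:R) by rewrite ler_pM2l.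
have h3 : x * x^-1 ^+ k.+1 = x^-1 ^+ k.
  by rewrite exprS mulrA mulfV ?mul1r// gt_eqF.
rewrite h3 in h2; apply: le_trans h2 _; rewrite le_eqVlt; apply/orP; left; apply/eqP; ring.
Qed.

Lemma flat_ge0 k x : 0 <= flat k x.
Proof.
by rewrite /flat; case: ifP => // x0; rewrite mulr_ge0 ?expR_ge0// invr_ge0 exprn_ge0 ?ltW.
Qed.

Lemma is_derive_flat k x :
  is_derive x 1 (flat k) (- k%:R * flat k.+1 x + flat k.+2 x).
Proof.
have [x0|x0|->] := ltgtP x 0.
- have -> : - k%:R * flat k.+1 x + flat k.+2 x = 0.
    by rewrite /flat !ltNge (ltW x0)/= mulr0 addr0.
  have D0 : is_derive x 1 (fun _ : R => 0 : R) 0 by exact: is_derive_cst.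
  apply: near_eq_is_derive D0.
  near=> y; rewrite /flat ltNge (_ : y <= 0)//.
  by apply: ltW; near: y; exact: lt_nbhsl.
- have -> : - k%:R * flat k.+1 x + flat k.+2 x =
      - k%:R * (x^-1 ^+ k.+1 * expR (- x^-1)) + x^-1 ^+ k.+2 * expR (- x^-1).
    by rewrite /flat x0 -!exprVn.
  have x0' : x != 0 by rewrite gt_eqF.
  have dV : is_derive x 1 (fun y : R => y^-1) (- x ^- 2).
    have := is_deriveV x0' (is_derive_id x 1).
    by move/is_derive_congr; apply=> //; rewrite /GRing.scale/= mulr1.
  have dX : is_derive x 1 (fun y : R => y^-1 ^+ k) (k%:R * x^-1 ^+ k.-1 * - x ^- 2).
    have := is_deriveX k dV; move/is_derive_congr; apply=> [y|].
      by rewrite fctE.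
    by rewrite /GRing.scale/= -mulr_natl; ring.
  have dE : is_derive x 1 (fun y : R => expR (- y^-1)) (expR (- x^-1) * x ^- 2).
    have := @is_derive1_comp R expR (fun y => - y^-1) x _ _ (is_derive_expR _) (is_deriveN dV).
    by move/is_derive_congr; apply=> //; rewrite opprK.
  have H : is_derive x 1 (fun y => y^-1 ^+ k * expR (- y^-1))
      (- k%:R * (x^-1 ^+ k.+1 * expR (- x^-1)) + x^-1 ^+ k.+2 * expR (- x^-1)); last first.
    apply: near_eq_is_derive H; near=> y; rewrite /flat (_ : 0 < y) ?exprVn//.
    by near: y; exact: lt_nbhsr.
  have := is_deriveM dX dE; move/is_derive_congr; apply=> //.
  rewrite /GRing.scale/= -exprVn.
  case: k {dX} => [|k] /=; first by rewrite !(expr0, mulr0n, mul0r, oppr0); ring.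
  by rewrite !exprS; ring.
(* At 0 one factor h is split off: [flat k h] is h times [flat k.+1 h], and [flat_bound] makes the
   second factor O(h), so the difference quotient tends to 0. *)
- rewrite /flat ltxx mulr0 addr0; apply: is_derive_eps => e e0.
  have C0 : 0 < k.+2`!%:R :> R by rewrite ltr0n fact_gt0.
  exists (e / k.+2`!%:R) => [|h hh]; first by rewrite divr_gt0.
  rewrite ltxx subr0 mulr0 subr0 add0r; case: ifPn => [h0|_]; last first.
    by rewrite normr0 mulr_ge0// ltW.
  rewrite ger0_norm; last by have := flat_ge0 k h; rewrite /flat h0.
  have E : h ^- k * expR (- h^-1) = h * (h ^- k.+1 * expR (- h^-1)).
    by rewrite -!exprVn exprS !mulrA mulfV ?mul1r// gt_eqF.
  rewrite gtr0_norm// in hh; rewrite gtr0_norm// E mulrC ler_pM2r//.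
  apply: le_trans (flat_bound k.+1 h0) _.
  by rewrite ltr_pdivlMr// in hh; rewrite mulrC ltW.
Unshelve. all: by end_near.
Qed.

Inductive flat_span : (R -> R) -> Prop :=
| fspan_base k : flat_span (flat k)
| fspan_scale c f : flat_span f -> flat_span (fun x => c * f x)
| fspan_add f g : flat_span f -> flat_span g -> flat_span (fun x => f x + g x).

Lemma smooth_flat k : smooth (flat k).
Proof.
apply: (smooth_coind (fspan_base k)) => g; elim=> {g k}.
- move=> k; exists (fun x => - k%:R * flat k.+1 x + flat k.+2 x) => [|x].
    by apply: fspan_add; [apply: fspan_scale|]; exact: fspan_base.
  exact: is_derive_flat.
- move=> c f _ [f' sf df]; exists (fun x => c * f' x) => [|x]; first exact: fspan_scale.
  exact: (is_deriveZ c (df x)).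
- move=> f g _ [f' sf' df] _ [g' sg' dg]; exists (fun x => f' x + g' x) => [|x].
    exact: fspan_add.
  exact: (is_deriveD (df x) (dg x)).
Qed.

Definition cutoff x : R := flat 0 x.

Lemma smooth_cutoff : smooth cutoff. Proof. exact: smooth_flat. Qed.
Lemma cutoff_ge0 x : 0 <= cutoff x. Proof. exact: flat_ge0. Qed.
Lemma cutoff_gt0 x : 0 < x -> 0 < cutoff x.
Proof. by move=> x0; rewrite /cutoff/flat x0 expr0 invr1 mul1r expR_gt0. Qed.
Lemma cutoff_eq0 x : x <= 0 -> cutoff x = 0.
Proof. by move=> x0; rewrite /cutoff/flat ltNge x0. Qed.

End Smoothness.

(** * Partial derivatives and test functions *)

Section PartialDerivatives.
Context {R : realType}.
Implicit Types (f g : R * R -> R) (t x : R).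

Lemma is_derive_dtP f t x l :
  is_derive (t, x) (1, 0) f l <-> is_derive t 1 (fun s => f (s, x)) l.
Proof.
have E : (fun h : R => h^-1 *: ((f \o shift (t, x)) (h *: ((1, 0) : R * R)) - f (t, x))) =
    (fun h : R => h^-1 *: (((fun s => f (s, x)) \o shift t) (h *: (1 : R)) - f (t, x))).
  apply/funext => h /=; congr (_ *: (f (_, _) - _)).
  by rewrite /= /GRing.scale/= mulr0 add0r.
by split=> -[d <-]; split; move: d; rewrite /derivable /derive E.
Qed.

Lemma is_derive_dxP f t x l :
  is_derive (t, x) (0, 1) f l <-> is_derive x 1 (fun y => f (t, y)) l.
Proof.
have E : (fun h : R => h^-1 *: ((f \o shift (t, x)) (h *: ((0, 1) : R * R)) - f (t, x))) =
    (fun h : R => h^-1 *: (((fun y => f (t, y)) \o shift x) (h *: (1 : R)) - f (t, x))).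
  apply/funext => h /=; congr (_ *: (f (_, _) - _)).
  by rewrite /= /GRing.scale/= mulr0 add0r.
by split=> -[d <-]; split; move: d; rewrite /derivable /derive E.
Qed.

Lemma is_derive_dt f t x : derivable f (t, x) (1, 0) ->
  is_derive t 1 (fun s => f (s, x)) (dt f (t, x)).
Proof. by move=> d; apply/is_derive_dtP; exact: DeriveDef. Qed.

Lemma is_derive_dx f t x : derivable f (t, x) (0, 1) ->
  is_derive x 1 (fun y => f (t, y)) (dx f (t, x)).
Proof. by move=> d; apply/is_derive_dxP; exact: DeriveDef. Qed.

Lemma dtE f g : (forall t x, is_derive t 1 (fun s => f (s, x)) (g (t, x))) -> dt f = g.
Proof. by move=> H; apply/funext => -[t x]; have /is_derive_dtP[_] := H t x. Qed.

Lemma dxE f g : (forall t x, is_derive x 1 (fun y => f (t, y)) (g (t, x))) -> dx f = g.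
Proof. by move=> H; apply/funext => -[t x]; have /is_derive_dxP[_] := H t x. Qed.

Lemma differentiable_class_step n f g h : continuous f ->
  (forall t x, is_derive t 1 (fun s => f (s, x)) (g (t, x))) ->
  (forall t x, is_derive x 1 (fun y => f (t, y)) (h (t, x))) ->
  differentiable_class n g -> differentiable_class n h -> differentiable_class n.+1 f.
Proof.
move=> cf dg dh cg ch; split=> //; rewrite (dtE dg) (dxE dh); split=> //.
- by move=> -[t x]; have /is_derive_dtP[] := dg t x.
- by move=> -[t x]; have /is_derive_dxP[] := dh t x.
Qed.

(** The algebra generated by ridge functions. It contains the explicit test functions built below
    (cut-offs in time, kernels moving along lines, Bernstein surfaces) and is closed under both
    partial derivatives. *)
Inductive smooth2 : (R * R -> R) -> Prop :=
| smooth2_lin (a : R -> R) (al be : R) : smooth a -> smooth2 (fun p => a (al * p.1 + be * p.2))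
| smooth2_add f g : smooth2 f -> smooth2 g -> smooth2 (fun p => f p + g p)
| smooth2_mul f g : smooth2 f -> smooth2 g -> smooth2 (fun p => f p * g p).

Lemma smooth2_partials f : smooth2 f -> continuous f /\ exists g h, [/\ smooth2 g, smooth2 h,
  forall t x, is_derive t 1 (fun s => f (s, x)) (g (t, x)) &
  forall t x, is_derive x 1 (fun y => f (t, y)) (h (t, x))].
Proof.
elim=> {f}.
- move=> a al be sa.
  have K c : smooth2 (fun p => c * derive1 a (al * p.1 + be * p.2)).
    by apply: (@smooth2_lin (fun x => c * derive1 a x)); apply: smoothZ; exact: smooth_derive1.
  split.
    move=> p; apply: (@continuous_comp _ _ _ (fun p : R * R => al * p.1 + be * p.2) a).
      by apply: cvgD; apply: cvgM; [exact: cvg_cst|exact: cvg_fst|exact: cvg_cst|exact: cvg_snd].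
    exact: smooth_cont.
  exists (fun p => al * derive1 a (al * p.1 + be * p.2)), (fun p => be * derive1 a (al * p.1 + be * p.2)).
  split=> // t x /=.
    have L : is_derive t 1 (fun s : R => al * s + be * x) al.
      have := is_deriveD (is_deriveZ al (is_derive_id t 1)) (is_derive_cst (be * x) t 1).
      by move/is_derive_congr; apply=> //; rewrite /GRing.scale/=; ring.
    by have := @is_derive1_comp R a (fun s => al * s + be * x) t _ _ (smooth_is_derive _ sa) L; move/is_derive_congr; apply=> //; exact: mulrC.
  have L : is_derive x 1 (fun s : R => al * t + be * s) be.
    have := is_deriveD (is_derive_cst (al * t) x 1) (is_deriveZ be (is_derive_id x 1)).
    by move/is_derive_congr; apply=> //; rewrite /GRing.scale/=; ring.
  by have := @is_derive1_comp R a (fun s => al * t + be * s) x _ _ (smooth_is_derive _ sa) L; move/is_derive_congr; apply=> //; exact: mulrC.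
- move=> f g _ [cf [f1 [f2 [sf1 sf2 df1 df2]]]] _ [cg [g1 [g2 [sg1 sg2 dg1 dg2]]]]; split.
    by move=> p; apply: cvgD; [exact: cf|exact: cg].
  exists (fun p => f1 p + g1 p), (fun p => f2 p + g2 p); split; try exact: smooth2_add.
    by move=> t x; exact: (is_deriveD (df1 t x) (dg1 t x)).
  by move=> t x; exact: (is_deriveD (df2 t x) (dg2 t x)).
- move=> f g sf [cf [f1 [f2 [sf1 sf2 df1 df2]]]] sg [cg [g1 [g2 [sg1 sg2 dg1 dg2]]]]; split.
    by move=> p; apply: cvgM; [exact: cf|exact: cg].
  exists (fun p => f p * g1 p + g p * f1 p), (fun p => f p * g2 p + g p * f2 p); split.
  + by apply: smooth2_add; apply: smooth2_mul.
  + by apply: smooth2_add; apply: smooth2_mul.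
  + by move=> t x; exact: (is_deriveM (df1 t x) (dg1 t x)).
  + by move=> t x; exact: (is_deriveM (df2 t x) (dg2 t x)).
Qed.

Lemma smooth2_differentiable n f : smooth2 f -> differentiable_class n f.
Proof.
elim: n f => [|n IH] f sf; first by have [] := smooth2_partials sf.
have [cf [g [h [sg sh dg dh]]]] := smooth2_partials sf.
by apply: (differentiable_class_step cf dg dh); exact: IH.
Qed.

Lemma smooth2_fst (a : R -> R) : smooth a -> smooth2 (fun p => a p.1).
Proof.
by move=> /(@smooth2_lin a 1 0); under eq_fun do rewrite mul1r mul0r addr0.
Qed.

Lemma smooth2_snd (a : R -> R) : smooth a -> smooth2 (fun p => a p.2).
Proof.
by move=> /(@smooth2_lin a 0 1); under eq_fun do rewrite mul1r mul0r add0r.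
Qed.

Section TestFunction.
Variables (T : R) (f : R * R -> R).
Hypothesis tf : test_function T f.

Lemma test_cont : continuous f. Proof. by have [_ /(_ 0%N)[]] := tf. Qed.

Lemma test_dt t x : is_derive t 1 (fun s => f (s, x)) (dt f (t, x)).
Proof. by have [_ /(_ 1%N)[_ [d _ _ _]]] := tf; exact: is_derive_dt. Qed.

Lemma test_dx t x : is_derive x 1 (fun y => f (t, y)) (dx f (t, x)).
Proof. by have [_ /(_ 1%N)[_ [_ d _ _]]] := tf; exact: is_derive_dx. Qed.

Lemma test_dt_class n : differentiable_class n (dt f).
Proof. by have [_ /(_ n.+1)[_ []]] := tf. Qed.

Lemma test_dx_class n : differentiable_class n (dx f).
Proof. by have [_ /(_ n.+1)[_ []]] := tf. Qed.

Lemma test_dt_cont : continuous (dt f). Proof. by have [] := test_dt_class 0. Qed.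
Lemma test_dx_cont : continuous (dx f). Proof. by have [] := test_dx_class 0. Qed.

Lemma test_dx_test : test_function T (dx f).
Proof.
split; last exact: test_dx_class.
move=> t x tT.
have [P _] := tf.
have d1 := test_dx t (x + 1).
have S : is_derive x 1 (fun y : R => y + 1) 1.
  by have := is_deriveD (is_derive_id x 1) (is_derive_cst (1 : R) x 1);
    move/is_derive_congr; apply=> //; rewrite addr0.
have d2 : is_derive x 1 (fun y => f (t, y)) (dx f (t, x + 1)).
  have /is_derive_congr := @is_derive1_comp R (fun y => f (t, y)) (fun y => y + 1) x _ _ d1 S.
  by apply; [move=> y /=; exact: P|rewrite mulr1].
by have [_ <-] := d2; have [_ <-] := test_dx t x.
Qed.

End TestFunction.

(** Chain rule along a straight line from continuity of the partial derivatives: the increment is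
    split into a step in t followed by a step in x, with the mean value theorem on each. *)
Lemma C1_line f (a b al be s : R) : continuous (dt f) -> continuous (dx f) ->
  (forall t x, is_derive t 1 (fun s => f (s, x)) (dt f (t, x))) ->
  (forall t x, is_derive x 1 (fun s => f (t, s)) (dx f (t, x))) ->
  is_derive s 1 (fun s => f (a + s * al, b + s * be))
    (al * dt f (a + s * al, b + s * be) + be * dx f (a + s * al, b + s * be)).
Proof.
move=> ct cx dft dfx; apply: is_derive_eps => e e0.
set p := (a + s * al, b + s * be).
pose e' := e / (`|al| + `|be| + 1).
have N0 : 0 < `|al| + `|be| + 1 by rewrite ltr_wpDl// addr_ge0.
have e'0 : 0 < e' by rewrite divr_gt0.
have /cvgrPdist_lt/(_ e' e'0)/nbhs_ballP[d1 /= d10 h1] := ct p.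
have /cvgrPdist_lt/(_ e' e'0)/nbhs_ballP[d2 /= d20 h2] := cx p.
pose d := Num.min d1 d2 / (`|al| + `|be| + 1).
have d0 : 0 < d by rewrite divr_gt0// lt_min d10 d20.
exists d => // h hd.
have H (y z : R) : `|y| <= `|h * al| -> `|z| <= `|h * be| ->
    `|dt f p - dt f (p.1 + y, p.2 + z)| < e' /\ `|dx f p - dx f (p.1 + y, p.2 + z)| < e'.
  move=> hy hz.
  have B (w c : R) : `|w| <= `|h * c| -> `|c| <= `|al| + `|be| + 1 -> `|w| < Num.min d1 d2.
    move=> hw hc; apply: (le_lt_trans hw); rewrite normrM.
    apply: (@le_lt_trans _ _ (`|h| * (`|al| + `|be| + 1))); first by rewrite ler_wpM2l.
    by rewrite -ltr_pdivlMr.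
  have Ba : `|al| <= `|al| + `|be| + 1 by have := normr_ge0 be; lra.
  have Bb : `|be| <= `|al| + `|be| + 1 by have := normr_ge0 al; lra.
  have := B _ _ hy Ba; rewrite lt_min => /andP[y1 y2].
  have := B _ _ hz Bb; rewrite lt_min => /andP[z1 z2].
  by split; [apply: h1|apply: h2]; split; rewrite /ball/= opprD addNKr normrN.
have MV (F F' : R -> R) (u w : R) : (forall v : R, is_derive v 1 F (F' v)) ->
    exists2 c, `|c| <= `|w| & F (u + w) - F u = F' (u + c) * w.
  move=> dF; have cF : continuous F by exact: derive_cont dF.
  have [w0|w0] := leP 0 w.
    have uw : u <= u + w by rewrite lerDl.
    have [c] := MVT_segment uw (fun x _ => dF x) (continuous_subspaceT cF).
    rewrite in_itv/= => /andP[c1 c2] ->; exists (c - u); last by congr (F' _ * _); ring.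
    by rewrite !ger0_norm// ?subr_ge0//; lra.
  have uw : u + w <= u by rewrite gerDl ltW.
  have [c] := MVT_segment uw (fun x _ => dF x) (continuous_subspaceT cF).
  rewrite in_itv/= => /andP[c1 c2] E; exists (c - u).
    rewrite ler0_norm ?ltr0_norm//; last by rewrite subr_le0.
    lra.
  by rewrite -opprB E (addrC u (c - u)) subrK; ring.
have [c1 hc1 E1] := MV _ _ p.1 (h * al) (fun v => dft v (p.2 + h * be)).
have [c2 hc2 E2] := MV _ _ p.2 (h * be) (fun v => dfx p.1 v).
have [K1 _] := H c1 (h * be) hc1 (lexx _).
have [_ K2] := H 0 c2 (ltac:(by rewrite normr0)) hc2; rewrite addr0 in K2.
have -> : f (a + (s + h) * al, b + (s + h) * be) - f p -
    h * (al * dt f p + be * dx f p) =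
    - (dt f p - dt f (p.1 + c1, p.2 + h * be)) * (h * al)
    - (dx f p - dx f (p.1, p.2 + c2)) * (h * be).
  have -> : f (a + (s + h) * al, b + (s + h) * be) = f (p.1 + h * al, p.2 + h * be).
    by rewrite /p /=; congr (f (_, _)); ring.
  have -> : f (p.1 + h * al, p.2 + h * be) - f p =
      dt f (p.1 + c1, p.2 + h * be) * (h * al) + dx f (p.1, p.2 + c2) * (h * be).
    by rewrite -E1 -E2 addrA subrK.
  by ring.
apply: (le_trans (ler_normB _ _)); rewrite !normrM normrN.
have S1 : `|dt f p - dt f (p.1 + c1, p.2 + h * be)| * (`|h| * `|al|) <= e' * (`|h| * `|al|).
  by rewrite ler_wpM2r ?mulr_ge0// ltW.
have S2 : `|dx f p - dx f (p.1, p.2 + c2)| * (`|h| * `|be|) <= e' * (`|h| * `|be|).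
  by rewrite ler_wpM2r ?mulr_ge0// ltW.
apply: (le_trans (lerD S1 S2)).
have -> : e = e' * (`|al| + `|be| + 1) by rewrite /e' divfK// gt_eqF.
by have := mulr_ge0 (ltW e'0) (normr_ge0 h); lra.
Qed.

End PartialDerivatives.

(** * Integrals depending on a parameter, and time primitives of test functions *)

Section ParameterIntegrals.
Context {R : realType}.
Local Notation mu := (@lebesgue_measure R).
Implicit Types (f g : R * R -> R) (a b t x : R).

Lemma cont_slice1 f t : continuous f -> continuous (fun x => f (t, x)).
Proof.
move=> cf x; apply: (@continuous_comp _ _ _ (fun x : R => (t, x)) f); last exact: cf.
by apply: (@cvg_pair _ _ _ _ (nbhs (t : R)) (nbhs (x : R))); [exact: cvg_cst|exact: cvg_id].
Qed.

Global Arguments cont_slice1 [f] t _ _.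

Lemma cont_slice2 f x : continuous f -> continuous (fun t => f (t, x)).
Proof.
move=> cf t; apply: (@continuous_comp _ _ _ (fun t : R => (t, x)) f); last exact: cf.
by apply: (@cvg_pair _ _ _ _ (nbhs (t : R)) (nbhs (x : R))); [exact: cvg_id|exact: cvg_cst].
Qed.

Global Arguments cont_slice2 [f] x _ _.

Lemma cont_param f a b : continuous f -> continuous (fun x => intv a b (fun s => f (s, x))).
Proof.
move=> cf.
wlog ab : a b / a <= b => [W|].
  have [ab|/ltW ba] := leP a b; first exact: W.
  by under eq_fun do rewrite intvC; move=> x; apply: cvgN; exact: W.
suff H (x : R) : {for x, continuous (fun x => intv a b (fun s => f (s, x)))} by exact: H.
rewrite (_ : (fun x => _) = (fun x => \int[mu]_(s in `[a, b]) f (s, x))); last first.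
  by apply/funext => y; rewrite (intvE _ ab).
have [M hM] := cont2_bounded (`|a| + `|b| + (`|x| + 1)) cf.
have intf (y : R) : (`]x - 1, x + 1[%classic : set R) y -> mu.-integrable `[a, b] (EFin \o (fun s => f (s, y))).
  by move=> _; exact: (locbm_int a b (locbm_cont (cont_slice2 y cf))).
have cfy : {ae mu, forall y : R, (`[a, b]%classic : set R) y ->
    {in (`]x - 1, x + 1[%classic : set R), continuous (fun z => f (y, z))}}.
  by apply: aeW => y _ z _; exact: cont_slice1.
apply: (@continuity_under_integral R _ _ mu (fun x y => f (y, x)) `[a, b]
  (measurable_itv _) (x - 1) (x + 1) intf cfy (fun=> M)).
- exact: (locbm_int a b (locbm_cst M)).
- move=> y; rewrite /= in_itv/= => /andP[y1 y2]; apply: aeW => s; rewrite /= in_itv/= => /andP[s1 s2].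
  apply: hM.
    rewrite ler_norml; apply/andP; split.
      have := ler_norm (- a); rewrite normrN; have := normr_ge0 b; have := normr_ge0 x; lra.
    have := ler_norm b; have := normr_ge0 a; have := normr_ge0 x; lra.
  rewrite ler_norml; apply/andP; split.
    have := ler_norm (- x); rewrite normrN; have := normr_ge0 b; have := normr_ge0 a; lra.
  have := ler_norm x; have := normr_ge0 a; have := normr_ge0 b; lra.
- by rewrite inE/= in_itv/=; apply/andP; split; lra.
Qed.

Global Arguments cont_param [f] a b _ _.

(** Differentiation under the integral sign through Fubini: up to a constant, the parameter integral
    is a primitive of the integral of [g], which is continuous in the parameter. *)
Lemma derive_param f g a b x : continuous f -> continuous g ->
  (forall t x, is_derive x 1 (fun y => f (t, y)) (g (t, x))) ->
  is_derive x 1 (fun y => intv a b (fun s => f (s, y))) (intv a b (fun s => g (s, x))).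
Proof.
move=> cf cg dfg.
have hf := locbm2_cont cf; have hg := locbm2_cont cg.
have E y : intv a b (fun s => f (s, y)) = intv a b (fun s => f (s, 0)) +
    intv 0 y (fun z => intv a b (fun s => g (s, z))).
  rewrite -(intv_fubini a b 0 y hg) -intvD; last 2 first.
  - exact: locbm2_slice2.
  - exact: locbm2_intv2.
  apply: intv_ext => s.
  by rewrite (intv_FTC 0 y (cont_slice1 s cg) (fun z => dfg s z)) addrC subrK.
have cG := cont_param a b cg.
have := is_deriveD (is_derive_cst (intv a b (fun s => f (s, 0))) x 1)
  (intv_is_derive 0 (locbm_cont cG) (cG x)).
by move/is_derive_congr; apply=> [y|]; [exact/esym/E|rewrite add0r].
Qed.

Lemma cont_antideriv f b : continuous f ->
  continuous (fun p : R * R => intv p.1 b (fun s => f (s, p.2))).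
Proof.
move=> cf p; apply/cvgrPdist_le => e e0 /=; pose t := p.1; pose x := p.2; rewrite -/t -/x.
have [M hM] := cont2_bounded (`|t| + `|x| + 1) cf.
have M0 : 0 <= M.
  apply: le_trans (hM t x _ _); rewrite ?normr_ge0//.
    by have := normr_ge0 x; lra.
  by have := normr_ge0 t; lra.
have e20 : 0 < e / 2 by rewrite divr_gt0.
have /cvgrPdist_le/(_ _ e20)/nbhs_ballP[d /= d0 hd] := cont_param t b cf x.
pose d' := Num.min d (Num.min 1 (e / 2 / (M + 1))).
have M1 : 0 < M + 1 by rewrite ltr_wpDl.
have d'0 : 0 < d' by rewrite !lt_min d0 ltr01 divr_gt0.
apply: (@nbhs_ballP _ (R * R)%type _ _).2; exists d' => // -[t' x'] [] /=; rewrite /ball/= => ht hx.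
have hf y := locbm_cont (cont_slice2 y cf).
rewrite -(intv_cat t t' b (hf x')).
have -> (u v w : R) : u - (v + w) = (u - w) - v by ring.
apply: (le_trans (ler_normB _ _)); rewrite (splitr e); apply: lerD.
  by apply: hd; rewrite /ball/= (lt_le_trans hx)// ge_min lexx.
have ht1 : `|t - t'| < 1 by rewrite (lt_le_trans ht)// !ge_min lexx orbT.
have hx1 : `|x - x'| < 1 by rewrite (lt_le_trans hx)// !ge_min lexx orbT.
have ht2 : `|t - t'| < e / 2 / (M + 1) by rewrite (lt_le_trans ht)// !ge_min lexx !orbT.
have bx : `|x'| <= `|t| + `|x| + 1.
  have := ler_normB x (x - x'); rewrite subKr; have := normr_ge0 t; lra.
have bt s : Num.min t t' <= s <= Num.max t t' -> `|s| <= `|t| + `|x| + 1.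
  move=> h; have : `|t - s| <= `|t - t'|.
    move: h; rewrite /Num.min/Num.max; case: ltP => tt /andP[s1 s2].
      by rewrite ler0_norm ?ler0_norm ?subr_le0//; lra.
    by rewrite ger0_norm ?ger0_norm ?subr_ge0//; lra.
  have := ler_normB t (t - s); rewrite subKr; have := normr_ge0 x; lra.
have -> : `|intv t' t (fun s => f (s, x'))| =
    `|intv (Num.min t t') (Num.max t t') (fun s => f (s, x'))|.
  by rewrite /Num.min/Num.max; case: ltP => // _; rewrite intvC normrN.
have mm : Num.min t t' <= Num.max t t' by rewrite ge_min !le_max lexx.
apply: (le_trans (intv_norm_le mm (hf x') (M := M) _)).
  by move=> s /bt hs; exact: hM.
have -> : Num.max t t' - Num.min t t' = `|t - t'|.
  rewrite /Num.min/Num.max; case: ltP => tt.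
    by rewrite ltr0_norm ?subr_lt0// opprB.
  by rewrite ger0_norm ?subr_ge0.
apply: (@le_trans _ _ ((M + 1) * `|t - t'|)); first by rewrite ler_wpM2r// lerDl.
by rewrite mulrC -ler_pdivlMr// ltW.
Qed.

Lemma differentiable_classN n f : differentiable_class n f ->
  differentiable_class n (fun p => - f p).
Proof.
elim: n f => [|n IH] f.
  by move=> [cf _]; split=> // p; apply: cvgN; exact: cf.
move=> [cf [d1 d2 c1 c2]].
apply: (@differentiable_class_step _ _ _ (fun p => - dt f p) (fun p => - dx f p)).
- by move=> p; apply: cvgN; exact: cf.
- by move=> t x; apply: (is_deriveN (is_derive_dt (d1 (t, x)))).
- by move=> t x; apply: (is_deriveN (is_derive_dx (d2 (t, x)))).
- exact: IH.
- exact: IH.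
Qed.

(** The integral runs from t up to the terminal time [b]. With b = T, the result has time derivative
    - f and vanishes near T whenever f does, so it is again admissible in the weak formulation. *)
Definition antideriv b f : R * R -> R := fun p => intv p.1 b (fun s => f (s, p.2)).

Lemma antideriv_dt b f t x : continuous f ->
  is_derive t 1 (fun s => antideriv b f (s, x)) (- f (t, x)).
Proof.
move=> cf; have cs := cont_slice2 x cf.
have := is_deriveN (intv_is_derive b (locbm_cont cs) (cs t)).
by move/is_derive_congr; apply=> // s; rewrite /antideriv/= [RHS]intvC.
Qed.

Lemma antideriv_dx b f t x : continuous f -> continuous (dx f) ->
  (forall t x, is_derive x 1 (fun y => f (t, y)) (dx f (t, x))) ->
  is_derive x 1 (fun y => antideriv b f (t, y)) (antideriv b (dx f) (t, x)).
Proof. by move=> cf cg df; exact: derive_param. Qed.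

Lemma antideriv_class b f n : (forall m, differentiable_class m f) ->
  differentiable_class n (antideriv b f).
Proof.
elim: n f => [|n IH] f hf.
  by split=> //; apply: cont_antideriv; have [] := hf 0%N.
have cf : continuous f by have [] := hf 0%N.
have [_ [_ dxf _ _]] := hf 1%N.
have hdx m : differentiable_class m (dx f) by have [_ []] := hf m.+1.
have cdx : continuous (dx f) by have [] := hdx 0%N.
apply: (@differentiable_class_step _ _ _ (fun p => - f p) (antideriv b (dx f))).
- exact: cont_antideriv.
- by move=> t x; exact: antideriv_dt.
- by move=> t x; apply: antideriv_dx => // t' x'; exact: is_derive_dx.
- exact/differentiable_classN/hf.
- exact: IH.
Qed.

Lemma antideriv_test T f : 0 <= T -> test_function T f -> test_function T (antideriv T f).
Proof.
move=> T0 [pf hf]; split; last by move=> n; exact: antideriv_class.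
move=> t x; rewrite in_itv/= => /andP[t0 tT]; apply: intv_eq => // s /andP[ts sT].
by apply: pf; rewrite in_itv/= sT (le_trans t0).
Qed.

End ParameterIntegrals.

(** * The Hopf-Lax semigroup *)

Section HopfLax.
Context {R : realType}.
Implicit Types (f g : R -> R) (a b c s t r x y L : R).

Definition lip L f := forall x y, `|f x - f y| <= L * `|x - y|.

Lemma lip_cont L f : lip L f -> continuous f.
Proof.
move=> lf x; apply/cvgrPdist_le => e e0.
have L1 : 0 < `|L| + 1 by rewrite ltr_wpDl.
near=> y; apply: (le_trans (lf _ _)).
apply: (@le_trans _ _ ((`|L| + 1) * `|x - y|)).
  by rewrite ler_wpM2r// (le_trans (ler_norm L))// lerDl.
rewrite mulrC -ler_pdivlMr//; near: y; apply: cvgr_dist_le; last by rewrite divr_gt0.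
exact: cvg_id.
Unshelve. all: by end_near.
Qed.

Lemma lipD L1 L2 f g : lip L1 f -> lip L2 g -> lip (L1 + L2) (fun x => f x + g x).
Proof.
move=> lf lg x y; rewrite mulrDl.
have -> : f x + g x - (f y + g y) = (f x - f y) + (g x - g y) by ring.
by apply: (le_trans (ler_normD _ _)); exact: lerD.
Qed.

Lemma lipZ L k f : lip L f -> lip (`|k| * L) (fun x => k * f x).
Proof. by move=> lf x y; rewrite -mulrBr normrM -mulrA ler_wpM2l. Qed.

Lemma lip_le L L' f : L <= L' -> lip L f -> lip L' f.
Proof. by move=> LL lf x y; rewrite (le_trans (lf _ _))// ler_wpM2r. Qed.

(** The case s = 0 is separate because division by zero yields 0 and would turn the formula into the
    infimum of f. *)
Definition hopf_lax s f y : R :=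
  if s == 0 then f y else inf [set f a + (y - a) ^+ 2 / (2 * s) | a in setT].

Lemma hopf_lax0 f : hopf_lax 0 f = f.
Proof. by apply/funext => y; rewrite /hopf_lax eqxx. Qed.

Lemma lip_lower L f s y a : 0 < s -> lip L f ->
  f y - L ^+ 2 * s / 2 <= f a + (y - a) ^+ 2 / (2 * s).
Proof.
move=> s0 lf; have := le_trans (ler_norm _) (lf y a).
set d := `|y - a| => h.
have -> : (y - a) ^+ 2 = d ^+ 2 by rewrite real_normK ?num_real.
have : 0 <= (d - L * s) ^+ 2 / (2 * s) by rewrite divr_ge0 ?sqr_ge0// mulr_ge0 ?ltW.
have -> : (d - L * s) ^+ 2 / (2 * s) = d ^+ 2 / (2 * s) - L * d + L ^+ 2 * s / 2.
  by field; rewrite gt_eqF.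
lra.
Qed.

Section Attained.
Variables (s L : R) (f : R -> R).
Hypotheses (s0 : 0 < s) (lf : lip L f).

Let lbd y : has_lbound [set f a + (y - a) ^+ 2 / (2 * s) | a in setT].
Proof. by exists (f y - L ^+ 2 * s / 2) => _ [a _ <-]; exact: lip_lower. Qed.

Lemma hopf_lax_le y a : hopf_lax s f y <= f a + (y - a) ^+ 2 / (2 * s).
Proof. by rewrite /hopf_lax gt_eqF//; apply: ge_inf => //; exists a. Qed.

Lemma hopf_lax_glb y m : (forall a, m <= f a + (y - a) ^+ 2 / (2 * s)) ->
  m <= hopf_lax s f y.
Proof.
move=> hm; rewrite /hopf_lax gt_eqF//; apply: lb_le_inf.
  by exists (f 0 + (y - 0) ^+ 2 / (2 * s)); exists 0.
by move=> _ [a _ <-].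
Qed.

Lemma hopf_lax_attained y : exists a, hopf_lax s f y = f a + (y - a) ^+ 2 / (2 * s).
Proof.
(* Beyond this radius the quadratic cost exceeds the largest gain L |y - a| allowed by the Lipschitz
   bound, so a minimizer over [y - r, y + r] is a global one. *)
pose r := 2 * s * `|L| + 1.
have r0 : 0 < r by rewrite ltr_wpDl// !mulr_ge0// ltW.
pose g a := f a + (y - a) ^+ 2 / (2 * s).
have cg : continuous g.
  move=> a; apply: cvgD; first exact: (lip_cont lf).
  apply: cvgM; last exact: cvg_cst.
  apply: (@cvg_comp _ _ _ (fun a => y - a) (fun z => z ^+ 2) (nbhs a) (nbhs (y - a))).
    by apply: cvgB; [exact: cvg_cst|exact: cvg_id].
  exact: exprn_continuous.
have yr : y - r <= y + r by lra.
have [a] := EVT_min yr (continuous_subspaceT cg).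
rewrite in_itv/= => ar amin; exists a; apply/eqP; rewrite eq_le hopf_lax_le/=.
apply: hopf_lax_glb => b.
have [br|] := boolP (b \in `[y - r, y + r]); first exact: amin.
have gy : g a <= f y.
  have := amin y; rewrite /g subrr expr0n/= mul0r addr0; apply.
  by rewrite in_itv/=; apply/andP; split; lra.
move=> nb; apply: (le_trans gy).
have d1 : r <= `|y - b|.
  rewrite leNgt; apply/negP; rewrite ltr_norml => /andP[h1 h2].
  by move: nb; rewrite in_itv/= => /negP; apply; apply/andP; split; lra.
have := le_trans (ler_norm _) (lf y b); set d := `|y - b| in d1 * => h.
have -> : (y - b) ^+ 2 = d ^+ 2 by rewrite real_normK ?num_real.
have d2 : L * d <= d ^+ 2 / (2 * s).
  rewrite ler_pdivlMr ?mulr_gt0//.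
  have L2 : L * (2 * s) <= `|L| * (2 * s) by rewrite ler_wpM2r ?ler_norm// mulr_ge0// ltW.
  have Ld : L * (2 * s) <= d by apply: le_trans d1; rewrite /r; lra.
  by rewrite mulrAC expr2; apply: ler_wpM2r => //; exact: normr_ge0.
lra.
Qed.

End Attained.

Lemma hopf_lax_lip s L f : 0 <= s -> lip L f -> lip L (hopf_lax s f).
Proof.
rewrite le_eqVlt => /predU1P[<- lf|s0 lf]; first by rewrite hopf_lax0.
suff H x y : hopf_lax s f x - hopf_lax s f y <= L * `|x - y|.
  by move=> x y; rewrite ler_norml H andbT lerNl opprB distrC H.
have [a ->] := hopf_lax_attained s0 lf y.
have := hopf_lax_le s0 lf x (a + (x - y)).
have -> : x - (a + (x - y)) = y - a by ring.
have := le_trans (ler_norm _) (lf (a + (x - y)) a).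
by rewrite addrAC subrr add0r; lra.
Qed.

Lemma hopf_lax_ge_self s L f y : 0 <= s -> lip L f ->
  f y - L ^+ 2 * s / 2 <= hopf_lax s f y.
Proof.
rewrite le_eqVlt => /predU1P[<- _|s0 lf].
  by rewrite hopf_lax0 mulr0 mul0r subr0.
by apply: hopf_lax_glb => // a; exact: lip_lower.
Qed.

(** The Hamilton-Jacobi inequality g_t + c g_x <= c^2/2 integrated along a line of slope c. The
    minimizer at the start of the line is used as a competitor at its end, and the two costs differ
    by a perfect square. All later subsolution estimates rest on this form. *)
Lemma hopf_lax_line s r L f x c : 0 <= s -> 0 < r -> lip L f ->
  hopf_lax (s + r) f (x + c * r) <= hopf_lax s f x + c ^+ 2 * r / 2.
Proof.
rewrite le_eqVlt => /predU1P[<- r0 lf|s0 r0 lf].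
  rewrite add0r hopf_lax0; apply: le_trans (hopf_lax_le r0 lf _ x) _.
  rewrite lerD2l le_eqVlt; apply/orP; left; apply/eqP; field.
  by rewrite gt_eqF.
have sr : 0 < s + r by rewrite addr_gt0.
have [a ->] := hopf_lax_attained s0 lf x.
apply: (le_trans (hopf_lax_le sr lf _ a)); rewrite -subr_ge0.
have -> : f a + (x - a) ^+ 2 / (2 * s) + c ^+ 2 * r / 2 -
    (f a + (x + c * r - a) ^+ 2 / (2 * (s + r))) =
   r / (2 * s * (s + r)) * (x - a - c * s) ^+ 2.
  by field; rewrite !gt_eqF.
by rewrite mulr_ge0 ?sqr_ge0// divr_ge0 ?ltW// !mulr_gt0.
Qed.

Lemma hopf_lax_semigroup s r L f y : 0 <= s -> 0 <= r -> lip L f ->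
  hopf_lax r (hopf_lax s f) y <= hopf_lax (s + r) f y.
Proof.
rewrite [in X in X -> _]le_eqVlt => /predU1P[<- _ _|s0]; first by rewrite hopf_lax0 add0r.
rewrite [in X in X -> _]le_eqVlt => /predU1P[<- _|r0 lf]; first by rewrite hopf_lax0 addr0.
have sr : 0 < s + r by rewrite addr_gt0.
have [a ->] := hopf_lax_attained sr lf y.
(* The position at time s on the straight path from [a] to [y], for which the two partial costs add
   up to the total cost. *)
pose m := a + s / (s + r) * (y - a).
apply: (le_trans (hopf_lax_le r0 (hopf_lax_lip (ltW s0) lf) y m)).
have := hopf_lax_le s0 lf m a.
have -> : (y - a) ^+ 2 / (2 * (s + r)) = (m - a) ^+ 2 / (2 * s) + (y - m) ^+ 2 / (2 * r).
  by rewrite /m; field; rewrite !gt_eqF.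
lra.
Qed.

(** Semiconcavity is inherited with the same constant: the minimizer for x, translated by h and by -
    h, is a competitor at x + h and at x - h with unchanged quadratic cost. *)
Lemma hopf_lax_second_diff s L M f x h : 0 <= s -> lip L f ->
  (forall x h, f (x + h) + f (x - h) - 2 * f x <= M * h ^+ 2) ->
  hopf_lax s f (x + h) + hopf_lax s f (x - h) - 2 * hopf_lax s f x <= M * h ^+ 2.
Proof.
rewrite le_eqVlt => /predU1P[<- _|s0 lf] sd; first by rewrite hopf_lax0; exact: sd.
have [a ->] := hopf_lax_attained s0 lf x.
have := hopf_lax_le s0 lf (x + h) (a + h); have := hopf_lax_le s0 lf (x - h) (a - h).
have -> : x + h - (a + h) = x - a by ring.
have -> : x - h - (a - h) = x - a by ring.
have := sd a h; lra.
Qed.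

(** A parabola that touches from below at a point of differentiability is tangent there: the
    expansions at h and - h bound p - l from both sides. *)
Lemma support_slope_derive f x p l K : is_derive x 1 f l ->
  (forall h, f x + p * h - K * h ^+ 2 <= f (x + h)) -> p = l.
Proof.
move=> df sup.
suff H e : 0 < e -> `|p - l| <= e.
  apply/eqP; rewrite -subr_eq0 -normr_eq0 eq_le normr_ge0 andbT.
  by apply/ler_addgt0Pr => e e0; rewrite add0r; exact: H.
move=> e0; have e20 : 0 < e / 2 by rewrite divr_gt0.
have [d d0 hd] := is_deriveP_eps df e20.
have K1 : 0 < `|K| + 1 by rewrite ltr_wpDl.
pose h := Num.min (d / 2) (e / 2 / (`|K| + 1)).
have h0 : 0 < h by rewrite lt_min !divr_gt0.
have h1 : h < d by apply: (@le_lt_trans _ _ (d / 2)); rewrite ?ge_min ?lexx// ltr_pdivrMr//; lra.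
have h2 : K * h <= e / 2.
  apply: (@le_trans _ _ ((`|K| + 1) * h)).
    by rewrite ler_wpM2r ?(ltW h0)// (le_trans (ler_norm K))// lerDl.
  by rewrite mulrC -ler_pdivlMr// ge_min lexx orbT.
have A := hd h; have B := hd (- h); have C := sup h; have D := sup (- h).
rewrite gtr0_norm// in A; rewrite normrN gtr0_norm// in B.
have {}A := A h1; have {}B := B h1.
rewrite ler_norml in A; rewrite ler_norml in B.
move/andP: A => [_ A]; move/andP: B => [_ B].
rewrite sqrrN in D.
rewrite ler_norml; apply/andP; split.
  rewrite -(ler_pM2r h0); nra.
rewrite -(ler_pM2r h0); nra.
Qed.

(** Semiconvexity (a supporting parabola at every point) and semiconcavity together give a Lipschitz
    derivative, namely the slope of the supporting parabola. The monotonicity of x + f'/al says that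
    characteristics do not cross before time 1/al. *)
Lemma C11_of_support f al M : 0 < al -> 0 <= M ->
  (forall x, exists p, forall h, f x + p * h - al / 2 * h ^+ 2 <= f (x + h)) ->
  (forall x h, f (x + h) + f (x - h) - 2 * f x <= M * h ^+ 2) ->
  exists f', [/\ forall x, is_derive x 1 f (f' x), continuous f',
    forall x y, x <= y -> x + f' x / al <= y + f' y / al &
    forall x h, f x + f' x * h - al / 2 * h ^+ 2 <= f (x + h)].
Proof.
move=> al0 M0 /choice[f' sup] sd.
pose K := M + al / 2 + al / 2.
have K0 : 0 < K by rewrite /K; lra.
(* The parabola from above results from the supporting one at - h and the second-difference
   bound. *)
have up x h : f (x + h) <= f x + f' x * h + (M + al / 2) * h ^+ 2.
  have := sup x (- h); have := sd x h; rewrite sqrrN; lra.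
have mono x y : x <= y -> f' x - f' y <= al * (y - x).
  rewrite le_eqVlt => /predU1P[->|xy]; first by rewrite !subrr mulr0.
  have h1 := sup x (y - x); have h2 := sup y (x - y).
  rewrite subrKC in h1; rewrite subrKC in h2.
  by rewrite -(ler_pM2r (_ : 0 < y - x)) ?subr_gt0//; nra.
have upm x y : x <= y -> f' y - f' x <= (2 * M + al) * (y - x).
  rewrite le_eqVlt => /predU1P[->|xy]; first by rewrite !subrr mulr0.
  have h1 := up x (y - x); have h2 := up y (x - y).
  rewrite subrKC in h1; rewrite subrKC in h2.
  by rewrite -(ler_pM2r (_ : 0 < y - x)) ?subr_gt0//; nra.
exists f'; split.
- move=> x; apply: is_derive_eps => e e0; exists (e / K) => [|h hh]; first by rewrite divr_gt0.
  have B : `|f (x + h) - f x - h * f' x| <= K * h ^+ 2.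
    have := up x h; have := sup x h; have := sqr_ge0 h.
    by rewrite ler_norml /K => ? ? ?; apply/andP; split; nra.
  apply: (le_trans B); rewrite -[h ^+ 2]real_normK ?num_real// expr2 mulrA ler_wpM2r//.
  by rewrite mulrC -ler_pdivlMr// ltW.
- apply: (@lip_cont (2 * M + al)) => x y.
  have [xy|/ltW yx] := leP x y.
    rewrite distrC (ler0_norm (_ : x - y <= 0)) ?subr_le0// opprB ler_norml upm// andbT.
    have := mono _ _ xy; have : 0 <= M * (y - x) by rewrite mulr_ge0 ?subr_ge0.
    lra.
  rewrite (ger0_norm (_ : 0 <= x - y)) ?subr_ge0// ler_norml upm// andbT.
  have := mono _ _ yx; have : 0 <= M * (x - y) by rewrite mulr_ge0 ?subr_ge0.
  lra.
- move=> x y xy; have := mono _ _ xy; rewrite mulrC -ler_pdivrMr// mulrBl; lra.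
- exact: sup.
Qed.

(** First-order condition: translating the minimizer shows that (x - a)/s is the slope of a parabola
    supporting f at a, hence equals f'(a). So x lies on the characteristic that leaves a. *)
Lemma hopf_lax_critical s L f f' x a : 0 < s -> lip L f -> is_derive a 1 f (f' a) ->
  hopf_lax s f x = f a + (x - a) ^+ 2 / (2 * s) -> x = a + s * f' a.
Proof.
move=> s0 lf df E.
have -> : f' a = (x - a) / s.
  apply/esym; apply: (support_slope_derive (K := 1 / (2 * s)) df) => h.
  have := hopf_lax_le s0 lf x (a + h); rewrite E.
  have -> : (x - (a + h)) ^+ 2 / (2 * s) = (x - a) ^+ 2 / (2 * s) - (x - a) / s * h + 1 / (2 * s) * h ^+ 2.
    by field; rewrite gt_eqF.
  lra.
by field; rewrite gt_eqF.
Qed.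

(** The semiconvexity constant 1/T at time 0 becomes 1/(T - t) at time t, as the Riccati equation
    for the second derivative along characteristics predicts. The difference of the two sides is
    again a perfect square. *)
Lemma hopf_lax_support T t L f f' x : 0 <= t < T -> lip L f ->
  (forall x, is_derive x 1 f (f' x)) ->
  (forall x h, f x + f' x * h - T^-1 / 2 * h ^+ 2 <= f (x + h)) ->
  exists p, forall h, hopf_lax t f x + p * h - (T - t)^-1 / 2 * h ^+ 2 <= hopf_lax t f (x + h).
Proof.
move=> /andP[+ tT] lf df sup; have Tt : 0 < T - t by rewrite subr_gt0.
rewrite le_eqVlt => /predU1P[t0|t0].
  by exists (f' x) => h; rewrite -t0 hopf_lax0 subr0.
have [a E] := hopf_lax_attained t0 lf x.
have xa := hopf_lax_critical t0 lf (df a) E.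
exists (f' a) => h; apply: hopf_lax_glb => // b.
have T0 : 0 < T by rewrite (lt_trans t0).
have := sup a (b - a); rewrite subrKC => h1.
rewrite E [in X in X <= _]xa [in X in _ <= X]xa.
have -> : a + t * f' a - a = t * f' a by ring.
set p := f' a in h1 *; pose q := b - a.
have key : 0 <= p * q - T^-1 / 2 * q ^+ 2 + (a + t * p + h - b) ^+ 2 / (2 * t)
    - (t * p) ^+ 2 / (2 * t) - p * h + (T - t)^-1 / 2 * h ^+ 2.
  have -> : p * q - T^-1 / 2 * q ^+ 2 + (a + t * p + h - b) ^+ 2 / (2 * t)
    - (t * p) ^+ 2 / (2 * t) - p * h + (T - t)^-1 / 2 * h ^+ 2 =
    (T - t) / (2 * t * T) * (q - T / (T - t) * h) ^+ 2.
    by rewrite /q; field; rewrite !gt_eqF.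
  by rewrite mulr_ge0 ?sqr_ge0// divr_ge0 ?ltW// !mulr_gt0.
rewrite /q in key; lra.
Qed.

End HopfLax.

(** * Periodic integrals and the energy balance of the Hopf-Lax evolution *)

Section HopfLaxIntegral.
Context {R : realType}.
Implicit Types (f g : R -> R) (a b c s t r x y L M : R).

Lemma intv_shift a b c f : continuous f -> intv a b (fun x => f (x + c)) = intv (a + c) (b + c) f.
Proof.
move=> cf; have hf := locbm_cont cf.
have S x : is_derive x 1 (fun y : R => y + c) 1.
  by have := is_deriveD (is_derive_id x 1) (is_derive_cst (c : R) x 1);
    move/is_derive_congr; apply=> //; rewrite addr0.
have cfc : continuous (fun x => f (x + c)).
  move=> x; apply: (@continuous_comp _ _ _ (fun x => x + c) f); last exact: cf.
  by apply: cvgD; [exact: cvg_id|exact: cvg_cst].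
have dF x : is_derive x 1 (fun x => intv 0 (x + c) f) (f (x + c)).
  have := @is_derive1_comp R (fun y => intv 0 y f) (fun y => y + c) x _ _
    (intv_is_derive 0 hf (cf (x + c))) (S x).
  by rewrite mulr1.
apply: (etrans (intv_FTC a b cfc dF)).
by rewrite -(intv_cat 0 (a + c) (b + c) hf) (intvC (a + c)) addrC.
Qed.

Lemma intv_opp a b f : continuous f -> intv a b (fun x => f (- x)) = intv (- b) (- a) f.
Proof.
move=> cf; have hf := locbm_cont cf.
have S x : is_derive x 1 (fun y : R => - y) (- 1) by exact: (is_deriveN (is_derive_id x 1)).
have cfc : continuous (fun x => f (- x)).
  by move=> x; apply: (@continuous_comp _ _ _ (fun x => - x) f); [exact: opp_continuous|exact: cf].
have dF x : is_derive x 1 (fun x => - intv 0 (- x) f) (f (- x)).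
  have := is_deriveN (@is_derive1_comp R (fun y => intv 0 y f) (fun y => - y) x _ _
    (intv_is_derive 0 hf (cf (- x))) (S x)).
  by rewrite mulrN1 opprK.
apply: (etrans (intv_FTC a b cfc dF)).
by rewrite -(intv_cat 0 (- b) (- a) hf) (intvC (- b)); ring.
Qed.

Lemma intv_periodic c f : continuous f -> (forall x, f (x + 1) = f x) ->
  intv c (c + 1) f = intv 0 1 f.
Proof.
move=> cf pf; have hf := locbm_cont cf.
rewrite -(intv_cat 0 c (c + 1) hf) -(intv_cat 1 0 (c + 1) hf) (intvC c 0).
have -> : intv 1 (c + 1) f = intv 0 c f.
  by rewrite -{1}(add0r 1) -intv_shift//; apply: intv_ext => x; exact: pf.
by rewrite addrCA addNr addr0.
Qed.

Lemma intv_periodic_shift c f : continuous f -> (forall x, f (x + 1) = f x) ->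
  intv 0 1 (fun x => f (x + c)) = intv 0 1 f.
Proof.
by move=> cf pf; rewrite intv_shift// add0r (addrC 1) intv_periodic.
Qed.

Definition pos x : R := Num.max x 0.

Lemma pos_ge0 x : 0 <= pos x. Proof. by rewrite /pos le_max lexx orbT. Qed.
Lemma le_pos x : x <= pos x. Proof. by rewrite /pos le_max lexx. Qed.
Lemma pos_id x : 0 <= x -> pos x = x. Proof. by move=> x0; rewrite /pos max_l. Qed.
Lemma pos_eq0 x : x <= 0 -> pos x = 0. Proof. by move=> x0; rewrite /pos max_r. Qed.
Lemma pos_lip : lip 1 pos.
Proof.
move=> x y; rewrite mul1r /pos /Num.max.
case: ltP => hx; case: ltP => hy; rewrite ?subrr ?normr0//.
  by rewrite sub0r normrN ger0_norm// ler0_norm; lra.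
rewrite subr0 ger0_norm// ger0_norm; lra.
Qed.
Lemma pos_cont : continuous pos. Proof. exact: lip_cont pos_lip. Qed.

Lemma pos_sqr x : pos x ^+ 2 + pos (- x) ^+ 2 = x ^+ 2.
Proof.
have [x0|/ltW x0] := leP 0 x.
  by rewrite (pos_id x0) (@pos_eq0 (- x)) ?oppr_le0// expr0n/= addr0.
by rewrite (pos_eq0 x0) (@pos_id (- x)) ?oppr_ge0// expr0n/= add0r sqrrN.
Qed.

(** Passing to the positive part replaces the upper limit d by a fixed M beyond which the integrand
    is nonpositive. Limits independent of the point are what allows Fubini in [intv_deficit]. *)
Lemma intv_pos_bound (k : R -> R) (d M : R) : continuous k -> 0 <= d -> 0 <= M ->
  (forall z, M <= z -> k z <= 0) -> intv 0 d k <= intv 0 M (fun z => pos (k z)).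
Proof.
move=> ck d0 M0 kM.
have cp : continuous (fun z => pos (k z)).
  by move=> z; apply: (@continuous_comp _ _ _ k pos); [exact: ck|exact: pos_cont].
have hp := locbm_cont cp; have hk := locbm_cont ck.
apply: (@le_trans _ _ (intv 0 d (fun z => pos (k z)))).
  by apply: le_intv => // z _; exact: le_pos.
have [dM|/ltW Md] := leP d M.
  rewrite -(intv_cat d 0 M hp) lerDl; apply: intv_ge0 => // z _; exact: pos_ge0.
rewrite -(intv_cat M 0 d hp) gerDl.
rewrite (@intv_eq _ _ _ _ (fun=> 0)) ?intv_cst ?mul0r// => z /andP[Mz _].
by rewrite pos_eq0 ?kM.
Qed.

Lemma intv_pos_eq (k : R -> R) (d M : R) : continuous k -> 0 <= d -> 0 <= M ->
  (forall z, M <= z -> k z <= 0) -> (forall z, 0 <= z <= d -> 0 <= k z) ->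
  (forall z, d <= z -> k z <= 0) -> intv 0 d k = intv 0 M (fun z => pos (k z)).
Proof.
move=> ck d0 M0 kM k1 k2.
have cp : continuous (fun z => pos (k z)).
  by move=> z; apply: (@continuous_comp _ _ _ k pos); [exact: ck|exact: pos_cont].
have hp := locbm_cont cp; have hk := locbm_cont ck.
have -> : intv 0 d k = intv 0 d (fun z => pos (k z)).
  by apply: intv_eq => // z hz; rewrite pos_id// k1.
rewrite -(intv_cat d 0 M hp) (_ : intv d M _ = 0) ?addr0//.
have [dM|/ltW Md] := leP d M.
  rewrite (@intv_eq _ _ _ _ (fun=> 0)) ?intv_cst ?mul0r// => z /andP[dz _].
  by rewrite pos_eq0 ?k2.
rewrite intvC (@intv_eq _ _ _ _ (fun=> 0)) ?intv_cst ?mul0r ?oppr0// => z /andP[dz _].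
by rewrite pos_eq0 ?kM.
Qed.

Lemma is_derive_sqr x : is_derive x 1 (fun d : R => d ^+ 2) (2 * x).
Proof.
have := is_deriveM (is_derive_id x 1) (is_derive_id x 1).
move/is_derive_congr; apply=> [y|]; first by rewrite expr2.
by rewrite /GRing.scale/=; ring.
Qed.

(** Area of the triangle of height c and base s c; M only has to exceed the base. *)
Lemma intv_triangle c s M : 0 < s -> 0 <= M -> s * c <= M ->
  intv 0 M (fun d => pos (c - d / s)) = s / 2 * pos c ^+ 2.
Proof.
move=> s0 M0 cM.
have ck : continuous (fun d : R => c - d / s).
  move=> d; apply: cvgB; first exact: cvg_cst.
  by apply: cvgM; [exact: cvg_id|exact: cvg_cst].
have [c0|/ltW c0] := leP 0 c; last first.
  rewrite (@intv_eq _ _ _ _ (fun=> 0)) ?intv_cst ?mul0r ?pos_eq0 ?expr0n ?mulr0// => z /andP[z0 _].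
  by rewrite pos_eq0// subr_le0 (le_trans c0)// divr_ge0// ltW.
rewrite -(@intv_pos_eq _ (s * c))//.
- have dF x : is_derive x 1 (fun d => c * d - d ^+ 2 / (2 * s)) (c - x / s).
    have := is_deriveB (is_deriveZ c (is_derive_id x 1)) (is_deriveZ ((2 * s)^-1) (is_derive_sqr x)).
    move/is_derive_congr; apply=> [y|].
      by change (c * y - (2 * s)^-1 * y ^+ 2 = c * y - y ^+ 2 / (2 * s)); rewrite [X in _ - X]mulrC.
    by change (c * 1 - (2 * s)^-1 * (2 * x) = c - x / s); field; rewrite gt_eqF.
  apply: (etrans (intv_FTC 0 _ ck dF)).
  by rewrite (pos_id c0); field; rewrite gt_eqF.
- by rewrite mulr_ge0// ltW.
- by move=> z Mz; rewrite subr_le0 ler_pdivlMr// mulrC (le_trans cM).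
- by move=> z /andP[z0 zc]; rewrite subr_ge0 ler_pdivrMr// mulrC.
- by move=> z zc; rewrite subr_le0 ler_pdivlMr// mulrC.
Qed.

Section Deficit.
Variables (s L : R) (f f' : R -> R).
Hypotheses (s0 : 0 < s) (lf : lip L f) (df : forall x, is_derive x 1 f (f' x)).
Hypotheses (cf' : continuous f') (pf' : forall x, f' (x + 1) = f' x).
Variable M : R.
Hypotheses (M0 : 0 <= M) (f'M : forall x, s * `|f' x| <= M).

(* [f y - hopf_lax s f y <= deficit y], with equality when x + s f'(x) is nondecreasing:
   f(y) - f(a) - (y - a)^2/(2s) is the integral of f'(x) - (y - x)/s for x from a to y, and only the
   positive part of the integrand is kept. *)
Definition deficit y : R :=
  intv 0 M (fun d => pos (f' (y - d) - d / s)) + intv 0 M (fun d => pos (- f' (y + d) - d / s)).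

Let k1 y d := f' (y - d) - d / s.
Let k2 y d := - f' (y + d) - d / s.

Let cfst : continuous (fun p : R * R => p.1). Proof. by move=> p; exact: cvg_fst. Qed.
Let csnd : continuous (fun p : R * R => p.2). Proof. by move=> p; exact: cvg_snd. Qed.

Let cK1 : continuous (fun p : R * R => pos (k1 p.1 p.2)).
Proof.
move=> p; apply: (@continuous_comp _ _ _ (fun p : R * R => k1 p.1 p.2) pos); last exact: pos_cont.
apply: cvgB; last by apply: cvgM; [exact: csnd|exact: cvg_cst].
apply: (@continuous_comp _ _ _ (fun p : R * R => p.1 - p.2) f'); last exact: cf'.
by apply: cvgB; [exact: cfst|exact: csnd].
Qed.

Let cK2 : continuous (fun p : R * R => pos (k2 p.1 p.2)).
Proof.
move=> p; apply: (@continuous_comp _ _ _ (fun p : R * R => k2 p.1 p.2) pos); last exact: pos_cont.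
apply: cvgB; last by apply: cvgM; [exact: csnd|exact: cvg_cst].
apply: cvgN; apply: (@continuous_comp _ _ _ (fun p : R * R => p.1 + p.2) f'); last exact: cf'.
by apply: cvgD; [exact: cfst|exact: csnd].
Qed.

Let ck1 y : continuous (k1 y).
Proof.
move=> d; apply: cvgB; last by apply: cvgM; [exact: cvg_id|exact: cvg_cst].
apply: (@continuous_comp _ _ _ (fun d => y - d) f'); last exact: cf'.
by apply: cvgB; [exact: cvg_cst|exact: cvg_id].
Qed.

Let ck2 y : continuous (k2 y).
Proof.
move=> d; apply: cvgB; last by apply: cvgM; [exact: cvg_id|exact: cvg_cst].
apply: cvgN; apply: (@continuous_comp _ _ _ (fun d => y + d) f'); last exact: cf'.
by apply: cvgD; [exact: cvg_cst|exact: cvg_id].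
Qed.

Let boundM x z : M <= z -> f' x <= z / s /\ - f' x <= z / s.
Proof.
move=> Mz; have := f'M x; rewrite -ler_pdivlMl// mulrC => h.
have h2 : M / s <= z / s by rewrite ler_pM2r// invr_gt0.
have := ler_norm (f' x); have := ler_norm (- f' x); rewrite normrN; lra.
Qed.

Let int1 y d : intv 0 d (k1 y) = f y - f (y - d) - d ^+ 2 / (2 * s).
Proof.
have dF x : is_derive x 1 (fun d => - f (y - d) - d ^+ 2 / (2 * s)) (k1 y x).
  have S : is_derive x 1 (fun d : R => y - d) (- 1).
    have := is_deriveB (is_derive_cst (y : R) x 1) (is_derive_id x 1).
    by rewrite sub0r.
  have D1 := is_deriveN (@is_derive1_comp R f (fun d => y - d) x _ _ (df (y - x)) S).
  have D2 := is_deriveZ ((2 * s)^-1) (is_derive_sqr x).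
  have := is_deriveB D1 D2; move/is_derive_congr; apply=> [z|].
    by change (- f (y - z) - (2 * s)^-1 * z ^+ 2 = - f (y - z) - z ^+ 2 / (2 * s)); rewrite [X in _ - X]mulrC.
  by change (- (f' (y - x) * (- 1)) - (2 * s)^-1 * (2 * x) = k1 y x); rewrite /k1; field; rewrite gt_eqF.
apply: (etrans (intv_FTC 0 d (@ck1 y) dF)).
by rewrite subr0 expr0n/= mul0r subr0; ring.
Qed.

Let int2 y d : intv 0 d (k2 y) = f y - f (y + d) - d ^+ 2 / (2 * s).
Proof.
have dF x : is_derive x 1 (fun d => - f (y + d) - d ^+ 2 / (2 * s)) (k2 y x).
  have S : is_derive x 1 (fun d : R => y + d) (1).
    have := is_deriveD (is_derive_cst (y : R) x 1) (is_derive_id x 1).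
    by rewrite add0r.
  have D1 := is_deriveN (@is_derive1_comp R f (fun d => y + d) x _ _ (df (y + x)) S).
  have D2 := is_deriveZ ((2 * s)^-1) (is_derive_sqr x).
  have := is_deriveB D1 D2; move/is_derive_congr; apply=> [z|].
    by change (- f (y + z) - (2 * s)^-1 * z ^+ 2 = - f (y + z) - z ^+ 2 / (2 * s)); rewrite [X in _ - X]mulrC.
  by change (- (f' (y + x) * 1) - (2 * s)^-1 * (2 * x) = k2 y x); rewrite /k2; field; rewrite gt_eqF.
apply: (etrans (intv_FTC 0 d (@ck2 y) dF)).
by rewrite addr0 expr0n/= mul0r subr0; ring.
Qed.

Let k1M y z : M <= z -> k1 y z <= 0.
Proof. by move=> Mz; rewrite subr_le0; case: (boundM (y - z) Mz). Qed.

Let k2M y z : M <= z -> k2 y z <= 0.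
Proof. by move=> Mz; rewrite subr_le0; case: (boundM (y + z) Mz). Qed.

Let pint_ge0 (k : R -> R) : 0 <= intv 0 M (fun d => pos (k d)).
Proof. by apply: intv_ge0 => // d _; exact: pos_ge0. Qed.

Lemma hopf_lax_deficit y : f y - deficit y <= hopf_lax s f y.
Proof.
apply: hopf_lax_glb => // a; rewrite /deficit.
have [ay|/ltW ya] := leP a y.
  have d0 : 0 <= y - a by rewrite subr_ge0.
  have := intv_pos_bound (@ck1 y) d0 M0 (@k1M y); rewrite int1 subKr.
  have := pint_ge0 (k2 y); rewrite /k1 /k2; lra.
have d0 : 0 <= a - y by rewrite subr_ge0.
have := intv_pos_bound (@ck2 y) d0 M0 (@k2M y); rewrite int2 subrKC -[(a - y) ^+ 2]sqrrN opprB.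
have := pint_ge0 (k1 y); rewrite /k1 /k2; lra.
Qed.

(** Monotonicity of x + s f'(x) makes the integrand f'(x) - (y - x)/s nonpositive to the left of the
    minimizer and nonnegative to its right. Hence the positive part agrees with the integrand
    between the minimizer and y, and it vanishes on all other pieces. *)
Lemma hopf_lax_deficit_eq y : (forall x x', x <= x' -> x + s * f' x <= x' + s * f' x') ->
  hopf_lax s f y = f y - deficit y.
Proof.
move=> mono; have [a E] := hopf_lax_attained s0 lf y.
have ya := hopf_lax_critical s0 lf (df a) E.
have up x : a <= x -> y <= x + s * f' x by move=> ax; rewrite ya mono.
have dn x : x <= a -> x + s * f' x <= y by move=> ax; rewrite ya mono.
have upd x z : a <= x -> y = x + z -> z / s <= f' x.
  by move=> /up h e; rewrite ler_pdivrMr// mulrC; lra.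
have dnd x z : x <= a -> y = x + z -> f' x <= z / s.
  by move=> /dn h e; rewrite ler_pdivlMr// mulrC; lra.
rewrite /deficit E; have [ay|/ltW ay] := leP a y.
  have d0 : 0 <= y - a by rewrite subr_ge0.
  have Q : intv 0 (y - a) (k1 y) = intv 0 M (fun d => pos (k1 y d)).
    apply: (intv_pos_eq (@ck1 y) d0 M0 (@k1M y)) => [z /andP[z0 z1]|z z1].
      by rewrite /k1; have := upd (y - z) z ltac:(lra) ltac:(ring); lra.
    by rewrite /k1; have := dnd (y - z) z ltac:(lra) ltac:(ring); lra.
  have Z : intv 0 M (fun d => pos (k2 y d)) = 0.
    rewrite (@intv_eq _ 0 M _ (fun=> 0))// ?intv_cst ?mul0r// => z /andP[z0 _].
    apply: pos_eq0; rewrite /k2.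
    by have := upd (y + z) (- z) ltac:(lra) ltac:(ring); rewrite mulNr; lra.
  by rewrite int1 subKr in Q; rewrite /k1 in Q; rewrite /k2 in Z; lra.
have d0 : 0 <= a - y by rewrite subr_ge0.
have Q : intv 0 (a - y) (k2 y) = intv 0 M (fun d => pos (k2 y d)).
  apply: (intv_pos_eq (@ck2 y) d0 M0 (@k2M y)) => [z /andP[z0 z1]|z z1]; rewrite /k2.
    by have := dnd (y + z) (- z) ltac:(lra) ltac:(ring); rewrite mulNr; lra.
  by have := upd (y + z) (- z) ltac:(lra) ltac:(ring); rewrite mulNr; lra.
have Z : intv 0 M (fun d => pos (k1 y d)) = 0.
  rewrite (@intv_eq _ 0 M _ (fun=> 0))// ?intv_cst ?mul0r// => z /andP[z0 _].
  apply: pos_eq0; rewrite /k1.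
  by have := dnd (y - z) z ltac:(lra) ltac:(ring); lra.
rewrite int2 subrKC -[(a - y) ^+ 2]sqrrN opprB in Q.
by rewrite /k2 in Q; rewrite /k1 in Z; lra.
Qed.

Lemma locbm_deficit : locbm deficit.
Proof.
exact: (locbmD (locbm2_intv2 0 M (locbm2_cont cK1)) (locbm2_intv2 0 M (locbm2_cont cK2))).
Qed.

(** After Fubini, the shift by d disappears by translation invariance on the circle. For each point
    there remain two triangles, of heights f' and - f', whose areas add up to s f'^2/2. *)
Lemma intv_deficit : intv 0 1 deficit = s / 2 * intv 0 1 (fun x => f' x ^+ 2).
Proof.
rewrite (intvD _ _ (locbm2_intv2 0 M (locbm2_cont cK1)) (locbm2_intv2 0 M (locbm2_cont cK2))).
have E1 : intv 0 1 (fun y => intv 0 M (fun d => pos (f' (y - d) - d / s))) =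
    intv 0 1 (fun y => s / 2 * pos (f' y) ^+ 2).
  rewrite (intv_fubini 0 1 0 M (locbm2_cont cK1)).
  have C : continuous (fun p : R * R => pos (f' p.2 - p.1 / s)).
    move=> p; apply: (@continuous_comp _ _ _ (fun p : R * R => f' p.2 - p.1 / s) pos); last exact: pos_cont.
    apply: cvgB; last by apply: cvgM; [exact: cfst|exact: cvg_cst].
    by apply: (@continuous_comp _ _ _ (fun p : R * R => p.2) f'); [exact: csnd|exact: cf'].
  transitivity (intv 0 M (fun d => intv 0 1 (fun y => pos (f' y - d / s)))).
    apply: intv_ext => d.
    have c1 : continuous (fun y => pos (f' y - d / s)) by exact: (cont_slice1 d C).
    by rewrite -(intv_periodic_shift (- d) c1)// => x; rewrite pf'.
  rewrite (intv_fubini 0 M 0 1 (locbm2_cont C)).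
  apply: intv_ext => y; apply: (@intv_triangle (f' y) s M s0 M0).
  by apply: le_trans (f'M y); rewrite ler_pM2l// ler_norm.
have E2 : intv 0 1 (fun y => intv 0 M (fun d => pos (- f' (y + d) - d / s))) =
    intv 0 1 (fun y => s / 2 * pos (- f' y) ^+ 2).
  rewrite (intv_fubini 0 1 0 M (locbm2_cont cK2)).
  have C : continuous (fun p : R * R => pos (- f' p.2 - p.1 / s)).
    move=> p; apply: (@continuous_comp _ _ _ (fun p : R * R => - f' p.2 - p.1 / s) pos); last exact: pos_cont.
    apply: cvgB; last by apply: cvgM; [exact: cfst|exact: cvg_cst].
    by apply: cvgN; apply: (@continuous_comp _ _ _ (fun p : R * R => p.2) f'); [exact: csnd|exact: cf'].
  transitivity (intv 0 M (fun d => intv 0 1 (fun y => pos (- f' y - d / s)))).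
    apply: intv_ext => d.
    have c1 : continuous (fun y => pos (- f' y - d / s)) by exact: (cont_slice1 d C).
    by rewrite -(intv_periodic_shift d c1)// => x; rewrite pf'.
  rewrite (intv_fubini 0 M 0 1 (locbm2_cont C)).
  apply: intv_ext => y; apply: (@intv_triangle (- f' y) s M s0 M0).
  by apply: le_trans (f'M y); rewrite ler_pM2l// -normrN ler_norm.
have cpos (g : R -> R) : continuous g -> locbm (fun y => s / 2 * pos (g y) ^+ 2).
  move=> cg; apply/locbmZ/locbm_cont => y.
  apply: cvgM; apply: (@continuous_comp _ _ _ g pos); by [exact: cg|exact: pos_cont].
have cN : continuous (fun y => - f' y) by move=> y; apply: cvgN; exact: cf'.
rewrite E1 E2 -intvD; [|exact: cpos..].
rewrite -intvZ; last by apply: locbm_cont => y; apply: cvgM; exact: cf'.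
by apply: intv_ext => y; rewrite -mulrDr pos_sqr.
Qed.

End Deficit.

Lemma periodic_int f (z : int) x : (forall x, f (x + 1) = f x) -> f (x + z%:~R) = f x.
Proof.
move=> pf; have pn (n : nat) y : f (y + n%:R) = f y.
  by elim: n y => [|n IH] y; rewrite ?addr0// -natr1 addrA pf IH.
case: z => n; first exact: pn.
by rewrite -[LHS](pn n.+1) NegzE mulrNz; congr f; rewrite subrK.
Qed.

Definition frac x := x - (Num.floor x)%:~R.

Lemma frac_itv x : 0 <= frac x < 1.
Proof. by have := floor_itv x; rewrite /frac intrD => /andP[]; lra. Qed.

Lemma periodic_frac f x : (forall x, f (x + 1) = f x) -> f (frac x) = f x.
Proof. by move=> pf; rewrite /frac -mulrNz periodic_int. Qed.

Lemma periodic_bounded f : continuous f -> (forall x, f (x + 1) = f x) ->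
  exists2 M, 0 <= M & forall x, `|f x| <= M.
Proof.
move=> cf pf; have [M hM] := (locbm_cont cf).2 0 1.
have M0 : 0 <= M by apply: le_trans (hM 0 _); rewrite ?normr_ge0 ?lexx ?ler01.
exists M => // x; rewrite -(periodic_frac x pf); apply: hM.
by have /andP[h1 h2] := frac_itv x; rewrite h1 ltW.
Qed.

Section Energy.
Variables (s L : R) (f f' : R -> R).
Hypotheses (s0 : 0 <= s) (lf : lip L f) (df : forall x, is_derive x 1 f (f' x)).
Hypotheses (cf' : continuous f') (pf' : forall x, f' (x + 1) = f' x).

Let hS : locbm (fun y => hopf_lax s f y - f y).
Proof.
apply: locbmB; apply: locbm_cont; last exact: lip_cont lf.
exact: lip_cont (hopf_lax_lip s0 lf).
Qed.

(* No convexity is needed for this lower bound: past the formation of shocks energy only decreases. *)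
Lemma hopf_lax_energy_ge :
  - (s / 2 * intv 0 1 (fun x => f' x ^+ 2)) <= intv 0 1 (fun y => hopf_lax s f y - f y).
Proof.
move: s0 hS; rewrite le_eqVlt => /predU1P[<- _|s0' hS'].
  rewrite !mul0r oppr0 hopf_lax0; apply: intv_ge0 => // x _; by rewrite subrr.
have [N N0 hN] := periodic_bounded cf' pf'.
have M0 : 0 <= s * N by rewrite mulr_ge0.
have f'M x : s * `|f' x| <= s * N by rewrite ler_pM2l.
have hd := locbm_deficit s cf' (s * N).
rewrite -(intv_deficit s0' cf' pf' M0 f'M) -intvN//.
apply: le_intv => //; first exact: locbmN.
by move=> y _; have := hopf_lax_deficit s0' df cf' M0 f'M y; lra.
Qed.

(** As long as characteristics do not cross, the deficit is exact and no energy is dissipated. *)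
Lemma hopf_lax_energy_le : (forall x x', x <= x' -> x + s * f' x <= x' + s * f' x') ->
  intv 0 1 (fun y => hopf_lax s f y - f y) <= - (s / 2 * intv 0 1 (fun x => f' x ^+ 2)).
Proof.
move: s0 hS; rewrite le_eqVlt => /predU1P[<- _ _|s0' hS' mono].
  rewrite !mul0r oppr0 hopf_lax0 (intv_ext _ _ (g := fun=> 0)) ?intv_cst ?mul0r// => x.
  by rewrite subrr.
have [N N0 hN] := periodic_bounded cf' pf'.
have M0 : 0 <= s * N by rewrite mulr_ge0.
have f'M x : s * `|f' x| <= s * N by rewrite ler_pM2l.
have hd := locbm_deficit s cf' (s * N).
rewrite -(intv_deficit s0' cf' pf' M0 f'M) -intvN//.
apply: le_intv => //; first exact: locbmN.
by move=> y _; rewrite (hopf_lax_deficit_eq s0' lf df cf' M0 f'M)//; lra.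
Qed.

End Energy.

End HopfLaxIntegral.

(** * Lipschitz bounds and first-order Taylor remainders *)

Section Taylor.
Context {R : realType}.
Implicit Types (f : R -> R).

Lemma lip_derive_le L f (x l : R) : lip L f -> is_derive x 1 f l -> `|l| <= L.
Proof.
move=> lf df; apply/ler_addgt0Pr => e e0.
have [d d0 hd] := is_deriveP_eps df e0.
have d20 : 0 < d / 2 by rewrite divr_gt0.
have h1 := hd (d / 2); rewrite (gtr0_norm d20) in h1.
have {}h1 := h1 ltac:(lra).
have h2 := lf (x + d / 2) x; rewrite addrAC subrr add0r (gtr0_norm d20) in h2.
set A := f (x + d / 2) - f x in h1 h2.
have h3 : `|d / 2 * l| <= `|A| + `|A - d / 2 * l|.
  by apply: le_trans (ler_normB _ _); rewrite subKr.
rewrite normrM (gtr0_norm d20) in h3.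
by rewrite -(ler_pM2l d20); lra.
Qed.

Lemma derive_lip L f f' : (forall x : R, is_derive x 1 f (f' x)) ->
  (forall x, `|f' x| <= L) -> lip L f.
Proof.
move=> df hf.
have H (a b : R) : a < b -> `|f b - f a| <= L * (b - a).
  move=> ab; have [c _ ->] : exists2 c, c \in `]a, b[ & f b - f a = f' c * (b - a).
    by apply: MVT => //; apply: continuous_subspaceT; exact: derive_cont df.
  have ba : 0 < b - a by rewrite subr_gt0.
  by rewrite normrM (gtr0_norm ba) ler_pM2r.
move=> x y; case: (ltgtP x y) => [xy|yx|->]; last by rewrite !subrr normr0 mulr0.
  by rewrite distrC (distrC x y) (gtr0_norm (_ : 0 < y - x)) ?subr_gt0// H.
by rewrite (gtr0_norm (_ : 0 < x - y)) ?subr_gt0// H.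
Qed.

Lemma taylor_lip D f f' x h : (forall x : R, is_derive x 1 f (f' x)) -> lip D f' ->
  `|f (x + h) - f x - h * f' x| <= D * h ^+ 2.
Proof.
move=> df lf.
have D0 : 0 <= D.
  by have := le_trans (normr_ge0 _) (lf 1 0); rewrite subr0 normr1 mulr1.
have H (a b y : R) : a < b -> (forall c, a < c < b -> `|c - y| <= b - a) ->
    `|f b - f a - (b - a) * f' y| <= D * (b - a) ^+ 2.
  move=> ab hy; have [c] : exists2 c, c \in `]a, b[ & f b - f a = f' c * (b - a).
    by apply: MVT => //; apply: continuous_subspaceT; exact: derive_cont df.
  rewrite in_itv/= => cab ->.
  have ba : 0 < b - a by rewrite subr_gt0.
  rewrite mulrC -mulrBr normrM (gtr0_norm ba) expr2 mulrCA ler_pM2l//.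
  by apply: (le_trans (lf _ _)); rewrite ler_wpM2l// hy.
case: (ltgtP 0 h) => [h0|h0|<-]; last first.
- by rewrite addr0 subrr mul0r subr0 normr0 expr0n mulr0.
- have := H (x + h) x x; rewrite gtrDl => /(_ h0).
  rewrite (_ : x - (x + h) = - h); last by ring.
  rewrite sqrrN => HH; rewrite -normrN (_ : - (_ - _ - _) = f x - f (x + h) - - h * f' x); last by ring.
  by apply: HH => c /andP[h1 h2]; rewrite ltr0_norm ?subr_lt0//; lra.
- have := H x (x + h) x; rewrite ltrDl => /(_ h0).
  rewrite (_ : x + h - x = h); last by ring.
  by apply => c /andP[h1 h2]; rewrite gtr0_norm ?subr_gt0//; lra.
Qed.

End Taylor.

(** * The convex envelope *)

Section Envelope.
Context {R : realType}.
Implicit Types (f g : R -> R) (x y t p h : R).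

Lemma convex_functionP f : convex_function [set: R^o] f <->
  forall p x y, 0 <= p <= 1 -> f ((1 - p) * x + p * y) <= (1 - p) * f x + p * f y.
Proof.
split=> [cf p x y /andP[p0 p1]|cf t x y _ _].
  have H : f (p * y + (1 - p) * x) <= p * f y + (1 - p) * f x :=
    cf (Itv01 p0 p1) y x (in_setT _) (in_setT _).
  by rewrite addrC [X in _ <= X]addrC.
have t01 : 0 <= t%:num <= 1 by apply/andP; split; [exact: ge0|exact: le1].
have H := cf t%:num y x t01.
rewrite addrC [X in _ <= X]addrC in H; exact: H.
Qed.

(** Convexity puts every left difference quotient below every right one, so the supremum of the left
    quotients is a subgradient. *)
Lemma convex_support g x : (forall p x y, 0 <= p <= 1 ->
    g ((1 - p) * x + p * y) <= (1 - p) * g x + p * g y) ->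
  exists p, forall h, g x + p * h <= g (x + h).
Proof.
move=> cg.
have slope u v : 0 < u -> 0 < v -> (g x - g (x - u)) / u <= (g (x + v) - g x) / v.
  move=> u0 v0; have uv : 0 < u + v by rewrite addr_gt0.
  have := cg (u / (u + v)) (x - u) (x + v).
  have -> : (1 - u / (u + v)) * (x - u) + u / (u + v) * (x + v) = x.
    by field; rewrite gt_eqF.
  have h01 : 0 <= u / (u + v) <= 1.
    apply/andP; split; first by rewrite divr_ge0// ltW.
    by rewrite ler_pdivrMr// mul1r lerDl ltW.
  move=> /(_ h01) H.
  rewrite ler_pdivrMr// mulrAC ler_pdivlMr//.
  have := ler_wpM2l (ltW uv) H.
  have -> : (u + v) * ((1 - u / (u + v)) * g (x - u) + u / (u + v) * g (x + v)) =
    v * g (x - u) + u * g (x + v) by field; rewrite gt_eqF.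
  lra.
pose A := [set (g x - g (x - u)) / u | u in [set u | 0 < u]].
have supA : has_sup A.
  split; first by exists ((g x - g (x - 1)) / 1); exists 1 => //=; exact: ltr01.
  by exists ((g (x + 1) - g x) / 1) => _ [u /= u0 <-]; exact: slope.
exists (sup A) => h; have [h0|h0|->] := ltgtP h 0.
- have u0 : 0 < - h by rewrite oppr_gt0.
  have : (g x - g (x - - h)) / (- h) <= sup A by apply: ub_le_sup; [case: supA|exists (- h)].
  rewrite ler_pdivrMr// opprK; lra.
- have : sup A <= (g (x + h) - g x) / h.
    by apply: ge_sup; [case: supA|move=> _ [u /= u0 <-]; exact: slope].
  rewrite ler_pdivlMr//; lra.
- by rewrite mulr0 !addr0.
Qed.

Lemma is_derive_periodic f f' : (forall x : R, is_derive x 1 f (f' x)) ->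
  (forall x, f (x + 1) = f x) -> forall x, f' (x + 1) = f' x.
Proof.
move=> df pf x.
have S : is_derive x 1 (fun y : R => y + 1) 1.
  by have := is_deriveD (is_derive_id x 1) (is_derive_cst (1 : R) x 1);
    move/is_derive_congr; apply=> //; rewrite addr0.
have := @is_derive1_comp R f (fun y => y + 1) x _ _ (df (x + 1)) S.
rewrite mulr1 => /is_derive_congr/(_ pf erefl)[_ <-].
by have [_ <-] := df x.
Qed.

Section Data.
Variables (T : R) (phi phiT : R -> R).
Hypotheses (T0 : 0 < T) (sphi : smooth phi) (pphi : periodic phi 1).
Hypothesis env : convex_envelope (fun x => x ^+ 2 / 2 + T * phi x)
                                 (fun x => x ^+ 2 / 2 + T * phiT x).

Let F x := x ^+ 2 / 2 + T * phi x.
Let G x := x ^+ 2 / 2 + T * phiT x.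

Let cG p x y : 0 <= p <= 1 -> G ((1 - p) * x + p * y) <= (1 - p) * G x + p * G y.
Proof. by case: env => /convex_functionP cG _ _; exact: cG. Qed.

Let GF x : G x <= F x. Proof. by case: env => _ h _; exact: h. Qed.

Let Gmax (h : R -> R) : (forall p x y, 0 <= p <= 1 -> h ((1 - p) * x + p * y) <= (1 - p) * h x + p * h y) ->
  (forall x, h x <= F x) -> forall x, h x <= G x.
Proof. by move=> /convex_functionP ch hF; case: env => _ _; apply. Qed.

Lemma envelope_le x : phiT x <= phi x.
Proof. by have := GF x; rewrite /F /G lerD2l ler_pM2l. Qed.

Lemma envelope_periodic x : phiT (x + 1) = phiT x.
Proof.
have H (c : R) : c ^+ 2 = 1 -> (forall x, phi (x + c) = phi x) -> forall x, phiT (x + c) <= phiT x.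
  move=> c1 pc y.
  have : G (y + c) - c * y - 1 / 2 <= G y.
    (* For c = 1 or c = -1, F(u + c) = F(u) + c u + 1/2. Hence the translate of the envelope,
       corrected by this affine function, is a convex minorant of F. *)
    apply: (Gmax (h := fun y => G (y + c) - c * y - 1 / 2)) => [p u v h01|u].
      have -> : (1 - p) * u + p * v + c = (1 - p) * (u + c) + p * (v + c) by ring.
      have := cG (u + c) (v + c) h01; lra.
    have := GF (u + c); rewrite /F pc sqrrD c1; lra.
  rewrite /G sqrrD c1 => h; rewrite -(ler_pM2l T0); lra.
apply/eqP; rewrite eq_le H ?expr1n//=.
have := H (- 1); rewrite sqrrN expr1n => /(_ erefl) h.
have := h _ (x + 1); rewrite addrK; apply => y.
by rewrite -[LHS]pphi subrK.
Qed.

Lemma smooth_periodic_second_diff : exists2 M, 0 <= M &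
  forall x h, phi (x + h) + phi (x - h) - 2 * phi x <= M * h ^+ 2.
Proof.
have d1 (x : R) := smooth_is_derive x sphi.
have d2 (x : R) := smooth_is_derive x (smooth_derive1 sphi).
have c2 := smooth_cont (smooth_derive1 (smooth_derive1 sphi)).
have [M M0 hM] := periodic_bounded c2 (is_derive_periodic d2 (is_derive_periodic d1 pphi)).
exists (2 * M) => [|x h]; first by rewrite mulr_ge0.
have l1 := derive_lip d2 hM.
have h1 := le_trans (ler_norm _) (taylor_lip x h d1 l1).
have h2 := le_trans (ler_norm _) (taylor_lip x (- h) d1 l1).
by move: h1 h2; rewrite sqrrN; lra.
Qed.

(** Semiconcavity passes to the envelope: the mean of its translates by h and - h, lowered by (1 + T
    M) h^2/2, is convex and stays below F, hence below the envelope. *)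
Lemma envelope_second_diff M : 0 <= M ->
  (forall x h, phi (x + h) + phi (x - h) - 2 * phi x <= M * h ^+ 2) ->
  forall x h, phiT (x + h) + phiT (x - h) - 2 * phiT x <= M * h ^+ 2.
Proof.
move=> M0 sd x h.
have : (G (x + h) + G (x - h) - (1 + T * M) * h ^+ 2) / 2 <= G x.
  apply: (Gmax (h := fun x => (G (x + h) + G (x - h) - (1 + T * M) * h ^+ 2) / 2)) => [p u v h01|u].
    have -> : (1 - p) * u + p * v + h = (1 - p) * (u + h) + p * (v + h) by ring.
    have -> : (1 - p) * u + p * v - h = (1 - p) * (u - h) + p * (v - h) by ring.
    have := cG (u + h) (v + h) h01; have := cG (u - h) (v - h) h01; lra.
  have := GF (u + h); have := GF (u - h).
  have := ler_wpM2l (ltW T0) (sd u h); rewrite /F !sqrrD sqrrN; lra.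
rewrite /G !sqrrD sqrrN => H; rewrite -(ler_pM2l T0); lra.
Qed.

Lemma envelope_derivative : exists u0 L M, [/\ 0 <= L, 0 <= M, lip L phi & lip L phiT] /\
  [/\ forall x, is_derive x 1 phiT (u0 x), continuous u0, forall x, u0 (x + 1) = u0 x,
      forall x h, phiT x + u0 x * h - T^-1 / 2 * h ^+ 2 <= phiT (x + h) &
      forall x h, phiT (x + h) + phiT (x - h) - 2 * phiT x <= M * h ^+ 2].
Proof.
have [M M0 sdphi] := smooth_periodic_second_diff.
have sd := envelope_second_diff M0 sdphi.
have Ti0 : 0 < T^-1 by rewrite invr_gt0.
have sup x : exists p, forall h, phiT x + p * h - T^-1 / 2 * h ^+ 2 <= phiT (x + h).
  have [p hp] := convex_support x cG.
  (* Here [p] is a subgradient of x^2/2 + T phi^T; removing the parabola and dividing by T leaves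
     the slope (p - x)/T and the curvature defect 1/T. *)
  exists ((p - x) / T) => h; rewrite -(ler_pM2l T0); have := hp h; rewrite /G sqrrD.
  have -> : T * (phiT x + (p - x) / T * h - T^-1 / 2 * h ^+ 2) =
    T * phiT x + (p - x) * h - h ^+ 2 / 2 by field; rewrite gt_eqF.
  lra.
have [u0 [du cu mu su]] := C11_of_support Ti0 M0 sup sd.
have pu := is_derive_periodic du envelope_periodic.
have [L1 L10 hL1] := periodic_bounded cu pu.
have d1 (x : R) := smooth_is_derive x sphi.
have p1 := is_derive_periodic d1 pphi.
have [L2 L20 hL2] := periodic_bounded (smooth_cont (smooth_derive1 sphi)) p1.
exists u0, (L1 + L2), M; split; split=> //.
- by rewrite addr_ge0.
- by apply: (@lip_le _ L2); [rewrite lerDr|exact: derive_lip d1 hL2].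
- by apply: (@lip_le _ L1); [rewrite lerDl|exact: derive_lip du hL1].
Qed.

(** Up to a function of y, T S_T phi(y) is the Legendre transform of x^2/2 + T phi with the sign
    reversed: it records the highest affine minorant of slope y. Such a minorant is convex, so it
    also lies below the envelope. *)
Lemma envelope_hopf_lax L y : lip L phi -> lip L phiT -> hopf_lax T phi y <= hopf_lax T phiT y.
Proof.
move=> l1 l2; apply: hopf_lax_glb => // a; set m := hopf_lax T phi y.
have hm b : m <= phi b + (y - b) ^+ 2 / (2 * T) by exact: (hopf_lax_le T0 l1).
have : T * m - y ^+ 2 / 2 + y * a <= G a.
  apply: (Gmax (h := fun a => T * m - y ^+ 2 / 2 + y * a)) => [p u v _|b]; first by lra.
  have := ler_wpM2l (ltW T0) (hm b); rewrite mulrDr.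
  have -> : T * ((y - b) ^+ 2 / (2 * T)) = (y - b) ^+ 2 / 2 by field; rewrite gt_eqF.
  by rewrite /F sqrrB; lra.
rewrite /G => h; rewrite -(ler_pM2l T0) mulrDr.
have -> : T * ((y - a) ^+ 2 / (2 * T)) = (y - a) ^+ 2 / 2 by field; rewrite gt_eqF.
by rewrite sqrrB; lra.
Qed.

End Data.

Lemma hopf_lax_periodic s L f y : 0 <= s -> lip L f -> (forall x, f (x + 1) = f x) ->
  hopf_lax s f (y + 1) = hopf_lax s f y.
Proof.
rewrite le_eqVlt => /predU1P[<- _ pf|s0 lf pf]; first by rewrite hopf_lax0.
apply/eqP; rewrite eq_le; apply/andP; split.
  have [a ->] := hopf_lax_attained s0 lf y.
  have := hopf_lax_le s0 lf (y + 1) (a + 1).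
  by rewrite pf; have -> : y + 1 - (a + 1) = y - a by ring.
have [a ->] := hopf_lax_attained s0 lf (y + 1).
have := hopf_lax_le s0 lf y (a - 1).
by rewrite -(pf (a - 1)) subrK; have -> : y - (a - 1) = y + 1 - a by ring.
Qed.

(** Before T the evolution of phi^T stays C^1, and by the last clause the characteristics issued at
    time t do not cross before T either. This makes the energy balance exact on [t, T]. *)
Lemma hopf_lax_C11 T t L M f f' : 0 <= t < T -> 0 <= M -> lip L f ->
  (forall x, is_derive x 1 f (f' x)) -> (forall x, f (x + 1) = f x) ->
  (forall x h, f x + f' x * h - T^-1 / 2 * h ^+ 2 <= f (x + h)) ->
  (forall x h, f (x + h) + f (x - h) - 2 * f x <= M * h ^+ 2) ->
  exists u, [/\ forall x, is_derive x 1 (hopf_lax t f) (u x), continuous u,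
     forall x, u (x + 1) = u x &
     forall x y, x <= y -> x + (T - t) * u x <= y + (T - t) * u y].
Proof.
move=> /andP[t0 tT] M0 lf df pf sup sd.
have Tt : 0 < (T - t)^-1 by rewrite invr_gt0 subr_gt0.
have S x : exists p, forall h, hopf_lax t f x + p * h - (T - t)^-1 / 2 * h ^+ 2 <= hopf_lax t f (x + h).
  by apply: (hopf_lax_support (f' := f')) => //; rewrite t0.
have D x h : hopf_lax t f (x + h) + hopf_lax t f (x - h) - 2 * hopf_lax t f x <= M * h ^+ 2.
  exact: hopf_lax_second_diff.
have [u [du cu mu _]] := C11_of_support Tt M0 S D.
exists u; split=> //; first by apply: (is_derive_periodic du) => x; exact: (hopf_lax_periodic _ t0 lf).
by move=> x y /mu; rewrite invrK ![_ * (T - t)]mulrC.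
Qed.

End Envelope.

(** * Pairings with charges *)

Section Rearrangements.
Context {R : realType}.
Implicit Types (a b c d k : R).

Fact sub_eq_of_add a b c d : a + d = b + c -> a - b = c - d. Proof. lra. Qed.
Fact add_eq_of_sub a b c d : a - b = c - d -> c + b = d + a. Proof. lra. Qed.
Fact addBB a b c d : a + c - (b + d) = a - b + (c - d). Proof. ring. Qed.
Fact mulBN k a b : - k * b - - k * a = k * (a - b). Proof. ring. Qed.
Fact le_of_subB a b c d : d - b <= c - a -> a - b <= c - d. Proof. lra. Qed.

End Rearrangements.

Section Pairing.
Context {R : realType}.
Variable T : R.
Implicit Types (f g : R * R -> R) (mu nu : {charge set (plane R) -> \bar R}).

Definition cellbm f := measurable_fun (cell T : set (plane R)) (f : plane R -> R) /\
  exists M, forall p, cell T p -> `|f p| <= M.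

Lemma cellbm_integrable (m : {measure set (plane R) -> \bar R}) f :
  m (cell T) \is a fin_num -> cellbm f -> m.-integrable (cell T) (EFin \o f).
Proof.
move=> mfin [mf [M hM]]; apply: measurable_bounded_integrable => //.
- exact: measurable_cell.
- by rewrite ltey_eq mfin.
- exists M; split; first exact: num_real.
  by move=> y My p /hM h; exact: le_trans h (ltW My).
Qed.

Lemma locbm2_cellbm f : locbm2 f -> cellbm f.
Proof.
move=> [mf bf]; split; first exact: measurable_funTS.
have [M hM] := bf (Num.max `|T| 1); exists M => -[t x] [/=].
rewrite !in_itv/= => /andP[t0 tT] /andP[x0 x1]; apply: hM.
  by rewrite le_max ger0_norm// (le_trans tT)// ler_norm.
by rewrite le_max [in X in _ || X]ger0_norm// (ltW x1) orbT.
Qed.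

Lemma cellbmD f g : cellbm f -> cellbm g -> cellbm (fun p => f p + g p).
Proof.
move=> [mf [M hM]] [mg [N hN]]; split; first exact: measurable_funD.
by exists (M + N) => p cp; rewrite (le_trans (ler_normD _ _))// lerD ?hM ?hN.
Qed.

Lemma cellbmZ k f : cellbm f -> cellbm (fun p => k * f p).
Proof.
move=> [mf [M hM]]; split; first exact: measurable_funM.
by exists (`|k| * M) => p cp; rewrite normrM ler_wpM2l ?hM.
Qed.

Lemma Rintegral_measure_add (m1 m2 : {measure set (plane R) -> \bar R}) f :
  m1 (cell T) \is a fin_num -> m2 (cell T) \is a fin_num -> cellbm f ->
  \int[measure_add m1 m2]_(p in cell T) f p =
  \int[m1]_(p in cell T) f p + \int[m2]_(p in cell T) f p.
Proof.
move=> f1 f2 hf; have i1 := cellbm_integrable f1 hf; have i2 := cellbm_integrable f2 hf.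
have mc := @measurable_cell R T.
have E := integral_measure_add mc i1 i2.
apply: (etrans (congr1 fine E)); rewrite fineD//.
- exact: (integrable_fin_num mc i1).
- exact: (integrable_fin_num mc i2).
Qed.

Lemma eq_measure_Rintegral (m1 m2 : {measure set (plane R) -> \bar R}) f :
  (forall A, measurable A -> m1 A = m2 A) ->
  \int[m1]_(p in cell T) f p = \int[m2]_(p in cell T) f p.
Proof. by move=> E; congr fine; apply: eq_measure_integral => A mA _; exact: E. Qed.

Lemma jordan_decompB mu P N (PN : hahn_decomposition mu P N) A : measurable A ->
  mu A = (jordan_pos PN A - jordan_neg PN A)%E.
Proof. by move=> mA; rewrite (jordan_decomp PN mA) /cadd/= /cscale/= EFinN mulN1e. Qed.

(** Any representation of mu as a difference of finite measures computes the pairing, not only the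
    Jordan one: the measures [jordan_pos + m2] and [jordan_neg + m1] coincide, hence so do their
    integrals. Linearity in mu follows from this. *)
Lemma pairing_decomp mu (m1 m2 : {measure set (plane R) -> \bar R}) f :
  (forall A, measurable A -> m1 A \is a fin_num) ->
  (forall A, measurable A -> m2 A \is a fin_num) ->
  (forall A, measurable A -> mu A = (m1 A - m2 A)%E) -> cellbm f ->
  pairing T f mu = \int[m1]_(p in cell T) f p - \int[m2]_(p in cell T) f p.
Proof.
move=> f1 f2 E hf; rewrite /pairing; case: cid => P HP; case: cid => N PN.
have mc := @measurable_cell R T.
have fp A : measurable A -> jordan_pos PN A \is a fin_num by exact: fin_num_measure.
have fn A : measurable A -> jordan_neg PN A \is a fin_num by exact: fin_num_measure.
have H A : measurable A ->
    measure_add (jordan_pos PN) m2 A = measure_add (jordan_neg PN) m1 A.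
  move=> mA; have := jordan_decompB PN mA; rewrite E//.
  have E1 : measure_add (jordan_pos PN) m2 A = (jordan_pos PN A + m2 A)%E by exact: measure_addE.
  have E2 : measure_add (jordan_neg PN) m1 A = (jordan_neg PN A + m1 A)%E by exact: measure_addE.
  move=> J; apply: (etrans E1); apply: (etrans _ (esym E2)); move: J.
  have := f1 _ mA; have := f2 _ mA; have := fp _ mA; have := fn _ mA.
  move=> /fineK <- /fineK <- /fineK <- /fineK <-.
  rewrite -!EFinN -!EFinD => -[e]; exact: (congr1 (@EFin R) (add_eq_of_sub e)).
have := eq_measure_Rintegral f H.
rewrite (Rintegral_measure_add (fp _ mc) (f2 _ mc) hf) (Rintegral_measure_add (fn _ mc) (f1 _ mc) hf).
exact: sub_eq_of_add.
Qed.

Lemma pairing_measure (m : {finite_measure set (plane R) -> \bar R}) f : cellbm f ->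
  pairing T f (charge_of_finite_measure m) = \int[m]_(p in cell T) f p.
Proof.
move=> hf.
rewrite (@pairing_decomp _ m mzero)//.
- by rewrite /Rintegral integral_measure_zero subr0.
- by move=> A mA; exact: fin_num_measure.
- by move=> A mA; rewrite sube0.
Qed.

Lemma jordan_exists mu : exists m1 m2 : {measure set (plane R) -> \bar R},
  [/\ forall A, measurable A -> m1 A \is a fin_num,
      forall A, measurable A -> m2 A \is a fin_num &
      forall A, measurable A -> mu A = (m1 A - m2 A)%E].
Proof.
have [P [N PN]] := Hahn_decomposition mu.
exists (jordan_pos PN), (jordan_neg PN); split.
- by move=> A mA; exact: fin_num_measure.
- by move=> A mA; exact: fin_num_measure.
- by move=> A mA; exact: jordan_decompB.
Qed.

Lemma pairing_cadd mu nu f : cellbm f ->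
  pairing T f (cadd mu nu) = pairing T f mu + pairing T f nu.
Proof.
move=> hf; have mc := @measurable_cell R T.
have [m1 [m2 [f1 f2 E]]] := jordan_exists mu.
have [n1 [n2 [g1 g2 F]]] := jordan_exists nu.
rewrite (pairing_decomp f1 f2 E hf) (pairing_decomp g1 g2 F hf).
rewrite (@pairing_decomp _ (measure_add m1 n1) (measure_add m2 n2))//.
- rewrite (Rintegral_measure_add (f1 _ mc) (g1 _ mc) hf) (Rintegral_measure_add (f2 _ mc) (g2 _ mc) hf).
  exact: addBB.
- move=> A mA; apply: (eq_ind_r (fun u : \bar R => u \is a fin_num) _ (measure_addE m1 n1 A)).
  by rewrite fin_numD f1// g1.
- move=> A mA; apply: (eq_ind_r (fun u : \bar R => u \is a fin_num) _ (measure_addE m2 n2 A)).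
  by rewrite fin_numD f2// g2.
- move=> A mA; transitivity ((m1 A + n1 A) - (m2 A + n2 A))%E; last first.
    exact: (f_equal2 (fun x y => x - y)%E (esym (measure_addE m1 n1 A)) (esym (measure_addE m2 n2 A))).
  rewrite /= /cadd/= E// F//.
  have := f1 _ mA; have := f2 _ mA; have := g1 _ mA; have := g2 _ mA.
  move=> /fineK <- /fineK <- /fineK <- /fineK <-.
  by rewrite -!EFinN -!EFinD; exact: (congr1 (@EFin R) (esym (addBB _ _ _ _))).
Qed.

Lemma pairing_copp mu f : cellbm f -> pairing T f (copp mu) = - pairing T f mu.
Proof.
move=> hf; have [m1 [m2 [f1 f2 E]]] := jordan_exists mu.
rewrite (pairing_decomp f1 f2 E hf) (@pairing_decomp _ m2 m1)// ?opprB// => A mA.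
rewrite /= /copp/= E//.
have := f1 _ mA; have := f2 _ mA => /fineK <- /fineK <-.
by rewrite -!EFinN -!EFinD; exact: (congr1 (@EFin R) (opprB _ _)).
Qed.

Lemma Rintegral_mscale (k : {nonneg R}) (m : {measure set (plane R) -> \bar R}) f :
  m (cell T) \is a fin_num -> cellbm f ->
  \int[mscale k m]_(p in cell T) f p = k%:num * \int[m]_(p in cell T) f p.
Proof.
move=> fm hf; have i1 := cellbm_integrable fm hf.
have mc := @measurable_cell R T.
have mEf := measurable_int m i1.
have ip := integrable_funepos mc i1; have iN := integrable_funeneg mc i1.
rewrite /Rintegral integralE ge0_integral_mscale//; last exact: measurable_funepos.
rewrite ge0_integral_mscale//; last exact: measurable_funeneg.
rewrite [in RHS]integralE.
have := integrable_fin_num mc ip; have := integrable_fin_num mc iN.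
by move=> /fineK <- /fineK <-; rewrite -!EFinM -!EFinN -!EFinD /=; ring.
Qed.

Lemma pairing_cscale k mu f : cellbm f ->
  pairing T f (cscale k mu) = k * pairing T f mu.
Proof.
move=> hf; have mc := @measurable_cell R T.
have [m1 [m2 [f1 f2 E]]] := jordan_exists mu.
rewrite (pairing_decomp f1 f2 E hf).
have [k0|/ltW k0] := leP 0 k.
  pose kk := NngNum k0.
  rewrite (@pairing_decomp _ (mscale kk m1) (mscale kk m2))//.
  - by rewrite !Rintegral_mscale ?f1 ?f2//= mulrBr.
  - by move=> A mA; rewrite /mscale/= fin_numM ?f1.
  - by move=> A mA; rewrite /mscale/= fin_numM ?f2.
  - move=> A mA; rewrite /= /cscale/= /mscale/= E//.
    have := f1 _ mA; have := f2 _ mA => /fineK <- /fineK <-.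
    by rewrite -!EFinM -!EFinN -!EFinD -?EFinM; exact: (congr1 (@EFin R) (mulrBr _ _ _)).
(* For k <= 0 the two measures exchange their roles and are scaled by - k. *)
have k0' : 0 <= - k by rewrite oppr_ge0.
pose kk := NngNum k0'.
rewrite (@pairing_decomp _ (mscale kk m2) (mscale kk m1))//.
- by rewrite !Rintegral_mscale ?f1 ?f2//=; exact: mulBN.
- by move=> A mA; rewrite /mscale/= fin_numM ?f2.
- by move=> A mA; rewrite /mscale/= fin_numM ?f1.
- move=> A mA; rewrite /= /cscale/= /mscale/= E//.
  have := f1 _ mA; have := f2 _ mA => /fineK <- /fineK <-.
  by rewrite -!EFinM -!EFinN -!EFinD -?EFinM; exact: (congr1 (@EFin R) (esym (mulBN _ _ _))).
Qed.

Lemma pairingD mu f g : cellbm f -> cellbm g ->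
  pairing T (fun p => f p + g p) mu = pairing T f mu + pairing T g mu.
Proof.
move=> hf hg; have mc := @measurable_cell R T.
have [m1 [m2 [f1 f2 E]]] := jordan_exists mu.
rewrite (pairing_decomp f1 f2 E hf) (pairing_decomp f1 f2 E hg).
rewrite (pairing_decomp f1 f2 E (cellbmD hf hg)).
rewrite (RintegralD mc (cellbm_integrable (f1 _ mc) hf) (cellbm_integrable (f1 _ mc) hg)).
rewrite (RintegralD mc (cellbm_integrable (f2 _ mc) hf) (cellbm_integrable (f2 _ mc) hg)).
exact: addBB.
Qed.

Lemma pairingZ mu k f : cellbm f ->
  pairing T (fun p => k * f p) mu = k * pairing T f mu.
Proof.
move=> hf; have mc := @measurable_cell R T.
have [m1 [m2 [f1 f2 E]]] := jordan_exists mu.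
rewrite (pairing_decomp f1 f2 E hf) (pairing_decomp f1 f2 E (cellbmZ k hf)).
rewrite (RintegralZl _ mc (cellbm_integrable (f1 _ mc) hf)).
rewrite (RintegralZl _ mc (cellbm_integrable (f2 _ mc) hf)).
exact: (esym (mulrBr _ _ _)).
Qed.

Lemma eq_pairing mu f g : (forall p, cell T p -> f p = g p) -> pairing T f mu = pairing T g mu.
Proof.
move=> fg; rewrite /pairing; case: cid => P HP; case: cid => N PN.
by congr (_ - _); apply: eq_Rintegral => p; rewrite inE => /fg.
Qed.

(** For a nonnegative charge written as m1 - m2 one has m2 <= m1, so the nonnegative function g - f
    has the larger integral against m1. *)
Lemma le_pairing mu f g : (forall A : set (plane R), measurable A -> (0 <= mu A)%E) ->
  cellbm f -> cellbm g -> (forall p, cell T p -> f p <= g p) ->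
  pairing T f mu <= pairing T g mu.
Proof.
move=> mu0 hf hg fg; have mc := @measurable_cell R T.
have [m1 [m2 [f1 f2 E]]] := jordan_exists mu.
have H : \int[m1]_(p in cell T) (g p - f p) >= \int[m2]_(p in cell T) (g p - f p).
  have hgf : cellbm (fun p => g p - f p).
    apply: cellbmD => //; have := cellbmZ (-1) hf.
    by under eq_fun do rewrite mulN1r.
  have i1 := cellbm_integrable (f1 _ mc) hgf; have i2 := cellbm_integrable (f2 _ mc) hgf.
  rewrite /Rintegral; apply: fine_le.
  - by apply: integrable_fin_num => //; exact: measurable_cell.
  - by apply: integrable_fin_num => //; exact: measurable_cell.
  pose h := ((EFin \o (fun p => g p - f p)) \_ (cell T : set (plane R))).
  have hE (m : {measure set (plane R) -> \bar R}) :
      (\int[m]_(p in cell T) (g p - f p)%:E = \int[m]_(p in cell T) h p)%E.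
    by apply: eq_integral => p pc; rewrite /h patchE pc.
  rewrite !hE; apply: ge0_le_measure_integral => //.
  - move=> A mA; have := mu0 _ mA; rewrite E//.
    have := f1 _ mA; have := f2 _ mA => /fineK <- /fineK <-.
    by rewrite -EFinN -EFinD !lee_fin subr_ge0.
  - move=> p; rewrite /h patchE; case: ifPn => // pc.
    by rewrite /= lee_fin subr_ge0 fg//; rewrite inE in pc.
  - by apply/(measurable_restrictT _ mc)/measurable_EFinP; case: hgf.
rewrite (RintegralB mc (cellbm_integrable (f1 _ mc) hg) (cellbm_integrable (f1 _ mc) hf)) in H.
rewrite (RintegralB mc (cellbm_integrable (f2 _ mc) hg) (cellbm_integrable (f2 _ mc) hf)) in H.
rewrite (pairing_decomp f1 f2 E hf) (pairing_decomp f1 f2 E hg); exact: le_of_subB.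
Qed.

End Pairing.

(** * The dual competitor *)

Section TorusFunctions.
Context {R : realType}.
Variable T : R.
Hypothesis T0 : 0 < T.

(** Projection of the line onto [0, T], written with [pos] so that its continuity and its Lipschitz
    bound are immediate. *)
Definition clamp (t : R) := pos (T - pos (T - t)).

Lemma clamp_cont : continuous clamp.
Proof.
have cp (f : R -> R) : continuous f -> continuous (fun t => pos (T - f t)).
  move=> cf t; apply: (@continuous_comp _ _ _ (fun t => T - f t) pos); last exact: pos_cont.
  by apply: cvgB; [exact: cvg_cst|exact: cf].
by apply: (cp (fun t => pos (T - t))); apply: (cp id) => t; exact: cvg_id.
Qed.

Lemma clamp_id t : 0 <= t <= T -> clamp t = t.
Proof. by move=> /andP[t0 tT]; rewrite /clamp (@pos_id _ (T - t)) ?subr_ge0// subKr pos_id. Qed.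

Lemma clamp_itv t : 0 <= clamp t <= T.
Proof.
rewrite /clamp pos_ge0/=; have u0 := pos_ge0 (T - t); move: (pos (T - t)) u0 => u u0.
by rewrite /pos ge_max (ltW T0) andbT gerBl.
Qed.

Lemma strip_clamp (p : R * R) : strip T (clamp p.1, p.2).
Proof. by split => //=; rewrite in_itv/= clamp_itv. Qed.

(** Freezing the function beyond times 0 and T extends it continuously to the plane without changing
    it on the strip, so that the integration lemmas for the plane apply. *)
Lemma continuous_on_torus_ext (z : R * R -> R) : continuous_on_torus T z ->
  exists2 zc, continuous zc & (forall p, strip T p -> zc p = z p) /\
     (forall t x, zc (t, x + 1) = zc (t, x)).
Proof.
move=> [pz /subspace_continuousP cz].
pose m (p : R * R) := (clamp p.1, p.2).
have cm : continuous m.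
  move=> p; apply: (@cvg_pair _ _ _ _ (nbhs (clamp p.1)) (nbhs p.2)); last exact: cvg_snd.
  by apply: (@continuous_comp _ _ _ (fun p : R * R => p.1) clamp); [exact: cvg_fst|exact: clamp_cont].
exists (fun p => z (m p)); last split.
- move=> p; apply/cvgrPdist_lt => e e0.
  have /cvgrPdist_lt/(_ e e0) := cz _ (strip_clamp p).
  rewrite near_withinE => H.
  have := cm p _ H; rewrite nbhs_simpl/=; apply: filterS => q; apply; exact: strip_clamp.
- by move=> [t x] [/=]; rewrite in_itv/= => t0 _; rewrite /m/= clamp_id.
- by move=> t x; apply: pz; rewrite in_itv/= clamp_itv.
Qed.

Lemma continuous_on_torus_cont (z : R * R -> R) : space_periodic T z -> continuous z ->
  continuous_on_torus T z.
Proof. by move=> pz cz; split=> //; exact: continuous_subspaceT. Qed.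

Lemma space_periodic_int (f : R * R -> R) t (k : int) x : space_periodic T f ->
  0 <= t <= T -> f (t, x + k%:~R) = f (t, x).
Proof.
move=> pf tT; apply: (periodic_int (f := fun y => f (t, y))) => y.
by apply: pf; rewrite in_itv.
Qed.

Lemma space_periodic_frac (f : R * R -> R) t x : space_periodic T f ->
  0 <= t <= T -> f (t, frac x) = f (t, x).
Proof. by move=> pf tT; rewrite /frac -mulrNz space_periodic_int. Qed.

(** At interior times the slices at x and x + 1 agree in a neighbourhood of t. At times 0 and T they
    are only known to agree on one side, and continuity of [dt f] carries the identity over. *)
Lemma space_periodic_dt (f : R * R -> R) : space_periodic T f -> continuous (dt f) ->
  (forall t x : R, is_derive t 1 (fun s => f (s, x)) (dt f (t, x))) -> space_periodic T (dt f).
Proof.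
move=> pf cdt df.
have inn (t x : R) : 0 < t < T -> dt f (t, x + 1) = dt f (t, x).
  move=> /andP[t0 tT].
  have E : \forall s \near t, f (s, x + 1) = f (s, x).
    near=> s; apply: pf; rewrite in_itv/=; apply/andP; split; apply: ltW; near: s.
      exact: lt_nbhsr.
    exact: lt_nbhsl.
  have D : is_derive t 1 (fun s => f (s, x)) (dt f (t, x + 1)).
    exact: near_eq_is_derive E (df t (x + 1)).
  by have [_ <-] := D; have [_ <-] := df t x.
move=> t x; rewrite in_itv/= => tT; apply/eqP; rewrite -subr_eq0 -normr_eq0 eq_le normr_ge0 andbT.
apply/ler_addgt0Pr => e e0; rewrite add0r.
pose g s := dt f (s, x + 1) - dt f (s, x).
have cg : continuous g.
  by move=> s; apply: cvgB; exact: cont_slice2.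
have /cvgrPdist_lt/(_ e e0)/nbhs_ballP[d /= d0 hd] := cg t.
have [s s0 ts] : exists2 s, 0 < s < T & `|t - s| < d.
  pose r := Num.min (d / 2) (T / 4).
  have r0 : 0 < r by rewrite lt_min !divr_gt0.
  have rd : r < d by apply: (@le_lt_trans _ _ (d / 2)); rewrite ?ge_min ?lexx// ltr_pdivrMr//; lra.
  have rT : r <= T / 4 by rewrite ge_min lexx orbT.
  move/andP: tT => [t0 tT]; have [h|h] := leP t (T / 2).
    exists (t + r); first by apply/andP; split; lra.
    by rewrite opprD addNKr normrN gtr0_norm.
  exists (t - r); first by apply/andP; split; lra.
  by rewrite subKr gtr0_norm.
have := hd s ts; rewrite /g (inn s x s0) subrr subr0 => /ltW; exact.
Unshelve. all: by end_near.
Qed.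

End TorusFunctions.

(** * Slabs of Lebesgue measure transported at constant velocity *)

Section Pieces.
Context {R : realType}.
Local Notation mu := (@lebesgue_measure R).
Variable T : R.
Hypothesis T0 : 0 < T.

Lemma measurable_frac : measurable_fun setT (@frac R).
Proof.
apply: measurable_funB => //; apply: nondecreasing_measurable => //.
by move=> x y xy; rewrite ler_int; exact: le_floor.
Qed.

(* Position at time t of the particle of velocity w that reaches y at time T. *)
Definition slanted (w : R) (p : plane R) : plane R := (p.1, frac (p.2 - (T - p.1) * w)).

Lemma measurable_slanted w : measurable_fun setT (slanted w).
Proof.
apply: measurable_fun_pair; first exact: measurable_fst.
apply: (measurableT_comp measurable_frac).
apply: measurable_funB; first exact: measurable_snd.
apply: measurable_funM => //; apply: measurable_funB => //; exact: measurable_fst.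
Qed.

End Pieces.

Definition box (R : realType) (T c d : R) : set (plane R) := `[0, T] `*` `[c, d[.

Lemma measurable_box (R : realType) (T c d : R) : measurable (box T c d).
Proof. by apply: measurableX; exact: measurable_itv. Qed.

Lemma area_box (R : realType) (T c d : R) : (area (box T c d) < +oo)%E.
Proof.
have -> : area (box T c d) =
    (lebesgue_measure (`[0%R, T] : set R) * lebesgue_measure (`[c, d[ : set R))%E.
  exact: product_measure1E.
rewrite !lebesgue_measure_itv/=.
by do 2?case: ifP => _; rewrite ?mule0 ?mul0e// -!EFinD -?EFinM ltry.
Qed.

(** Lebesgue measure on the slab [c, d[ of final positions, carried back in time with velocity [w];
    the reduction modulo 1 in [slanted] keeps it in the fundamental domain. *)
Definition piece (R : realType) (T w c d : R) : set (plane R) -> \bar R :=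
  pushforward (mfrestr (measurable_box T c d) (area_box T c d)) (slanted T w).

Definition piece_measure (R : realType) (T w c d : R) : {measure set (plane R) -> \bar R}.
Proof.
unshelve refine (pushforward (mfrestr (measurable_box T c d) (area_box T c d)) (slanted T w)
  : {measure set (plane R) -> \bar R}).
exact: measurable_slanted.
Defined.

HB.instance Definition _ (R : realType) (T w c d : R) := Measure.copy (piece T w c d) (piece_measure T w c d).

Lemma fin_piece (R : realType) (T w c d : R) : fin_num_fun (piece T w c d).
Proof.
move=> A mA; rewrite /piece /pushforward; apply: fin_num_measure.
by rewrite -[X in measurable X]setTI; exact: measurable_slanted.
Qed.

HB.instance Definition _ (R : realType) (T w c d : R) :=
  @Measure_isFinite.Build _ _ _ (piece T w c d) (fin_piece T w c d).

Lemma locbm2_slant (R : realType) (T w : R) (f : R * R -> R) : locbm2 f ->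
  locbm2 (fun p => f (p.1, p.2 - (T - p.1) * w)).
Proof.
move=> [mf bf].
have csl : continuous (fun p : R * R => p.2 - (T - p.1) * w).
  move=> p; apply: cvgB; first exact: cvg_snd.
  by apply: cvgM; [apply: cvgB; [exact: cvg_cst|exact: cvg_fst]|exact: cvg_cst].
split; first exact: (measurableT_comp mf (measurable_fun_pair measurable_fst (cont2_measurable csl))).
move=> r; have [K hK] := bf (r + (r + (`|T| + r) * `|w|)).
exists K => t x ht hx; have r0 : 0 <= r by exact: le_trans ht.
apply: hK => /=.
  by rewrite (le_trans ht)// lerDl addr_ge0// mulr_ge0// addr_ge0.
apply: (le_trans (ler_normB _ _)); apply: (@le_trans _ _ (r + (`|T| + r) * `|w|)).
  apply: lerD => //; rewrite normrM ler_wpM2r//.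
  by apply: (le_trans (ler_normB _ _)); rewrite lerD2l.
by rewrite lerDr.
Qed.

Section PieceIntegral.
Context {R : realType}.
Local Notation mu := (@lebesgue_measure R).
Variables (T w c d : R).
Hypotheses (T0 : 0 < T) (c0 : 0 <= c) (cd : c <= d) (d1 : d <= 1).

Let S : set (plane R) := box T c d.
Let mS : measurable S := measurable_box T c d.
Let fS : (area S < +oo)%E := area_box T c d.

Lemma slanted_cell p : S p -> cell T (slanted T w p).
Proof.
case: p => t x [/= h _]; split=> //=; rewrite in_itv/=; exact: frac_itv.
Qed.

Lemma piece_concentrated A : A `&` cell T = set0 -> piece T w c d A = 0%E.
Proof.
move=> A0; rewrite /piece /pushforward /mfrestr /mrestr.
rewrite (_ : _ `&` _ = set0) ?measure0// -subset0 => p [Ap Sp].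
have : (A `&` cell T) (slanted T w p) by split=> //; exact: slanted_cell.
by rewrite A0.
Qed.

Lemma piece_integral (f : R * R -> R) : locbm2 f -> space_periodic T f ->
  \int[piece T w c d]_(p in cell T) f p = intv 0 T (fun t => intv c d (fun y => f (t, y - (T - t) * w))).
Proof.
move=> hf pf; have [mf bf] := hf.
have mc := @measurable_cell R T.
pose D := slanted T w @^-1` cell T.
have mD : measurable D by rewrite -[X in measurable X]setTI; exact: measurable_slanted.
have SD : S `<=` D by move=> p; exact: slanted_cell.
have [_ [M hM]] := locbm2_cellbm T hf.
have intD : (mfrestr mS fS).-integrable D ((EFin \o f) \o slanted T w).
  apply: measurable_bounded_integrable => //.
  - by rewrite ltey_eq fin_num_measure.
  - apply: measurable_funTS; exact: (measurableT_comp mf (measurable_slanted T w)).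
  - exists M; split; first exact: num_real.
    by move=> y My p Dp; apply: le_trans (ltW My); exact: hM.
have E1 : (\int[piece T w c d]_(p in cell T) (f p)%:E = \int[mfrestr mS fS]_(p in D) (f (slanted T w p))%:E)%E.
  have mEf : measurable_fun setT (EFin \o f : plane R -> \bar R) by exact/measurable_EFinP.
  exact: (@integral_pushforward _ _ _ _ R (slanted T w) (measurable_slanted T w)
    (mfrestr mS fS) (cell T) (EFin \o f) mEf intD mc).
have N0 : mfrestr mS fS (D `\` S) = 0%E.
  by rewrite /mfrestr /mrestr setIC setDE setICA setICr setI0 measure0.
have mDS : measurable (D `\` S) by exact: measurableD.
have E2 : (\int[mfrestr mS fS]_(p in D) (f (slanted T w p))%:E =
    \int[mfrestr mS fS]_(p in S) (f (slanted T w p))%:E)%E.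
  rewrite (negligible_integral mDS mD intD N0); congr (integral _ _ _).
  by rewrite setDD setIidr.
have E3 : (\int[mfrestr mS fS]_(p in S) (f (slanted T w p))%:E =
    \int[area]_(p in S) (f (slanted T w p))%:E)%E.
  apply: eq_measure_integral => A mA AS.
  have E : mfrestr mS fS A = area (A `&` S) by [].
  by apply: (etrans E); rewrite (setIidl AS).
pose g (p : R * R) := f (p.1, p.2 - (T - p.1) * w).
have hg : locbm2 g := locbm2_slant T w hf.
(* The reduction modulo 1 is removed by periodicity of [f]. *)
have E4 : \int[area]_(p in S) f (slanted T w p) = \int[area]_(p in S) g p.
  apply: eq_Rintegral => -[t x]; rewrite inE => -[/= ht _]; rewrite in_itv/= in ht.
  exact: (space_periodic_frac _ pf ht).
apply: (etrans (congr1 fine (etrans E1 (etrans E2 E3)))); apply: (etrans E4).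
have Scd : `[c, d[ `<=` (`[c, d]%classic : set R) by apply: subset_itvl; rewrite bnd_simp.
rewrite (intvE _ (ltW T0)).
transitivity (\int[mu]_(t in `[0, T]) \int[mu]_(x in `[c, d[) g (t, x)).
  exact: (@area_fubini R g _ 0 T c d hg (measurable_itv _) Scd).1.
apply: eq_Rintegral => t _; exact: (intv_co cd (locbm2_slice1 t hg)).
Qed.

End PieceIntegral.

(** * Admissibility and dual value of the transport competitor *)

Section Competitor.
Context {R : realType}.
Local Notation mu := (@lebesgue_measure R).
Local Notation charges := ({charge set (plane R) -> \bar R}).

Fixpoint csum (n : nat) (k : nat -> R) (nu : nat -> charges) : charges :=
  if n is m.+1 then cadd (csum m k nu) (cscale (k m) (nu m)) else czero.

Implicit Types (k : nat -> R) (nu : nat -> charges) (A : set (plane R)).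

Lemma csum_eq0 n k nu A : (forall i, nu i A = 0%E) -> csum n k nu A = 0%E.
Proof.
by move=> h; elim: n => [|n IH] //=; rewrite /cadd/= IH /cscale/= h mule0 adde0.
Qed.

Lemma csum_ge0 n k nu A : (forall i, 0 <= k i) -> (forall i, (0 <= nu i A)%E) ->
  (0 <= csum n k nu A)%E.
Proof.
move=> k0 h; elim: n => [|n IH] //=; rewrite /cadd/= /cscale/= adde_ge0//.
by rewrite mule_ge0// lee_fin.
Qed.

Lemma pairing_csum T n k nu f : cellbm T f ->
  pairing T f (csum n k nu) = \sum_(i < n) k i * pairing T f (nu i).
Proof.
move=> hf; elim: n => [|n IH]; last first.
  by rewrite big_ord_recr/= pairing_cadd// pairing_cscale// IH.
rewrite big_ord0 (@pairing_decomp _ _ _ mzero mzero)//.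
- exact: subrr.
- by move=> A mA /=; rewrite sube0.
Qed.

Fact half_double_swap (x y : \bar R) : x \is a fin_num -> y \is a fin_num ->
  (x + (2 : R)%:E * ((2^-1 : R)%:E * (y + - x)))%E = y.
Proof.
move=> /fineK <- /fineK <-.
have h (a b : R) : a + 2 * (2^-1 * (b - a)) = b by field.
exact: (congr1 (@EFin R) (h _ _)).
Qed.

Fact half_diff0 (x y : \bar R) : x = 0%E -> y = 0%E ->
  ((2^-1 : R)%:E * (x + - y))%E = 0%E.
Proof. by move=> -> ->; rewrite oppe0 adde0 mule0. Qed.

Variables (T L : R) (v0 phi : R -> R).
Hypotheses (T0 : 0 < T) (lphi : lip L phi) (L0 : 0 <= L).
Hypotheses (dphi : forall x : R, is_derive x 1 phi (v0 x)) (cv0 : continuous v0).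
Hypotheses (pv0 : forall x, v0 (x + 1) = v0 x) (pphi : forall x, phi (x + 1) = phi x).

(* The competitor transports mass along the Hopf-Lax characteristics of phi.  Final positions are cut
   into N slabs, and all the particles of a slab get the velocity of its left end point. *)
Variable N : nat.
Hypothesis N0 : (0 < N)%N.

Let y_ (j : nat) : R := j%:R / N%:R.
Let a_ j := sval (cid (hopf_lax_attained T0 lphi (y_ j))).
Let a_E j : hopf_lax T phi (y_ j) = phi (a_ j) + (y_ j - a_ j) ^+ 2 / (2 * T).
Proof. exact: svalP (cid (hopf_lax_attained T0 lphi (y_ j))). Qed.
Let w_ j := (y_ j - a_ j) / T.

Let nu j : charges := charge_of_finite_measure (piece T (w_ j) (y_ j) (y_ j.+1)).

Definition competitor_flux : charges := csum N w_ nu.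
Definition competitor_density : charges := csum N (fun=> 1) nu.
Definition competitor_E : charges := copp competitor_flux.
(** Chosen so that Leb + 2 B is the transported density. *)
Definition competitor_B : charges :=
  cscale 2^-1 (cadd competitor_density (copp (charge_of_finite_measure (Leb T)))).

Let NR0 : 0 < N%:R :> R. Proof. by rewrite ltr0n. Qed.
Let y_le j : y_ j <= y_ j.+1.
Proof. by rewrite /y_ ler_pM2r ?invr_gt0// ler_nat. Qed.
Let y_step j : y_ j.+1 - y_ j = N%:R^-1.
Proof. by rewrite /y_ -mulrBl -natrB// subSnn mul1r. Qed.

Let intv_pieces (g : R -> R) : locbm g ->
  intv 0 1 g = \sum_(i < N) intv (y_ i) (y_ i.+1) g.
Proof.
move=> hg; have H n : intv 0 (y_ n) g = \sum_(i < n) intv (y_ i) (y_ i.+1) g.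
  elim: n => [|n IH]; first by rewrite big_ord0 /y_ mul0r intvxx.
  by rewrite big_ord_recr/= -IH intv_cat.
by rewrite -H /y_ divff// gt_eqF.
Qed.

Lemma pairing_competitor_piece f i : (i < N)%N -> locbm2 f -> space_periodic T f ->
  pairing T f (nu i) = intv (y_ i) (y_ i.+1) (fun y => intv 0 T (fun t => f (t, y - (T - t) * w_ i))).
Proof.
move=> iN hf pf; rewrite pairing_measure; last exact: locbm2_cellbm.
apply: (etrans (piece_integral (w_ i) T0 (y_le i) hf pf)).
exact: (intv_fubini 0 T (y_ i) (y_ i.+1) (locbm2_slant T (w_ i) hf)).
Qed.

Lemma pairing_flux_competitor f : locbm2 f -> space_periodic T f ->
  pairing T f competitor_flux = \sum_(i < N) w_ i * intv (y_ i) (y_ i.+1)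
     (fun y => intv 0 T (fun t => f (t, y - (T - t) * w_ i))).
Proof.
move=> hf pf; rewrite pairing_csum; last exact: locbm2_cellbm.
by apply: eq_bigr => i _; rewrite pairing_competitor_piece.
Qed.

Lemma pairing_density_competitor f : locbm2 f -> space_periodic T f ->
  pairing T f competitor_density = \sum_(i < N) intv (y_ i) (y_ i.+1)
     (fun y => intv 0 T (fun t => f (t, y - (T - t) * w_ i))).
Proof.
move=> hf pf; rewrite pairing_csum; last exact: locbm2_cellbm.
by apply: eq_bigr => i _; rewrite mul1r pairing_competitor_piece.
Qed.

Lemma pairing_Leb f : locbm2 f ->
  pairing T f (charge_of_finite_measure (Leb T)) = intv 0 1 (fun x => intv 0 T (fun t => f (t, x))).
Proof.
move=> hf; rewrite pairing_measure; last exact: locbm2_cellbm.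
apply: (etrans (Leb_integral (ltW T0) hf)); exact: (intv_fubini 0 T 0 1 hf).
Qed.

Lemma pairing_rho B f : cellbm T f ->
  pairing T f (rho T B) = pairing T f (charge_of_finite_measure (Leb T)) + 2 * pairing T f B.
Proof. by move=> hf; rewrite pairing_cadd// pairing_cscale. Qed.

Lemma pairing_rho_competitor f : cellbm T f ->
  pairing T f (rho T competitor_B) = pairing T f competitor_density.
Proof.
move=> hf; rewrite pairing_rho// pairing_cscale// pairing_cadd// pairing_copp//.
by rewrite mulrA mulfV// mul1r subrKC.
Qed.

Lemma rho_competitor_ge0 A : measurable A -> (0 <= rho T competitor_B A)%E.
Proof.
move=> mA; have fl : (charge_of_finite_measure (Leb T) : charges) A \is a fin_num by exact: fin_num_measure.
have fd : competitor_density A \is a fin_num by exact: fin_num_measure.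
rewrite (_ : rho T competitor_B A = competitor_density A); last exact: (half_double_swap fl fd).
apply: csum_ge0 => [i|i]; first exact: ler01.
exact: measure_ge0.
Qed.

Lemma intv_characteristic (Psi : R * R -> R) (w y : R) : test_function T Psi ->
  intv 0 T (fun t => dt Psi (t, y - (T - t) * w) + w * dx Psi (t, y - (T - t) * w)) =
  Psi (T, y) - Psi (0, y - T * w).
Proof.
move=> tP.
have cl : continuous (fun t : R => (t, y - (T - t) * w)).
  move=> t; apply: (@cvg_pair _ _ _ _ (nbhs (t : R)) (nbhs (y - (T - t) * w))); first exact: cvg_id.
  apply: cvgB; first exact: cvg_cst.
  by apply: cvgM; [apply: cvgB; [exact: cvg_cst|exact: cvg_id]|exact: cvg_cst].
have ck : continuous (fun t => dt Psi (t, y - (T - t) * w) + w * dx Psi (t, y - (T - t) * w)).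
  move=> t; apply: cvgD.
    by apply: (@continuous_comp _ _ _ (fun t : R => (t, y - (T - t) * w)) (dt Psi)); [exact: cl|exact: (test_dt_cont tP)].
  apply: cvgM; first exact: cvg_cst.
  by apply: (@continuous_comp _ _ _ (fun t : R => (t, y - (T - t) * w)) (dx Psi)); [exact: cl|exact: (test_dx_cont tP)].
have dF (t : R) : is_derive t 1 (fun t => Psi (t, y - (T - t) * w))
    (dt Psi (t, y - (T - t) * w) + w * dx Psi (t, y - (T - t) * w)).
  have := @C1_line R Psi 0 (y - T * w) 1 w t
    (test_dt_cont tP) (test_dx_cont tP) (test_dt tP) (test_dx tP).
  have E s : (0 + s * 1, y - T * w + s * w) = (s, y - (T - s) * w) by congr (_, _); ring.
  by move/is_derive_congr; apply=> [s|]; rewrite E// mul1r.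
apply: (etrans (intv_FTC 0 T ck dF)).
by rewrite subrr mul0r !subr0.
Qed.

(** On a piece of velocity w, Psi_t + w Psi_x is the derivative of Psi along the paths and
    integrates to Psi(T, y), since Psi(0, .) = 0. The final positions of the pieces tile the circle,
    so the sum is the integral of Psi(T, .), which the Lebesgue part of B cancels. *)
Lemma competitor_admissible : admissible T competitor_E competitor_B.
Proof.
split.
- move=> A mA A0; rewrite /competitor_E/= /copp/= csum_eq0 ?oppe0// => i.
  exact: piece_concentrated.
- move=> A mA A0.
  have D0 : competitor_density A = 0%E by apply: csum_eq0 => i; exact: piece_concentrated.
  have L0' : (charge_of_finite_measure (Leb T) : charges) A = 0%E.
    by apply: (etrans (congr1 (@area R) A0)); rewrite measure0.
  exact: (half_diff0 D0 L0').
- exact: rho_competitor_ge0.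
- move=> Psi tP Psi0.
  have pdt : space_periodic T (dt Psi).
    by apply: (space_periodic_dt T0); [case: tP|exact: (test_dt_cont tP)|exact: (test_dt tP)].
  have pdx : space_periodic T (dx Psi) by case: (test_dx_test tP).
  have ldt := locbm2_cont (test_dt_cont tP); have ldx := locbm2_cont (test_dx_cont tP).
  have cdt := locbm2_cellbm T ldt; have cdx := locbm2_cellbm T ldx.
  rewrite pairing_cscale// pairing_cadd// !pairing_copp// pairing_density_competitor//.
  rewrite pairing_flux_competitor// pairing_Leb//.
  have lP : locbm (fun y => Psi (T, y)) by apply: locbm_cont; apply: cont_slice1; exact: (test_cont tP).
  have -> : intv 0 1 (fun x => intv 0 T (fun t => dt Psi (t, x))) = intv 0 1 (fun y => Psi (T, y)).
    apply: intv_ext => x.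
    apply: (etrans (intv_FTC 0 T (cont_slice2 x (test_dt_cont tP)) (fun t => test_dt tP t x))).
    by rewrite Psi0 subr0.
  rewrite (intv_pieces lP) -mulrN -mulrDr opprK addrAC.
  apply/eqP; rewrite mulf_eq0; apply/orP; right; rewrite -big_split/= subr_eq0; apply/eqP.
  apply: eq_bigr => i _.
  have l1 := locbm2_slant T (w_ i) ldt; have l2 := locbm2_slant T (w_ i) ldx.
  rewrite -intvZ; last exact: (locbm2_intv2 0 T (locbm2_swap l2)).
  rewrite -intvD; last 2 first.
  + exact: (locbm2_intv2 0 T (locbm2_swap l1)).
  + exact: (locbmZ (w_ i) (locbm2_intv2 0 T (locbm2_swap l2))).
  apply: intv_ext => y.
  rewrite -intvZ; last exact: (locbm2_slice2 y l2).
  rewrite -intvD; last 2 first.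
  + exact: (locbm2_slice2 y l1).
  + exact: (locbmZ (w_ i) (locbm2_slice2 y l2)).
  by rewrite intv_characteristic// Psi0 subr0.
Qed.

Let hS : locbm (fun y => phi y - hopf_lax T phi y).
Proof.
apply: locbmB; apply: locbm_cont; first exact: lip_cont lphi.
exact: lip_cont (hopf_lax_lip (ltW T0) lphi).
Qed.

(** A particle that arrives at y collects phi(y) - phi(y - T w) and pays the kinetic energy T w^2/2.
    At the left end of a slab the balance is phi - S_T phi by the choice of the minimizer. Inside
    the slab, phi at the starting point and S_T phi at y are each off by at most L/N, whence the
    error 2 L/N. *)
Lemma competitor_value :
  ((intv 0 1 (fun y => phi y - hopf_lax T phi y) - 2 * L / N%:R)%:E <=
   dual_objective T v0 competitor_E competitor_B)%E.
Proof.
have lv : locbm2 (fun p : R * R => v0 p.2) by apply: locbm2_snd; exact: locbm_cont.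
have pv : space_periodic T (fun p : R * R => v0 p.2) by move=> t x _; exact: pv0.
pose K := \sum_(i < N) intv (y_ i) (y_ i.+1) (fun=> - (T / 2 * w_ i ^+ 2)).
have hK : (K%:E <= Kfun T competitor_E competitor_B)%E.
  apply: le_ereal_inf_tmp => _ [z [M [cz cM zM ->]]].
  have [zc czc [Ez pz]] := continuous_on_torus_ext T0 cz.
  have [Mc cMc [EM pM]] := continuous_on_torus_ext T0 cM.
  have CS p : cell T p -> strip T p by case.
  rewrite (@eq_pairing _ _ _ z zc); last by move=> p /CS/Ez.
  rewrite (@eq_pairing _ _ _ M Mc); last by move=> p /CS/EM.
  have lz := locbm2_cont czc; have lM := locbm2_cont cMc.
  have kz := locbm2_cellbm T lz; have kM := locbm2_cellbm T lM.
  have pzc : space_periodic T zc by move=> t x _.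
  have pMc : space_periodic T Mc by move=> t x _.
  rewrite pairing_copp// pairing_rho_competitor// pairing_flux_competitor// pairing_density_competitor//.
  rewrite lee_fin /K -sumrN mulr_sumr -big_split/=; apply: ler_sum => i _.
  have l1 := locbm2_slant T (w_ i) lz; have l2 := locbm2_slant T (w_ i) lM.
  rewrite -[X in _ <= X + _]mulNr -!intvZ; last 2 first.
  + exact: (locbm2_intv2 0 T (locbm2_swap l2)).
  + exact: (locbm2_intv2 0 T (locbm2_swap l1)).
  rewrite -intvD; last 2 first.
  + exact: (locbmZ _ (locbm2_intv2 0 T (locbm2_swap l1))).
  + exact: (locbmZ _ (locbm2_intv2 0 T (locbm2_swap l2))).
  apply: le_intv => //.
  + exact: locbm_cst.
  + by apply: locbmD; apply: locbmZ; [exact: (locbm2_intv2 0 T (locbm2_swap l1))|exact: (locbm2_intv2 0 T (locbm2_swap l2))].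
  move=> y _; rewrite -!intvZ; last 2 first.
  + exact: (locbm2_slice2 y l2).
  + exact: (locbm2_slice2 y l1).
  rewrite -intvD; last 2 first.
  + exact: (locbmZ _ (locbm2_slice2 y l1)).
  + exact: (locbmZ _ (locbm2_slice2 y l2)).
  have -> : - (T / 2 * w_ i ^+ 2) = intv 0 T (fun=> - (w_ i ^+ 2 / 2)) by rewrite intv_cst; ring.
  apply: le_intv => //; first exact: ltW.
  + exact: locbm_cst.
  + by apply: locbmD; apply: locbmZ; [exact: (locbm2_slice2 y l1)|exact: (locbm2_slice2 y l2)].
  move=> t tT.
  have st : strip T (t, y - (T - t) * w_ i) by split=> //=; rewrite in_itv.
  have := zM _ st; rewrite -Ez// -EM//=.
  set a := zc _; set b := Mc _ => ab.
  (* Young's inequality: b >= a^2 gives - w a + b/2 >= - w^2/2. *)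
  by have := sqr_ge0 (a - w_ i); rewrite sqrrB; lra.
rewrite /dual_objective (@le_trans _ _ ((- pairing T (fun p => v0 p.2) competitor_E)%:E + K%:E)%E)//; last first.
  by rewrite leeD2l.
rewrite -EFinD lee_fin pairing_copp; last exact: locbm2_cellbm.
rewrite opprK pairing_flux_competitor// /K -big_split/= (intv_pieces hS).
have -> : 2 * L / N%:R = \sum_(i < N) (2 * L / N%:R * N%:R^-1).
  by rewrite sumr_const card_ord -[RHS]mulr_natl mulrCA divff ?mulr1// gt_eqF.
rewrite -sumrB; apply: ler_sum => i _.
have lvs := locbm2_slant T (w_ i) lv.
rewrite -(y_step i) -intv_cst -intvB//; last exact: locbm_cst.
rewrite -intvZ; last exact: (locbm2_intv2 0 T (locbm2_swap lvs)).
rewrite -intvD; last 2 first.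
+ exact: (locbmZ _ (locbm2_intv2 0 T (locbm2_swap lvs))).
+ exact: locbm_cst.
apply: le_intv => //.
+ by apply: locbmB => //; exact: locbm_cst.
+ apply: locbmD; last exact: locbm_cst.
  exact: (locbmZ _ (locbm2_intv2 0 T (locbm2_swap lvs))).
move=> y /andP[y1 y2].
have -> : w_ i * intv 0 T (fun t => v0 (y - (T - t) * w_ i)) = phi y - phi (y - T * w_ i).
  have cl : continuous (fun t : R => y - (T - t) * w_ i).
    move=> t; apply: cvgB; first exact: cvg_cst.
    by apply: cvgM; [apply: cvgB; [exact: cvg_cst|exact: cvg_id]|exact: cvg_cst].
  have cvl : continuous (fun t : R => v0 (y - (T - t) * w_ i)).
    by move=> t; apply: (@continuous_comp _ _ _ (fun t : R => y - (T - t) * w_ i) v0); [exact: cl|exact: cv0].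
  rewrite -intvZ; last exact: locbm_cont.
  have dF (t : R) : is_derive t 1 (fun t => phi (y - (T - t) * w_ i)) (w_ i * v0 (y - (T - t) * w_ i)).
    have dl : is_derive t 1 (fun t : R => y - (T - t) * w_ i) (w_ i).
      have := is_deriveD (is_derive_cst (y - T * w_ i) t 1) (is_deriveZ (w_ i) (is_derive_id t 1)).
      move/is_derive_congr; apply=> [s|].
        by change (y - T * w_ i + w_ i * s = y - (T - s) * w_ i); ring.
      by change (0 + w_ i * 1 = w_ i); ring.
    have := @is_derive1_comp R phi (fun t => y - (T - t) * w_ i) t _ _ (dphi _) dl.
    by rewrite mulrC.
  have cvl' : continuous (fun t : R => w_ i * v0 (y - (T - t) * w_ i)).
    by move=> t; apply: cvgM; [exact: cvg_cst|exact: cvl].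
  apply: (etrans (intv_FTC 0 T cvl' dF)).
  by rewrite subrr mul0r !subr0.
have Tw : T * w_ i = y_ i - a_ i by rewrite /w_ mulrC divfK// gt_eqF.
have hy : `|y - y_ i| <= N%:R^-1 by rewrite ger0_norm ?subr_ge0// -(y_step i); lra.
have h1 : phi (y - T * w_ i) <= phi (a_ i) + L / N%:R.
  have := le_trans (ler_norm _) (lphi (y - T * w_ i) (a_ i)).
  have -> : y - T * w_ i - a_ i = y - y_ i by rewrite Tw; ring.
  by have := ler_wpM2l L0 hy; lra.
have h2 : hopf_lax T phi (y_ i) <= hopf_lax T phi y + L / N%:R.
  have := le_trans (ler_norm _) (hopf_lax_lip (ltW T0) lphi (y_ i) y).
  by rewrite distrC; have := ler_wpM2l L0 hy; lra.
have E := a_E i.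
have -> : T / 2 * w_ i ^+ 2 = (y_ i - a_ i) ^+ 2 / (2 * T).
  by rewrite -Tw; field; rewrite gt_eqF.
rewrite (y_step i) -mulrA; lra.
Qed.

End Competitor.

(** * Lower bound for the optimal dual value *)

Section DualBound.
Context {R : realType}.
Variables (T L : R) (v0 phi : R -> R).
Hypotheses (T0 : 0 < T) (lphi : lip L phi) (L0 : 0 <= L).
Hypotheses (dphi : forall x : R, is_derive x 1 phi (v0 x)) (cv0 : continuous v0).
Hypotheses (pv0 : forall x, v0 (x + 1) = v0 x).
Variables (E B : {charge set (plane R) -> \bar R}).
Hypothesis EB : dual_maximizer T v0 E B.

(** The maximizer beats the competitors for every N, so their error 2 L/N disappears; its own value
    is bounded from above by choosing M = z^2 in the infimum that defines [Kfun]. *)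
Lemma dual_lower_bound (z : R * R -> R) : continuous_on_torus T z ->
  intv 0 1 (fun y => phi y - hopf_lax T phi y) <=
  - pairing T (fun p => v0 p.2) E +
  (pairing T z E + 2^-1 * pairing T (fun p => z p ^+ 2) (rho T B)).
Proof.
move=> cz; set I := intv 0 1 _.
have cz2 : continuous_on_torus T (fun p => z p ^+ 2).
  case: cz => pz cz; split; first by move=> t x tT; rewrite pz.
  by move=> p; apply: continuousM; exact: cz.
have hK : (Kfun T E B <= (pairing T z E + 2^-1 * pairing T (fun p => z p ^+ 2) (rho T B))%:E)%E.
  by apply: ereal_inf_lbound; exists z, (fun p => z p ^+ 2); split.
apply/ler_addgt0Pr => e e0.
have [N N0 hN] : exists2 N : nat, (0 < N)%N & 2 * L / N%:R <= e.
  exists (Num.truncn (2 * L / e)).+1 => //.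
  rewrite ler_pdivrMr ?ltr0n// [leRHS]mulrC -ler_pdivrMr//; apply: ltW; exact: truncnS_gt.
have := le_trans (competitor_value T0 lphi L0 dphi cv0 pv0 N0)
  (EB.2 _ _ (competitor_admissible T0 lphi N0)).
rewrite -/I => h.
have := le_trans h (leeD2l _ hK).
by rewrite -EFinD lee_fin; lra.
Qed.

End DualBound.

(** * Mollifiers and Bernstein polynomials *)

Section Mollifier.
Context {R : realType}.
Implicit Types (k f g : R -> R) (x y h : R).

Definition vanishes_outside (r : R) k := forall x, r < `|x| -> k x = 0.

Lemma kernel_exists r : 0 < r -> r < 1 -> exists k, [/\ smooth k, forall x, 0 <= k x,
  vanishes_outside r k & intv (-1) 1 k = 1].
Proof.
move=> r0 r1; pose k x := cutoff (r ^+ 2 + - 1 * (x * x)).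
have sk : smooth k.
  apply: (@smooth_comp R cutoff (fun x => r ^+ 2 + - 1 * (x * x))); first exact: smooth_cutoff.
  apply: smoothD; first exact: smooth_cst.
  by apply: smoothZ; apply: smoothM; exact: smooth_id.
have k0 x : 0 <= k x by exact: cutoff_ge0.
have vk : vanishes_outside r k.
  move=> x hx; apply: cutoff_eq0; rewrite mulN1r -expr2 subr_le0 -[x ^+ 2]real_normK ?num_real//.
  by rewrite ler_sqr ?nnegrE// ?ltW.
have ck := smooth_cont sk; have lk := locbm_cont ck.
have kp : 0 < k 0 by apply: cutoff_gt0; rewrite mulr0 mulr0 addr0 exprn_gt0.
have [d /andP[d0 d1] hd] : exists2 d, 0 < d < 1 & forall x, `|x| <= d -> k 0 / 2 <= k x.
  have e0 : 0 < k 0 / 2 by rewrite divr_gt0.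
  have /cvgrPdist_lt/(_ _ e0)/nbhs_ballP[d /= d0 hd] := ck 0.
  exists (Num.min (d / 2) (1 / 2)); first by rewrite lt_min gt_min !divr_gt0//=; apply/orP; right; lra.
  move=> x; rewrite le_min => /andP[hx _].
  have : `|k 0 - k x| < k 0 / 2.
    by apply: hd; rewrite /ball/= sub0r normrN; lra.
  by move/(le_lt_trans (ler_norm _)); lra.
have I0 : 0 < intv (-1) 1 k.
  rewrite -(intv_cat (- d) _ _ lk) -(intv_cat d (- d) _ lk).
  have h1 : 0 <= intv (-1) (- d) k by apply: intv_ge0 => //; rewrite lerN2 ltW.
  have h2 : 0 <= intv d 1 k by apply: intv_ge0 => //; rewrite ltW.
  have h3 : intv (- d) d (fun=> k 0 / 2) <= intv (- d) d k.
    apply: le_intv => //; [lra|exact: locbm_cst|].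
    by move=> x hx; apply: hd; rewrite ler_norml.
  have h4 : 0 < intv (- d) d (fun=> k 0 / 2) by rewrite intv_cst mulr_gt0 ?divr_gt0//; lra.
  lra.
exists (fun x => (intv (-1) 1 k)^-1 * k x); split.
- exact: smoothZ.
- by move=> x; rewrite mulr_ge0// invr_ge0 ltW.
- by move=> x /vk ->; rewrite mulr0.
- by rewrite intvZ// mulVf// gt_eqF.
Qed.

Lemma derive_vanishes_outside r k k' : (forall x : R, is_derive x 1 k (k' x)) ->
  vanishes_outside r k -> vanishes_outside r k'.
Proof.
move=> dk vk x hx.
have E : \forall y \near x, k y = 0.
  have d0 : 0 < `|x| - r by rewrite subr_gt0.
  near=> y; apply: vk; rewrite -subr_gt0.
  have : `|x - y| < `|x| - r by near: y; exact: cvgr_dist_lt.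
  by have := ler_normD (x - y) y; rewrite subrK; lra.
have D : is_derive x 1 (fun=> 0 : R) (k' x).
  exact: near_eq_is_derive E (dk x).
by have [_ <-] := D; rewrite derive_cst.
Unshelve. all: by end_near.
Qed.

Definition mollify k g x := intv (-1) 1 (fun h => k h * g (x - h)).

Lemma mollify_periodic k g x : (forall x, g (x + 1) = g x) -> mollify k g (x + 1) = mollify k g x.
Proof. by move=> pg; apply: intv_ext => h; rewrite addrAC pg. Qed.

Lemma cont_shift_opp g x : continuous g -> continuous (fun h => g (x - h)).
Proof.
move=> cg h; apply: (@continuous_comp _ _ _ (fun h : R => x - h) g); last exact: cg.
by apply: cvgB; [exact: cvg_cst|exact: cvg_id].
Qed.

Lemma locbm_mollify k g x : continuous k -> continuous g -> locbm (fun h => k h * g (x - h)).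
Proof.
by move=> ck cg; apply: locbmM; apply: locbm_cont => //; exact: cont_shift_opp.
Qed.

Lemma mollify_cst k c x : continuous k -> intv (-1) 1 k = 1 -> mollify k (fun=> c) x = c.
Proof.
move=> ck k1; rewrite /mollify (intv_ext _ _ (g := fun h => c * k h)); last by move=> h; rewrite mulrC.
by rewrite intvZ ?k1 ?mulr1//; exact: locbm_cont.
Qed.

(** The two mollifications have different centres, so that an inequality between the two ends of a
    line segment passes through the convolution unchanged. *)
Lemma mollify_le r k f g x y a : continuous k -> continuous f -> continuous g ->
  (forall x, 0 <= k x) -> vanishes_outside r k -> intv (-1) 1 k = 1 ->
  (forall h, `|h| <= r -> f (x - h) <= g (y - h) + a) -> mollify k f x <= mollify k g y + a.
Proof.
move=> ck cf cg k0 vk k1 H.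
rewrite -(mollify_cst a 0 ck k1) /mollify -intvD; last 2 first.
- exact: locbm_mollify.
- by apply: locbm_mollify => // ?; exact: cvg_cst.
apply: le_intv.
- lra.
- exact: locbm_mollify.
- by apply: locbmD; apply: locbm_mollify => // ?; exact: cvg_cst.
move=> h _; have [hr|/vk ->] := leP `|h| r; last by rewrite !mul0r addr0.
by rewrite -mulrDr ler_wpM2l// H.
Qed.

Lemma mollify_lip k L g : continuous k -> lip L g -> (forall x, 0 <= k x) ->
  vanishes_outside 1 k -> intv (-1) 1 k = 1 -> lip L (mollify k g).
Proof.
move=> ck lg k0 vk k1; have cg := lip_cont lg.
have H x y : mollify k g x - mollify k g y <= L * `|x - y|.
  rewrite lerBlDl; apply: (mollify_le ck cg cg k0 vk k1) => h _.
  have := le_trans (ler_norm _) (lg (x - h) (y - h)).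
  by rewrite (_ : x - h - (y - h) = x - y); [lra|ring].
by move=> x y; rewrite ler_norml H andbT lerNl opprB distrC H.
Qed.

Lemma mollify_near r k L g x : continuous k -> lip L g -> 0 <= L -> (forall x, 0 <= k x) ->
  vanishes_outside r k -> intv (-1) 1 k = 1 -> `|mollify k g x - g x| <= L * r.
Proof.
move=> ck lg L0 k0 vk k1; have cg := lip_cont lg.
have cc (c : R) : continuous (fun _ : R => c) by move=> ?; exact: cvg_cst.
have G h : `|h| <= r -> `|g (x - h) - g x| <= L * r.
  move=> hr; apply: (le_trans (lg _ _)); rewrite ler_wpM2l//.
  by rewrite (_ : x - h - x = - h) ?normrN//; ring.
rewrite ler_distl; apply/andP; split.
  rewrite lerBlDr -(mollify_cst (g x) x ck k1).
  apply: (mollify_le ck (cc _) cg k0 vk k1) => h /G.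
  by rewrite ler_norml; lra.
rewrite -(mollify_cst (g x) x ck k1).
apply: (mollify_le ck cg (cc _) k0 vk k1) => h /G.
by rewrite ler_norml; lra.
Qed.

(** The variable is moved from [g] to the kernel, and the window of integration is fixed for all x
    near [x0]; differentiation under the integral then falls on the kernel. *)
Lemma mollify_window r k g x0 x : r < 1 -> continuous k -> continuous g -> vanishes_outside r k ->
  `|x - x0| < 1 -> mollify k g x = intv (x0 - 2) (x0 + 2) (fun y => k (x - y) * g y).
Proof.
move=> r1 ck cg vk; rewrite ltr_norml => /andP[h1 h2].
have lk := locbm_mollify x ck cg.
have ck' : continuous (fun h => k h * g (x - h)).
  by move=> h; apply: cvgM; [exact: ck|exact: cont_shift_opp].
have cF : continuous (fun y => k (x - y) * g y).
  by move=> y; apply: cvgM; [exact: cont_shift_opp|exact: cg].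
have Z a b : a <= b -> (1 <= a \/ b <= -1) -> intv a b (fun h => k h * g (x - h)) = 0.
  move=> ab hab; rewrite (intv_eq ab (g := fun=> 0)); first by rewrite intv_cst mul0r.
  move=> h /andP[ah hb]; rewrite vk ?mul0r//; apply: (lt_le_trans r1); case: hab => hab.
    by apply: le_trans (ler_norm _); lra.
  by rewrite -normrN; apply: le_trans (ler_norm _); lra.
transitivity (intv (x - x0 - 2) (x - x0 + 2) (fun h => k h * g (x - h))).
  rewrite /mollify -(intv_cat (-1) (x - x0 - 2) _ lk) -(intv_cat 1 (-1) (x - x0 + 2) lk).
  rewrite (Z (x - x0 - 2) (-1)); [|lra|by right].
  by rewrite (Z 1 (x - x0 + 2)); [rewrite add0r addr0|lra|left].
have -> : intv (x0 - 2) (x0 + 2) (fun y => k (x - y) * g y) =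
   intv (- (x0 + 2)) (- (x0 - 2)) (fun y => k (x + y) * g (- y)).
  have := @intv_opp R (- (x0 + 2)) (- (x0 - 2)) (fun y => k (x - y) * g y) cF.
  by rewrite !opprK => <-; apply: intv_ext => y; rewrite opprK.
have cG : continuous (fun y => k y * g (x - y)) by [].
have -> : x - x0 - 2 = - (x0 + 2) + x by ring.
have -> : x - x0 + 2 = - (x0 - 2) + x by ring.
rewrite -(intv_shift _ _ _ cG); apply: intv_ext => y.
by congr (k _ * g _); ring.
Qed.

Lemma is_derive_mollify r k k' g x : r < 1 -> (forall x : R, is_derive x 1 k (k' x)) -> continuous k' ->
  continuous g -> vanishes_outside r k -> is_derive x 1 (mollify k g) (mollify k' g x).
Proof.
move=> r1 dk ck' cg vk; have ck := derive_cont dk.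
have vk' := derive_vanishes_outside dk vk.
have x1 : `|x - x| < 1 by rewrite subrr normr0.
rewrite (mollify_window r1 ck' cg vk' x1).
have c2 (f : R -> R) : continuous f -> continuous (fun p : R * R => f (p.2 - p.1) * g p.1).
  move=> cf p; apply: cvgM.
    apply: (@continuous_comp _ _ _ (fun p : R * R => p.2 - p.1) f); last exact: cf.
    by apply: cvgB; [exact: cvg_snd|exact: cvg_fst].
  by apply: (@continuous_comp _ _ _ (fun p : R * R => p.1) g); [exact: cvg_fst|exact: cg].
have D : is_derive x 1 (fun z => intv (x - 2) (x + 2) (fun y => k (z - y) * g y))
    (intv (x - 2) (x + 2) (fun y => k' (x - y) * g y)).
  apply: (@derive_param R (fun p => k (p.2 - p.1) * g p.1) (fun p => k' (p.2 - p.1) * g p.1)).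
  - exact: c2.
  - exact: c2.
  move=> t y /=.
  have d1 : is_derive y 1 (fun y => k (y - t)) (k' (y - t)).
    have dl : is_derive y 1 (fun y : R => y - t) 1.
      have := is_deriveD (is_derive_id y 1) (is_derive_cst (- t) y 1).
      by move/is_derive_congr; apply=> //; rewrite addr0.
    by have := @is_derive1_comp R k (fun y => y - t) y _ _ (dk _) dl; rewrite mulr1.
  have := is_deriveZ (g t) d1.
  move/is_derive_congr; apply=> [s|]; first by change (g t * k (s - t) = k (s - t) * g t); ring.
  by change (g t * k' (y - t) = k' (y - t) * g t); ring.
have E : \forall z \near x, intv (x - 2) (x + 2) (fun y => k (z - y) * g y) = mollify k g z.
  near=> z; apply: esym; apply: (mollify_window r1 ck cg vk).
  by rewrite distrC; near: z; exact: cvgr_dist_lt.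
exact: near_eq_is_derive E D.
Unshelve. all: by end_near.
Qed.

Lemma mollify_smooth r k g : r < 1 -> smooth k -> continuous g -> vanishes_outside r k ->
  smooth (mollify k g).
Proof.
move=> r1 sk cg vk.
apply: (@smooth_coind R (fun f => exists k, [/\ smooth k, vanishes_outside r k & f = mollify k g])).
  by exists k.
move=> _ [{}k [{}sk {}vk ->]].
have dk x := smooth_is_derive x sk; have sk' := smooth_derive1 sk.
exists (mollify (derive1 k) g).
  by exists (derive1 k); split => //; exact: derive_vanishes_outside vk.
by move=> x; apply: (is_derive_mollify x r1 dk _ cg vk); exact: smooth_cont.
Qed.

Lemma intv_mollify k g : continuous k -> intv (-1) 1 k = 1 -> continuous g ->
  (forall x, g (x + 1) = g x) -> intv 0 1 (mollify k g) = intv 0 1 g.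
Proof.
move=> ck k1 cg pg; rewrite /mollify.
have c2 : continuous (fun p : R * R => k p.1 * g (p.2 - p.1)).
  move=> p; apply: cvgM.
    by apply: (@continuous_comp _ _ _ (fun p : R * R => p.1) k); [exact: cvg_fst|exact: ck].
  apply: (@continuous_comp _ _ _ (fun p : R * R => p.2 - p.1) g); last exact: cg.
  by apply: cvgB; [exact: cvg_snd|exact: cvg_fst].
have := intv_fubini (-1) 1 0 1 (locbm2_cont c2) => /= <-.
transitivity (intv (-1) 1 (fun h => intv 0 1 g * k h)); last first.
  by rewrite intvZ ?k1 ?mulr1//; exact: locbm_cont.
apply: intv_ext => h; rewrite intvZ; last first.
  apply: locbm_cont => x; apply: (@continuous_comp _ _ _ (fun x : R => x - h) g); last exact: cg.
  by apply: cvgB; [exact: cvg_id|exact: cvg_cst].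
by rewrite intv_periodic_shift// mulrC.
Qed.

(** The kernel may change sign here: the lemma is applied to the derivative of a mollifier and gives
    a Lipschitz bound for the slope of a mollified function. The factor 2 is the length of
    [-1, 1]. *)
Lemma mollify_lip_kernel k M L g : continuous k -> (forall x, -1 <= x <= 1 -> `|k x| <= M) ->
  0 <= M -> lip L g -> lip (2 * (M * L)) (mollify k g).
Proof.
move=> ck hk M0 lg x y; have cg := lip_cont lg.
rewrite /mollify -intvB; [|exact: locbm_mollify..].
have -> : 2 * (M * L) * `|x - y| = M * (L * `|x - y|) * (1 - -1) by ring.
apply: intv_norm_le; first lra.
  by apply: locbmB; exact: locbm_mollify.
move=> h /hk hM; rewrite -mulrBr normrM ler_pM//.
by have := lg (x - h) (y - h); rewrite (_ : x - h - (y - h) = x - y)//; ring.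
Qed.

End Mollifier.

Section Bernstein.
Context {R : realType}.
Implicit Types (U V : nat -> R) (p : R).

(** De Casteljau's recursion for the Bernstein polynomial with control values U 0, ..., U n, that
    is, for p in [0, 1], the mean of U under the binomial law with parameters n and p. *)
Fixpoint bern (n : nat) U p : R :=
  if n is m.+1 then (1 - p) * bern m U p + p * bern m (fun j => U j.+1) p else U 0%N.

Lemma bernD n U V p : bern n (fun j => U j + V j) p = bern n U p + bern n V p.
Proof. by elim: n U V => //= n IH U V; rewrite !IH; ring. Qed.

Lemma bernZ n c U p : bern n (fun j => c * U j) p = c * bern n U p.
Proof. by elim: n U => //= n IH U; rewrite !IH; ring. Qed.

Lemma bern_cst n c p : bern n (fun=> c) p = c.
Proof. by elim: n => //= n ->; ring. Qed.

Lemma eq_bern n U V p : (forall j, U j = V j) -> bern n U p = bern n V p.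
Proof. by elim: n U V => //= n IH U V UV; rewrite (IH U V)// (IH (U \o S) (V \o S))// => j /=. Qed.

Lemma le_bern n U V p : 0 <= p <= 1 -> (forall j, (j <= n)%N -> U j <= V j) ->
  bern n U p <= bern n V p.
Proof.
move=> /andP[p0 p1]; elim: n U V => [U V h|n IH U V h] /=; first exact: h.
apply: lerD; rewrite ler_wpM2l ?subr_ge0//; apply: IH => j jn; apply: h => //.
exact: leqW.
Qed.

Lemma bern0 n U : bern n U 0 = U 0%N.
Proof. by elim: n => //= n ->; rewrite subr0 mul1r mul0r addr0. Qed.

Lemma bern1 n U : bern n U 1 = U n.
Proof. by elim: n U => //= n IH U; rewrite IH subrr mul0r mul1r add0r. Qed.

Lemma is_derive_bern n U p : is_derive p 1 (bern n.+1 U) (n.+1%:R * bern n (fun j => U j.+1 - U j) p).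
Proof.
have dsub (q : R) : is_derive q 1 (fun q : R => 1 - q) (-1).
  have := is_deriveB (is_derive_cst (1 : R) q 1) (is_derive_id q 1).
  by move/is_derive_congr; apply=> //; rewrite sub0r.
have step m W w V v (q : R) : is_derive q 1 (bern m W) w -> is_derive q 1 (bern m V) v ->
    is_derive q 1 (fun q => (1 - q) * bern m W q + q * bern m V q)
      ((1 - q) * w + q * v + (bern m V q - bern m W q)).
  move=> dW dV.
  have := is_deriveD (is_deriveM (dsub q) dW) (is_deriveM (is_derive_id q 1) dV).
  move/is_derive_congr; apply=> //.
  change ((1 - q) * w + bern m W q * -1 + (q * v + bern m V q * 1) =
     (1 - q) * w + q * v + (bern m V q - bern m W q)); ring.
elim: n U p => [|n IH] U p.
  have := step 0%N U 0 (fun j => U j.+1) 0 p (is_derive_cst _ _ _) (is_derive_cst _ _ _).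
  by move/is_derive_congr; apply=> //=; ring.
have := step n.+1 U _ (fun j => U j.+1) _ p (IH _ _) (IH _ _).
move/is_derive_congr; apply=> //.
set D := fun j => U j.+1 - U j.
have -> : bern n.+1 (fun j => U j.+1) p - bern n.+1 U p = bern n.+1 D p.
  rewrite -[bern n.+1 U p]mul1r -mulNr -bernZ -bernD; apply: eq_bern => j.
  by rewrite /D mulN1r.
rewrite -[n.+2]addn1 natrD mulrDl mul1r /=; ring.
Qed.

(** Variance plus squared bias of the binomial law. *)
Lemma bern_sqr n a p : bern n (fun j => (j%:R - a) ^+ 2) p =
  n%:R * (p * (1 - p)) + (n%:R * p - a) ^+ 2.
Proof.
elim: n a => [|n IH] a /=; first by ring.
rewrite IH.
have -> : bern n (fun j => (j.+1%:R - a) ^+ 2) p = n%:R * (p * (1 - p)) + (n%:R * p - (a - 1)) ^+ 2.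
  by rewrite -IH; apply: eq_bern => j; rewrite -natr1; ring.
by rewrite -natr1; ring.
Qed.

End Bernstein.

(** * From discrete subsolutions to a pointwise inequality for their smooth interpolation *)

Section Pointwise.
Context {R : realType}.

(** The first moment is bounded by the second through |y| <= a + y^2/a with a = d (m + 1). The
    parameter d stays free, so that the bound divided by m + 1 can be made small by fixing d before
    m. *)
Lemma bern_dist (m : nat) (p d : R) : 0 <= p <= 1 -> 0 < d ->
  bern m (fun j => `|j%:R - m.+1%:R * p|) p <= d * m.+1%:R + d^-1.
Proof.
move=> p01 d0; have n0 : 0 < m.+1%:R :> R by rewrite ltr0n.
apply: (@le_trans _ _ (bern m (fun j => d * m.+1%:R + (d * m.+1%:R)^-1 * (j%:R - m.+1%:R * p) ^+ 2) p)).
  apply: le_bern => // j _; set y := _ - _; rewrite -(real_normK (num_real y)).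
  have dn0 : 0 < d * m.+1%:R by rewrite mulr_gt0.
  move: (d * _) dn0 (normr_ge0 y) => a a0; move: `|y| => {}y y0.
  rewrite -(ler_pM2l a0) mulrDr mulVKf ?gt_eqF//; nra.
rewrite bernD bern_cst bernZ bern_sqr lerD2l.
have di : 0 <= d^-1 by rewrite invr_ge0 ltW.
rewrite invfM -mulrA ler_piMr// ler_pdivrMl// mulr1.
have -> : m%:R * p - m.+1%:R * p = - p by rewrite -natr1; ring.
rewrite sqrrN -natr1; have := ler0n R m; case/andP: p01 => p0 p1.
by move: m%:R => {n0}b b0; nra.
Qed.

Variables (T C K r D d eta : R) (k : R -> R) (Phi : R * R -> R).
Variables (U U' : nat -> R -> R) (m : nat).
Hypotheses (T0 : 0 < T) (C0 : 0 <= C) (K0 : 0 <= K) (d0 : 0 < d).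
Hypotheses (ck : continuous k) (k0 : forall x, 0 <= k x) (vk : vanishes_outside r k).
Hypotheses (k1 : intv (-1) 1 k = 1) (cU : forall j, continuous (U j)).
Hypothesis dU : forall j (x : R), is_derive x 1 (mollify k (U j)) (U' j x).
Hypothesis lU : forall j, lip D (U' j).
Hypothesis lPhi : forall t s x y, 0 <= t <= T -> 0 <= s <= T ->
  `|Phi (t, x) - Phi (s, y)| <= K * (`|t - s| + `|x - y|).

Let tau := T / m.+1%:R.
Let V j := mollify k (U j).

Hypothesis hU : forall j x c, (j <= m)%N -> `|c| <= C ->
  U j.+1 (x + c * tau) <= U j x + tau * (c ^+ 2 / 2 - c * Phi (j%:R * tau, x) + eta).

Let n0 : 0 < m.+1%:R :> R. Proof. by rewrite ltr0n. Qed.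
Let tau0 : 0 < tau. Proof. exact: divr_gt0. Qed.

(* Starting at [x - (1 - p) c tau] puts the two ends of the step at the points whose first-order
   expansions recombine, by de Casteljau's recursion, into the x-derivative of the Bernstein
   polynomial of degree m + 1. *)
Lemma mollified_step j t x c p : (j <= m)%N -> 0 <= t <= T -> `|c| <= C -> 0 <= p <= 1 ->
  V j.+1 (x + p * c * tau) <= V j (x - (1 - p) * c * tau) +
    tau * (c ^+ 2 / 2 - c * Phi (t, x) + eta + C * K * (`|j%:R * tau - t| + (C * tau + r))).
Proof.
move=> jm tT cC p01; rewrite /V.
apply: (mollify_le ck (@cU j.+1) (@cU j) k0 vk k1) => h hr.
set x' := x - (1 - p) * c * tau - h.
have -> : x + p * c * tau - h = x' + c * tau by rewrite /x'; ring.
apply: (le_trans (hU _ jm cC)); rewrite lerD2l ler_pM2l//.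
have jT : 0 <= j%:R * tau <= T.
  rewrite mulr_ge0 ?(ltW tau0)//= /tau mulrA ler_pdivrMr// mulrC ler_pM2l// ler_nat.
  exact: leqW.
have H := lPhi x' x jT tT.
have hx : `|x' - x| <= C * tau + r.
  rewrite /x' (_ : _ - x = - ((1 - p) * c * tau) - h); last by ring.
  apply: (le_trans (ler_normB _ _)); apply: lerD => //.
  rewrite normrN 2!normrM (gtr0_norm tau0) ler_pM2r//.
  apply: le_trans cC; rewrite ler_piMl//.
  by case/andP: p01 => p0 p1; rewrite ger0_norm ?subr_ge0//; lra.
have {}H : `|c * (Phi (j%:R * tau, x') - Phi (t, x))| <= C * K * (`|j%:R * tau - t| + (C * tau + r)).
  rewrite normrM -mulrA ler_pM//; apply: (le_trans H).
  by rewrite ler_wpM2l// lerD2l.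
have := le_trans (ler_norm _) H; rewrite -normrN in H.
by have := le_trans (ler_norm _) H; rewrite mulrBr; lra.
Qed.

(** The left-hand side is, up to the factor (m + 1)/T, the time derivative of the degree m + 1
    interpolation. Each increment is estimated by [mollified_step] after a Taylor expansion of both
    ends around x. The error terms come from freezing Phi in space (C tau + r), from the two Taylor
    remainders, and from replacing j tau by t, which costs the mean binomial deviation. *)
Lemma bern_subsolution t x c : 0 <= t <= T -> `|c| <= C ->
  bern m (fun j => V j.+1 x - V j x) (t / T) <=
  tau * (- c * bern m.+1 (fun j => U' j x) (t / T) + c ^+ 2 / 2 - c * Phi (t, x) + eta
    + (C * K * (C * tau + r) + 2 * D * C ^+ 2 * tau + C * K * T * (d + d^-1 / m.+1%:R))).
Proof.
move=> tT cC; set p := t / T.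
have p01 : 0 <= p <= 1.
  case/andP: tT => t0 tT; rewrite /p divr_ge0 ?(ltW T0)//=.
  by rewrite ler_pdivrMr// mul1r.
have tE : t = m.+1%:R * p * tau.
  by rewrite /p /tau; move: (m.+1%:R : R) n0 => b b0; field; rewrite !gt_eqF.
have D0 : 0 <= D.
  by have := le_trans (normr_ge0 _) (lU 0 1 0); rewrite subr0 normr1 mulr1.
have TY j y : `|y| <= C * tau -> `|V j (x + y) - V j x - y * U' j x| <= D * (C * tau) ^+ 2.
  move=> hy; apply: (le_trans (taylor_lip x y (dU j) (lU j))).
  rewrite ler_wpM2l// -(real_normK (num_real y)) ler_sqr// nnegrE.
  by rewrite mulr_ge0// ltW.
have hq q : 0 <= q <= 1 -> `|q * c * tau| <= C * tau.
  move=> /andP[q0 q1]; rewrite 2!normrM (gtr0_norm tau0) ler_pM2r// (ger0_norm q0).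
  by apply: le_trans cC; rewrite ler_piMl.
have q01 : 0 <= 1 - p <= 1 by case/andP: p01 => p0 p1; apply/andP; split; lra.
pose A := tau * (c ^+ 2 / 2 - c * Phi (t, x) + eta + C * K * (C * tau + r)) + 2 * D * (C * tau) ^+ 2.
apply: (@le_trans _ _ (bern m (fun j => - c * tau * ((1 - p) * U' j x + p * U' j.+1 x) +
    (A + tau * C * K * tau * `|j%:R - m.+1%:R * p|)) p)).
  apply: le_bern => // j jm.
  have H := mollified_step x jm tT cC p01.
  have := TY j.+1 _ (hq p p01); have := TY j (- ((1 - p) * c * tau)).
  rewrite normrN => /(_ (hq _ q01)).
  rewrite !ler_norml => /andP[_ h1] /andP[h2 _].
  have E : `|j%:R * tau - t| = tau * `|j%:R - m.+1%:R * p|.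
    by rewrite tE -mulrBl normrM (gtr0_norm tau0) mulrC.
  rewrite E in H.
  rewrite /A; move: h1 h2 H; set a := V _ _; set b := V _ _; set a' := V _ _; set b' := V _ _.
  move: (U' j x) (U' j.+1 x) `|_ - _| => u1 u2 y.
  lra.
(* This is the recursion of [bern] itself: the weights 1 - p and p produced by the two expansions
   raise the degree of the slope polynomial from m to m + 1. *)
have E1 : bern m (fun j => (1 - p) * U' j x + p * U' j.+1 x) p = bern m.+1 (fun j => U' j x) p.
  by rewrite bernD !bernZ.
rewrite bernD bernZ E1 bernD bern_cst bernZ.
have := bern_dist m p01 d0; set b := bern m _ _ => hb.
set B := bern _ _ _.
have h : tau * C * K * tau * b <= tau * (C * K * T * (d + d^-1 / m.+1%:R)).
  have -> : tau * (C * K * T * (d + d^-1 / m.+1%:R)) = tau * C * K * tau * (d * m.+1%:R + d^-1).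
    by rewrite /tau; move: (m.+1%:R : R) n0 => a a0; field; rewrite !gt_eqF.
  by rewrite ler_wpM2l// !mulr_ge0// ltW.
have lin (X Y : R) : Y <= tau * X -> - c * tau * B + (A + Y) <=
  tau * (- c * B + c ^+ 2 / 2 - c * Phi (t, x) + eta +
   (C * K * (C * tau + r) + 2 * D * C ^+ 2 * tau + X)) by rewrite /A => XY; lra.
exact: lin.
Qed.

End Pointwise.

(** * Upper bounds for the optimal flux *)

Section Rearrangement.
Context {R : realType}.
Implicit Types (a b c d s z A I : R).

Fact dual_test_arith a b c d s z A I I1 I2 : I1 - I2 <= - a + (z + 2^-1 * s) ->
  z = a + -1 * b + c -> d = I + b -> 2^-1 * s + -1 * d <= A -> - c <= I2 - I1 + I + A.
Proof. lra. Qed.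

Fact certificate_arith a b c d f k : k <= b - c + (c - d) + (a + f) -> k <= b - d + a + f.
Proof. lra. Qed.

Fact certificate_pointwise (N Z c w u eta C K Lv r q Q e : R) :
  N * Z <= c ^+ 2 / 2 - w + eta + (C * K * r + q + Q) -> w = c ^+ 2 - u ->
  u <= C * Lv * r -> C * (Lv + K) * r <= e -> q <= e -> Q <= e ->
  2^-1 * c ^+ 2 - - (N * Z) <= eta + 3 * e.
Proof. by move=> h1 h2 h3 h4 h5 h6; rewrite opprK; lra. Qed.

End Rearrangement.

Section BernsteinSurface.
Context {R : realType}.
Variables (T : R) (V V' : nat -> R -> R).
Hypotheses (T0 : 0 < T) (sV : forall j, smooth (V j)).
Hypothesis dV : forall j (x : R), is_derive x 1 (V j) (V' j x).

(** Bernstein interpolation in time. It takes the values V 0 and V n exactly at t = 0 and t = T, so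
    the initial condition of the test function holds without error. *)
Definition surface (n : nat) (p : R * R) : R := bern n (fun j => V j p.2) (p.1 / T).

Lemma surface_smooth2 n : smooth2 (surface n).
Proof.
(* The shift i is needed for the induction, because the recursion of [bern] shifts the control
   values. *)
have H m : forall i, smooth2 (fun p : R * R => bern m (fun j => V (i + j)%N p.2) (p.1 / T)).
  elim: m => [|m IH] i /=; first by apply: smooth2_snd; exact: sV.
  apply: smooth2_add; apply: smooth2_mul.
  - have := smooth2_fst (@smooth_aff R 1 (- T^-1)); congr smooth2.
    by apply/funext => p /=; ring.
  - exact: IH.
  - have := smooth2_fst (@smooth_aff R 0 T^-1); congr smooth2.
    by apply/funext => p /=; ring.
  - have := IH i.+1; congr smooth2; apply/funext => p; apply: eq_bern => j.
    by rewrite addSnnS.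
exact: (H n 0%N).
Qed.

Lemma surface_dt n (t x : R) : is_derive t 1 (fun s => surface n.+1 (s, x))
  (T^-1 * (n.+1%:R * bern n (fun j => V j.+1 x - V j x) (t / T))).
Proof.
have dl : is_derive t 1 (fun s : R => s / T) T^-1.
  have := is_deriveZ T^-1 (is_derive_id t 1).
  move/is_derive_congr; apply=> [s|]; first by change (T^-1 * s = s / T); ring.
  by change (T^-1 * 1 = T^-1); ring.
have := @is_derive1_comp R (bern n.+1 (fun j => V j x)) (fun s => s / T) t _ _ (is_derive_bern n _ _) dl.
by rewrite mulrC.
Qed.

Lemma surface_dx n (t x : R) : is_derive x 1 (fun y => surface n (t, y)) (bern n (fun j => V' j x) (t / T)).
Proof.
have H m : forall i, is_derive x 1 (fun y => bern m (fun j => V (i + j)%N y) (t / T))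
    (bern m (fun j => V' (i + j)%N x) (t / T)).
  elim: m => [|m IH] i /=; first exact: dV.
  have := is_deriveD (is_deriveZ (1 - t / T) (IH i)) (is_deriveZ (t / T) (IH i.+1)).
  move/is_derive_congr; apply=> [y|].
    change ((1 - t / T) * bern m (fun j => V (i + j)%N y) (t / T) +
      t / T * bern m (fun j => V (i.+1 + j)%N y) (t / T) =
      (1 - t / T) * bern m (fun j => V (i + j)%N y) (t / T) +
      t / T * bern m (fun j => V (i + j.+1)%N y) (t / T)).
    by congr (_ + _ * _); apply: eq_bern => j; rewrite addSnnS.
  change ((1 - t / T) * bern m (fun j => V' (i + j)%N x) (t / T) +
      t / T * bern m (fun j => V' (i.+1 + j)%N x) (t / T) =
      (1 - t / T) * bern m (fun j => V' (i + j)%N x) (t / T) +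
      t / T * bern m (fun j => V' (i + j.+1)%N x) (t / T)).
  by congr (_ + _ * _); apply: eq_bern => j; rewrite addSnnS.
exact: (H n 0%N).
Qed.

End BernsteinSurface.

(** * Weak duality: subsolutions bound the flux from above *)

Section Certificate.
Context {R : realType}.
Variables (T L : R) (v0 phi : R -> R).
Hypotheses (T0 : 0 < T) (lphi : lip L phi).
Hypotheses (dphi : forall x : R, is_derive x 1 phi (v0 x)) (cv0 : continuous v0).
Hypotheses (pphi : forall x, phi (x + 1) = phi x).
Variables (E B : {charge set (plane R) -> \bar R}).
Hypothesis EB : dual_maximizer T v0 E B.

Lemma admissible_weak Psi : test_function T Psi -> (forall x, Psi (0, x) = 0) ->
  pairing T (dt Psi) (rho T B) = intv 0 1 (fun x => Psi (T, x)) + pairing T (dx Psi) E.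
Proof.
move=> tP P0; have [_ _ _ /(_ Psi tP P0)/eqP] := EB.1; rewrite subr_eq0 => /eqP H.
have ldt := locbm2_cont (test_dt_cont tP).
rewrite pairing_rho; last exact: locbm2_cellbm.
rewrite H pairing_Leb// mulrA mulfV// mul1r; congr (_ + _); apply: intv_ext => x.
apply: (etrans (intv_FTC 0 T (cont_slice2 x (test_dt_cont tP)) (fun t => test_dt tP t x))).
by rewrite P0 subr0.
Qed.

Lemma smooth2_test f : smooth2 f -> space_periodic T f -> test_function T f.
Proof. by move=> sf pf; split=> // n; exact: smooth2_differentiable. Qed.

(** The test function Psi = t depends on time alone; it shows that [rho] has total mass T. *)
Lemma admissible_mass c : pairing T (fun=> c) (rho T B) = c * T.
Proof.
have t1 : test_function T (fun p : R * R => p.1).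
  by apply: smooth2_test => //; exact: smooth2_fst (@smooth_id R).
have d1 : dt (fun p : R * R => p.1) = fun=> 1.
  by apply: dtE => t x; exact: is_derive_id.
have d2 : dx (fun p : R * R => p.1) = fun=> 0.
  by apply: dxE => t x; exact: is_derive_cst.
have := admissible_weak t1 (fun=> erefl); rewrite d1 d2 intv_cst subr0 mulr1 /= => H.
have k1 : cellbm T (fun=> 1) by apply: locbm2_cellbm; exact: locbm2_cst.
have := pairingZ (rho T B) c k1; rewrite H mulr1 => ->.
have := pairingZ E 0 k1; rewrite !mul0r => ->.
by rewrite addr0.
Qed.

Let pv0 x : v0 (x + 1) = v0 x.
Proof. exact: is_derive_periodic dphi pphi x. Qed.

(** The lower bound is tested with z = v0 - Psi_x + Phi. The two pairings of v0 with E cancel, the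
    constraint trades Psi_x against E for Psi_t against [rho], and the remaining integrand is at
    most A against a measure of mass T. *)
Lemma dual_test Psi Phi A : test_function T Psi -> (forall x, Psi (0, x) = 0) ->
  continuous Phi -> space_periodic T Phi ->
  (forall p, strip T p ->
    2^-1 * (v0 p.2 - dx Psi p + Phi p) ^+ 2 - dt Psi p <= A) ->
  pairing T Phi (flux E) <=
    intv 0 1 (hopf_lax T phi) - intv 0 1 phi + intv 0 1 (fun x => Psi (T, x)) + A * T.
Proof.
move=> tP P0 cP pP hA; pose z p := v0 p.2 - dx Psi p + Phi p.
have cdx := test_dx_cont tP; have cdt := test_dt_cont tP.
have cv : continuous (fun p : R * R => v0 p.2).
  by move=> p; apply: (@continuous_comp _ _ _ (fun p : R * R => p.2) v0); [exact: cvg_snd|exact: cv0].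
have cz : continuous z.
  by move=> p; apply: cvgD; [apply: cvgB; [exact: cv|exact: cdx]|exact: cP].
have pz : space_periodic T z.
  have [pdx _] := test_dx_test tP.
  by move=> t x tT; rewrite /z pdx// pP//= pv0.
have L0 : 0 <= L.
  by have := le_trans (normr_ge0 _) (lphi 1 0); rewrite subr0 normr1 mulr1.
have := dual_lower_bound T0 lphi L0 dphi cv0 pv0 EB (continuous_on_torus_cont pz cz).
have lphi' : locbm phi := locbm_cont (lip_cont lphi).
have lS : locbm (hopf_lax T phi) by apply: locbm_cont; exact: lip_cont (hopf_lax_lip (ltW T0) lphi).
rewrite intvB// => Hd.
have kv := locbm2_cellbm T (locbm2_cont cv).
have kdx := locbm2_cellbm T (locbm2_cont cdx).
have kdt := locbm2_cellbm T (locbm2_cont cdt).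
have kP := locbm2_cellbm T (locbm2_cont cP).
have kz2 : cellbm T (fun p => z p ^+ 2).
  by apply: locbm2_cellbm; apply: locbm2_cont => p; apply: cvgM; exact: cz.
have Ez : pairing T z E = pairing T (fun p => v0 p.2) E + -1 * pairing T (dx Psi) E + pairing T Phi E.
  have kn : cellbm T (fun p => -1 * dx Psi p) := cellbmZ (-1) kdx.
  rewrite -(pairingZ E (-1) kdx) -(pairingD E kv kn) -(pairingD E (cellbmD kv kn) kP).
  by apply: eq_pairing => p _; rewrite /z mulN1r.
have Ed := admissible_weak tP P0.
have rho0 : forall A0 : set (plane R), measurable A0 -> (0 <= rho T B A0)%E by case: EB.1.
have Er : 2^-1 * pairing T (fun p => z p ^+ 2) (rho T B) + -1 * pairing T (dt Psi) (rho T B) <= A * T.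
  rewrite -(pairingZ (rho T B) 2^-1 kz2) -(pairingZ (rho T B) (-1) kdt).
  rewrite -(pairingD (rho T B) (cellbmZ 2^-1 kz2) (cellbmZ (-1) kdt)) -admissible_mass.
  apply: (le_pairing rho0).
  - exact: (cellbmD (cellbmZ 2^-1 kz2) (cellbmZ (-1) kdt)).
  - by apply: locbm2_cellbm; exact: locbm2_cst.
  - by move=> p [c1 _]; rewrite mulN1r; apply: hA; split.
have Ef : pairing T Phi (flux E) = - pairing T Phi E by rewrite pairing_copp.
rewrite Ef; exact: (dual_test_arith Hd Ez Ed Er).
Qed.

Variables (Lv : R).
Hypotheses (lv0 : lip Lv v0).

(** The derivative falls on phi and not on the kernel, which exhibits the slope as a mollification
    of v0, uniformly close to v0. *)
Lemma is_derive_mollify_arg k (x : R) : continuous k -> is_derive x 1 (mollify k phi) (mollify k v0 x).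
Proof.
move=> ck.
have c2 (f : R -> R) : continuous f -> continuous (fun p : R * R => k p.1 * f (p.2 - p.1)).
  move=> cf p; apply: cvgM.
    by apply: (@continuous_comp _ _ _ (fun p : R * R => p.1) k); [exact: cvg_fst|exact: ck].
  apply: (@continuous_comp _ _ _ (fun p : R * R => p.2 - p.1) f); last exact: cf.
  by apply: cvgB; [exact: cvg_snd|exact: cvg_fst].
apply: (@derive_param R (fun p => k p.1 * phi (p.2 - p.1)) (fun p => k p.1 * v0 (p.2 - p.1))).
- exact: c2 (lip_cont lphi).
- exact: c2 cv0.
move=> t y; have dl : is_derive y 1 (fun y : R => y - t) 1.
  have := is_deriveD (is_derive_id y 1) (is_derive_cst (- t) y 1).
  by move/is_derive_congr; apply=> //; rewrite addr0.
have := @is_derive1_comp R phi (fun y => y - t) y _ _ (dphi _) dl; rewrite mulr1.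
by move/(is_deriveZ (k t)); exact.
Qed.

(* The [U j] are discrete subsolutions of the Hamilton-Jacobi equation with an additional linear term
   [c * Phi]; the test function is the mollification of phi minus the Bernstein interpolation in time of
   the mollified [U j]. *)
Lemma dual_certificate (Phi : R * R -> R) (M K C LU e : R) :
  continuous Phi -> space_periodic T Phi -> 0 <= K ->
  (forall t s x y, 0 <= t <= T -> 0 <= s <= T ->
    `|Phi (t, x) - Phi (s, y)| <= K * (`|t - s| + `|x - y|)) ->
  (forall p, strip T p -> `|Phi p| <= M) ->
  LU + Lv + M <= C -> 0 < e ->
  exists N : nat, forall (m : nat) (U : nat -> R -> R) (eta : R), (N <= m)%N ->
    U 0%N = phi -> (forall j x, U j (x + 1) = U j x) -> (forall j, lip LU (U j)) ->
    (forall j x c, (j <= m)%N -> `|c| <= C ->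
      U j.+1 (x + c * (T / m.+1%:R)) <=
      U j x + T / m.+1%:R * (c ^+ 2 / 2 - c * Phi (j%:R * (T / m.+1%:R), x) + eta)) ->
    pairing T Phi (flux E) <= intv 0 1 (hopf_lax T phi) - intv 0 1 (U m.+1) + eta * T + e.
Proof.
move=> cP pP K0 lPhi bP hC e0.
have Lv0 : 0 <= Lv.
  by have := le_trans (normr_ge0 _) (lv0 1 0); rewrite subr0 normr1 mulr1.
have M0 : 0 <= M.
  apply: le_trans (normr_ge0 _) (bP (0, 0) _); split=> //=.
  by rewrite in_itv/= lexx ltW.
have [LU0|LU0] := ltP LU 0.
  exists 0%N => m U eta _ _ _ /(_ 0%N) lU.
  by have := le_trans (normr_ge0 _) (lU 1 0); rewrite subr0 normr1 mulr1 leNgt LU0.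
have C0 : 0 <= C by lra.
have small (a b : R) : 0 <= a -> 0 < b -> exists2 x, 0 < x < 1 & a * x <= b.
  move=> a0 b0; exists (Num.min (1 / 2) (b / (a + 1))).
    have ? : 0 < b / (a + 1) by rewrite divr_gt0// ltr_wpDl.
    by rewrite lt_min gt_min divr_gt0//=; apply/andP; split => //; apply/orP; left; lra.
  apply: (@le_trans _ _ (a * (b / (a + 1)))); first by rewrite ler_wpM2l// ge_min lexx orbT.
  by rewrite mulrA ler_pdivrMr ?ltr_wpDl// mulrDr mulr1 mulrC lerDl ltW.
(* Three errors of size at most e' remain, integrated over a time T: the mollification radius [r],
   the binomial parameter [d], and all the terms of order 1/(m + 1). *)
pose e' := e / (3 * T).
have e'0 : 0 < e' by rewrite divr_gt0// mulr_gt0.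
have [r /andP[r0 r1] hr] := small (C * (Lv + K)) e' (mulr_ge0 C0 (addr_ge0 Lv0 K0)) e'0.
have [d /andP[d0 d1] hd] := small (C * K * T) e' (mulr_ge0 (mulr_ge0 C0 K0) (ltW T0)) e'0.
have [k [sk k0 vk k1]] := kernel_exists r0 r1.
have ck := smooth_cont sk.
have vk1 : vanishes_outside 1 k by move=> x x1; apply: vk; exact: lt_trans x1.
have ck' := smooth_cont (smooth_derive1 sk).
have dk (x : R) := smooth_is_derive x sk.
have [Mk hMk] := (locbm_cont ck').2 (-1) 1.
have Mk0 : 0 <= Mk by apply: le_trans (normr_ge0 _) (hMk 0 _); rewrite lerN10 ler01.
pose D := 2 * (Mk * LU).
(* The terms that come with a factor 1/(m + 1). Since [D] depends on the kernel, hence on [r], the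
   threshold for m is chosen after [r] and [d]. *)
pose Q := C * K * (C * T) + 2 * D * C ^+ 2 * T + C * K * T * d^-1.
have D0 : 0 <= D by rewrite !mulr_ge0.
have Q0 : 0 <= Q by rewrite !addr_ge0// !mulr_ge0// ?exprn_ge0 ?invr_ge0 1?ltW.
exists (Num.truncn (Q / e')) => m U eta Nm U0 pU lU hU.
have hQ : Q / m.+1%:R <= e'.
  rewrite ler_pdivrMr ?ltr0n// [leRHS]mulrC -ler_pdivrMr//; apply: ltW.
  by apply: (lt_le_trans (truncnS_gt _)); rewrite ler_nat.
pose V j := mollify k (U j); pose V' j := mollify (derive1 k) (U j).
have cU j : continuous (U j) := lip_cont (lU j).
have sV j : smooth (V j) := mollify_smooth r1 sk (cU j) vk.
have dV j (x : R) : is_derive x 1 (V j) (V' j x) := is_derive_mollify x r1 dk ck' (cU j) vk.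
have lV' j : lip D (V' j) := mollify_lip_kernel ck' hMk Mk0 (lU j).
have pV j x : V j (x + 1) = V j x by exact: mollify_periodic (pU j).
pose chi := surface T V m.+1.
have s2c : smooth2 chi := surface_smooth2 T sV m.+1.
have cphi := lip_cont lphi.
have sphi : smooth (mollify k phi) := mollify_smooth r1 sk cphi vk.
pose Psi p := mollify k phi p.2 + -1 * chi p.
have PsiE t x : Psi (t, x) = mollify k phi x + -1 * bern m.+1 (fun j => V j x) (t / T) by [].
have sP : smooth2 Psi.
  apply: smooth2_add; first exact: smooth2_snd.
  by apply: smooth2_mul => //; exact: smooth2_snd (@smooth_cst R (-1)).
have tP : test_function T Psi.
  apply: smooth2_test => // t x _; rewrite !PsiE mollify_periodic//.
  by congr (_ + _ * _); apply: eq_bern => j; exact: pV.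
have P0 x : Psi (0, x) = 0.
  by rewrite PsiE mul0r bern0 /V U0 mulN1r subrr.
have addrN1 (a b : R) : a + -1 * b = a - b by rewrite mulN1r.
have EdP t x : dt Psi (t, x) = - (T^-1 * (m.+1%:R * bern m (fun j => V j.+1 x - V j x) (t / T))).
  have -> // : dt Psi = fun p => - (T^-1 * (m.+1%:R * bern m (fun j => V j.+1 p.2 - V j p.2) (p.1 / T))).
  apply: dtE => {}t {}x.
  have := is_deriveD (is_derive_cst (mollify k phi x) t 1) (is_deriveZ (-1) (surface_dt T V m t x)).
  move/is_derive_congr; apply=> //.
  change (0 + -1 * (T^-1 * (m.+1%:R * bern m (fun j => V j.+1 x - V j x) (t / T))) =
    - (T^-1 * (m.+1%:R * bern m (fun j => V j.+1 x - V j x) (t / T)))); ring.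
have ExP t x : dx Psi (t, x) = mollify k v0 x - bern m.+1 (fun j => V' j x) (t / T).
  pose g (p : R * R) := mollify k v0 p.2 - bern m.+1 (fun j => V' j p.2) (p.1 / T).
  have dg (s y : R) : is_derive y 1 (fun y => Psi (s, y)) (g (s, y)).
    have := is_deriveD (is_derive_mollify_arg y ck) (is_deriveZ (-1) (surface_dx T dV m.+1 s y)).
    by move/is_derive_congr; apply; [exact: (fun=> erefl)|exact: addrN1].
  exact: (congr1 (@^~ (t, x)) (dxE dg)).
have EI : intv 0 1 (fun x => Psi (T, x)) = intv 0 1 phi - intv 0 1 (U m.+1).
  rewrite -(intv_mollify ck k1 cphi pphi) -(intv_mollify ck k1 (cU m.+1) (pU m.+1)) -intvB.
  - by apply: intv_ext => x; rewrite PsiE divff ?gt_eqF// bern1 mulN1r.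
  - exact: locbm_cont (smooth_cont sphi).
  - exact: locbm_cont (smooth_cont (sV m.+1)).
suff H p : strip T p -> 2^-1 * (v0 p.2 - dx Psi p + Phi p) ^+ 2 - dt Psi p <= eta + 3 * e'.
  have := dual_test tP P0 cP pP H; rewrite EI.
  have -> : (eta + 3 * e') * T = eta * T + e by rewrite /e'; field; rewrite gt_eqF.
  exact: certificate_arith.
move: p => [t x] sp; rewrite EdP ExP -[(t, x).2]/x.
have tT : 0 <= t <= T by case: sp => /= + _; rewrite in_itv.
(* The slope [c] is the function z of [dual_test] at this point. Up to v0 minus its mollification it
   equals W + Phi, so the linear inequality with this slope turns into the quadratic one, and |c| <=
   LU + Lv + M. *)
set W := bern m.+1 _ _; set c := v0 x - (mollify k v0 x - W) + Phi (t, x).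
have p01 : 0 <= t / T <= 1.
  by case/andP: tT => t0 tT; rewrite divr_ge0 ?(ltW T0)//= ler_pdivrMr// mul1r.
have hW : `|W| <= LU.
  have hV' j : `|V' j x| <= LU.
    apply: lip_derive_le (dV j x); exact: mollify_lip ck (lU j) k0 vk1 k1.
  rewrite ler_norml; apply/andP; split.
    rewrite -(bern_cst m.+1 (- LU) (t / T)); apply: le_bern => // j _.
    by have := hV' j; rewrite ler_norml => /andP[].
  rewrite -(bern_cst m.+1 LU (t / T)); apply: le_bern => // j _.
  by have := hV' j; rewrite ler_norml => /andP[].
have hv : `|mollify k v0 x - v0 x| <= Lv * r := mollify_near x ck lv0 Lv0 k0 vk k1.
have hPhi := bP _ sp.
have hvr : Lv * r <= Lv by rewrite ler_piMr// ltW.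
have cC : `|c| <= C.
  apply: le_trans hC; move: hW hPhi hv; rewrite /c !ler_norml; lra.
have := bern_subsolution T0 C0 K0 d0 ck k0 vk k1 cU dV lV' lPhi hU x tT cC.
rewrite -/W -/V; set Z := bern m _ _.
have n0 : 0 < m.+1%:R :> R by rewrite ltr0n.
have -> : - (T^-1 * (m.+1%:R * Z)) = - (m.+1%:R / T * Z) by congr (- _); ring.
set F := (X in _ <= _ * X) => hZ.
have hZ' : m.+1%:R / T * Z <= F.
  rewrite -(ler_pM2l (_ : 0 < T / m.+1%:R)); last exact: divr_gt0.
  rewrite mulrA (_ : T / m.+1%:R * (m.+1%:R / T) = 1) ?mul1r//.
  by move: (m.+1%:R : R) n0 => a a0; field; rewrite !gt_eqF.
have hF : F = c ^+ 2 / 2 - c * (W + Phi (t, x)) + eta + (C * K * r + C * K * T * d + Q / m.+1%:R).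
  by rewrite /F /Q; move: (m.+1%:R : R) n0 => a a0; field; rewrite !gt_eqF.
have hcv : c * (v0 x - mollify k v0 x) <= C * Lv * r.
  apply: (le_trans (ler_norm _)); rewrite normrM -mulrA ler_pM// distrC; exact: hv.
have Ec : c * (W + Phi (t, x)) = c ^+ 2 - c * (v0 x - mollify k v0 x) by rewrite /c; ring.
rewrite hF in hZ'.
exact: (certificate_pointwise hZ' Ec hcv hr hd hQ).
Qed.

End Certificate.

(** * Entropy solutions and the Hopf-Lax formula *)

Section SmoothStep.
Context {R : realType}.
Implicit Types (a b c p q r t x y z : R) (f g h : R -> R).

Lemma intv_gt0 a b c f : continuous f -> (forall x, 0 <= f x) -> a < c < b -> 0 < f c ->
  0 < intv a b f.
Proof.
move=> cf f0 /andP[ac cb] fc; have lf := locbm_cont cf.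
have [d d0 hd] : exists2 d, 0 < d & forall x, `|x - c| <= d -> f c / 2 <= f x.
  have e0 : 0 < f c / 2 by rewrite divr_gt0.
  have /cvgrPdist_lt/(_ _ e0)/nbhs_ballP[d /= d0 hd] := cf c.
  exists (d / 2) => [|x hx]; first by rewrite divr_gt0.
  have : `|f c - f x| < f c / 2 by apply: hd; rewrite /ball/= distrC; lra.
  by move/(le_lt_trans (ler_norm _)); lra.
pose d' := Num.min d (Num.min (c - a) (b - c)).
have d'0 : 0 < d' by rewrite !lt_min d0 !subr_gt0 ac.
have [h1 h2 h3] : [/\ d' <= d, d' <= c - a & d' <= b - c].
  by rewrite /d' !ge_min !lexx ?orbT.
rewrite -(intv_cat (c - d') _ _ lf) -(intv_cat (c + d') (c - d') _ lf).
have i1 : 0 <= intv a (c - d') f by apply: intv_ge0 => //; lra.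
have i2 : 0 <= intv (c + d') b f by apply: intv_ge0 => //; lra.
have i3 : intv (c - d') (c + d') (fun=> f c / 2) <= intv (c - d') (c + d') f.
  apply: le_intv => //; [lra|exact: locbm_cst|].
  by move=> x hx; apply: hd; rewrite ler_norml; lra.
have i4 : 0 < intv (c - d') (c + d') (fun=> f c / 2) by rewrite intv_cst mulr_gt0 ?divr_gt0//; lra.
lra.
Qed.

Lemma intv_eq_interior a b f g : a <= b -> locbm f -> locbm g ->
  (forall x, a < x < b -> f x = g x) -> intv a b f = intv a b g.
Proof.
move=> ab lf lg fg.
have H h : locbm h -> intv a b h = \int[@lebesgue_measure R]_(x in `]a, b[) h x.
  move=> lh; rewrite -(intv_co ab lh) Rintegral_itv_obnd_cbnd//.
  by apply: integrableS (locbm_int a b lh) => //; apply: subset_itv; rewrite bnd_simp.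
by rewrite !H//; apply: eq_Rintegral => x; rewrite inE/= in_itv/=; exact: fg.
Qed.

Lemma smooth_of_derive f f' : (forall x, is_derive x 1 f (f' x)) -> smooth f' -> smooth f.
Proof.
move=> df sf'; apply: (@smooth_coind R (fun g => g = f \/ smooth g)); first by left.
move=> g [->|sg]; first by exists f' => //; right.
exists (derive1 g) => [|x]; last exact: smooth_is_derive.
by right; exact: smooth_derive1.
Qed.

(** The step is the integral of a kernel from l (x - m) to 1, where this affine map sends [p, q]
    onto [-1, 1]. *)
Lemma smooth_step p q : p < q -> exists s s' : R -> R,
  [/\ smooth s, smooth s', forall x, is_derive x 1 s (s' x) & forall x, s' x <= 0] /\
  [/\ forall x, 0 <= s x <= 1, forall x, x <= p -> s x = 1, forall x, q <= x -> s x = 0 &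
      forall x, ~~ (p <= x <= q) -> s' x = 0].
Proof.
move=> pq; have [k [sk k0 vk k1]] := @kernel_exists R (1 / 2) ltac:(lra) ltac:(lra).
pose l := 2 / (q - p); pose m := (p + q) / 2.
have l0 : 0 < l by rewrite divr_gt0// subr_gt0.
have ck := smooth_cont sk; have lk := locbm_cont ck.
have E1 x : x <= p -> l * (x - m) <= -1.
  move=> xp; rewrite -[leRHS](_ : l * (p - m) = -1).
    by rewrite ler_pM2l// lerD2r.
  by rewrite /l /m; field; rewrite gt_eqF// subr_gt0.
have E2 x : q <= x -> 1 <= l * (x - m).
  move=> xp; rewrite -[leLHS](_ : l * (q - m) = 1).
    by rewrite ler_pM2l// lerD2r.
  by rewrite /l /m; field; rewrite gt_eqF// subr_gt0.
have Z a b : a <= b -> b <= -1 \/ 1 <= a -> intv a b k = 0.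
  move=> ab hab; rewrite (intv_eq ab (g := fun=> 0)); first by rewrite intv_cst mul0r.
  move=> h /andP[ah hb]; rewrite vk//; apply: (@lt_le_trans _ _ 1); first lra.
  case: hab => hab; last by apply: le_trans (ler_norm _); lra.
  by rewrite -normrN; apply: le_trans (ler_norm _); lra.
have V y : y <= -1 -> intv y 1 k = 1.
  by move=> y1; rewrite -(intv_cat (-1) _ _ lk) k1 Z ?add0r//; left.
have V' y : 1 <= y -> intv y 1 k = 0.
  by move=> y1; rewrite intvC Z ?oppr0//; right.
pose s x := intv (l * (x - m)) 1 k; pose s' x := - l * k (l * (x - m)).
have daff (x : R) : is_derive x 1 (fun x : R => l * (x - m)) l.
  have := is_deriveZ l (is_deriveB (is_derive_id x 1) (is_derive_cst m x 1)).
  by move/is_derive_congr; apply=> //; change (l * (1 - 0) = l); rewrite subr0 mulr1.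
have ds (x : R) : is_derive x 1 s (s' x).
  have d1 (y : R) : is_derive y 1 (fun y => intv y 1 k) (- k y).
    have := is_deriveN (intv_is_derive 1 lk (ck y)).
    by move/is_derive_congr; apply=> // z; rewrite [RHS]intvC.
  have := @is_derive1_comp R _ _ x _ _ (d1 _) (daff x).
  by move/is_derive_congr; apply=> //; rewrite /s' [LHS]mulrC; ring.
have ss' : smooth s'.
  apply: smoothZ; apply: (@smooth_comp R k (fun x => l * (x - m)) sk).
  by apply: smoothZ; apply: smoothD; [exact: smooth_id|exact: smooth_cst].
exists s, s'; split; split.
- exact: smooth_of_derive ds ss'.
- exact: ss'.
- exact: ds.
- by move=> x; rewrite /s' mulNr oppr_le0 mulr_ge0// ltW.
- move=> x; rewrite /s; set y := l * _.
  have [y1|y1] := leP y (-1); first by rewrite V// ler01 lexx.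
  have [y2|y2] := leP 1 y; first by rewrite V'// ler01 lexx.
  rewrite intv_ge0//=; last exact: ltW.
  by rewrite -[leRHS]k1 -(intv_cat y (-1) _ lk) lerDr intv_ge0// ltW.
- by move=> x /E1; exact: V.
- by move=> x /E2; exact: V'.
- move=> x; rewrite negb_and -!ltNge => /orP[xp|qx]; rewrite /s' vk ?mulr0//; apply: (@lt_le_trans _ _ 1).
  + lra.
  + by rewrite -normrN; apply: le_trans (ler_norm _); have := E1 _ (ltW xp); lra.
  + lra.
  + by apply: le_trans (ler_norm _); exact: E2 (ltW qx).
Qed.

(** The cut-off of cos(2 pi x) - cos(2 pi r) is smooth, even and periodic without a sum over
    translates, and it lives within distance r of the integers. *)
Lemma periodic_kernel r : 0 < r -> r < 1 / 2 -> exists k, [/\ smooth k, forall x, 0 <= k x,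
  forall x, k (x + 1) = k x, forall x, k (- x) = k x & 0 < intv 0 1 k] /\
  forall x, k x != 0 -> exists m : int, `|x - m%:~R| <= r.
Proof.
move=> r0 r1; pose P : R := pi *+ 2.
have pi0 : 0 < pi :> R by exact: pi_gt0.
have P0 : 0 < P by rewrite /P mulr2n addr_gt0.
have inP x : 0 <= x <= 1 / 2 -> P * x \in `[0, pi].
  move=> /andP[x0 x1]; rewrite in_itv/= (mulr_ge0 (ltW P0) x0)/= /P mulr2n.
  by move: (pi : R) pi0 => a a0; nra.
pose k x := cutoff (cos (P * x) + - cos (P * r)).
have sk : smooth k.
  apply: (@smooth_comp R cutoff (fun x => cos (P * x) + - cos (P * r))); first exact: smooth_cutoff.
  apply: smoothD; last exact: smooth_cst.
  by apply: (@smooth_comp R cos (fun x => P * x)); [exact: smooth_cos|apply: smoothZ; exact: smooth_id].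
have k0 x : 0 <= k x by exact: cutoff_ge0.
have pk x : k (x + 1) = k x by rewrite /k mulrDr mulr1 cosD2pi.
have ek x : k (- x) = k x by rewrite /k mulrN cosN.
have hr : P * r \in `[0, pi] by apply: inP; rewrite !ltW.
have supp x : 0 <= x <= 1 / 2 -> k x != 0 -> x <= r.
  move=> hx kx; rewrite leNgt; apply: contra kx => rx; apply/eqP/cutoff_eq0.
  by rewrite subr_le0 leNgt (ltr_cos (inP _ hx) hr) (ltr_pM2l P0) -leNgt ltW.
exists k; split; first split => //.
  rewrite -(intv_periodic (- (1 / 2)) (smooth_cont sk) pk).
  apply: (@intv_gt0 _ _ 0) => //; [exact: smooth_cont|apply/andP; split; lra|].
  have h0 : 0 <= (0 : R) <= 1 / 2 by apply/andP; split; lra.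
  apply: cutoff_gt0; rewrite subr_gt0 (ltr_cos (inP _ h0) hr).
  by rewrite mulr0 mulr_gt0.
move=> x kx; have kf : k (frac x) = k x by exact: periodic_frac pk.
have /andP[f0 f1] := frac_itv x.
have [h|h] := leP (frac x) (1 / 2).
  exists (Num.floor x); rewrite -/(frac x) ger0_norm// supp ?f0//.
  by rewrite kf.
exists (Num.floor x + 1); rewrite intrD opprD addrA -/(frac x) -normrN opprB ger0_norm; last by rewrite subr_ge0 ltW.
apply: supp; first by apply/andP; split; lra.
by rewrite -ek opprB -(pk (frac x - 1)) subrK kf.
Qed.

Section KernelAverage.
Variables (r L : R) (k g : R -> R).
Hypotheses (r0 : 0 <= r) (L0 : 0 <= L) (ck : continuous k) (k0 : forall x, 0 <= k x).
Hypotheses (pk : forall x, k (x + 1) = k x) (ek : forall x, k (- x) = k x).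
Hypothesis supp : forall x, k x != 0 -> exists m : int, `|x - m%:~R| <= r.
Hypotheses (lg : lip L g) (pg : forall x, g (x + 1) = g x).

Lemma intv_kernel_shift x : intv 0 1 (fun y => k (x - y)) = intv 0 1 k.
Proof.
rewrite -(intv_periodic_shift (- x) ck pk); apply: intv_ext => y.
by rewrite -ek opprB.
Qed.

Lemma kernel_average x : `|intv 0 1 (fun y => k (x - y) * g y) - intv 0 1 k * g x| <= intv 0 1 k * (L * r).
Proof.
have ckx : continuous (fun y => k (x - y)) := @cont_shift_opp R k x ck.
have lkx := locbm_cont ckx; have lg' := locbm_cont (lip_cont lg).
have H y : `|k (x - y) * g y - k (x - y) * g x| <= k (x - y) * (L * r).
  rewrite -mulrBr normrM (ger0_norm (k0 _)).
  have [->|kxy] := eqVneq (k (x - y)) 0; first by rewrite !mul0r.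
  rewrite ler_wpM2l//; have [m hm] := supp kxy.
  have -> : g y = g (y + m%:~R) by rewrite periodic_int.
  apply: (le_trans (lg _ _)); rewrite ler_wpM2l// distrC.
  by rewrite opprD addrA.
have l1 : locbm (fun y => k (x - y) * g y) := locbmM lkx lg'.
have lZ c : locbm (fun y => c * k (x - y)) := locbmZ c lkx.
have E c : intv 0 1 k * c = intv 0 1 (fun y => c * k (x - y)).
  by rewrite intvZ// intv_kernel_shift mulrC.
rewrite ler_norml; apply/andP; split.
  rewrite -mulrN !E -intvB//; apply: le_intv => // [|y _]; first exact: locbmB.
  by have := H y; rewrite ler_norml => /andP[+ _]; rewrite mulrC; lra.
rewrite !E -intvB//; apply: le_intv => // [|y _]; first exact: locbmB.
by have := H y; rewrite ler_norml => /andP[_]; rewrite [k _ * g x]mulrC; lra.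
Qed.

End KernelAverage.

End SmoothStep.

(** * Fubini on a triangle and integration by parts *)

Section Triangle.
Context {R : realType}.
Implicit Types (T : R) (f g h : R -> R).

Definition le_ind (p : R * R) : R := ((p.1 <= p.2)%R)%:R.

Lemma measurable_le_ind : measurable_fun setT (le_ind : plane R -> R).
Proof.
have mle : measurable [set p : plane R | p.1 <= p.2].
  have -> : [set p : plane R | p.1 <= p.2] = (fun p : plane R => p.2 - p.1) @^-1` `[0, +oo[.
    by apply/seteqP; split=> p /=; rewrite in_itv/= andbT subr_ge0.
  rewrite -[X in measurable X]setTI.
  by apply: (measurable_funB measurable_snd measurable_fst) => //; exact: measurable_itv.
have -> : (le_ind : plane R -> R) = \1_[set p : plane R | p.1 <= p.2].
  by apply/funext => p; rewrite indicE /le_ind; congr (_%:R); rewrite /= mem_setE.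
exact: measurable_indic.
Qed.

Lemma intv_triangle_swap T f g : 0 <= T -> locbm f -> locbm g ->
  intv 0 T (fun t => f t * intv t T g) = intv 0 T (fun s => g s * intv 0 s f).
Proof.
move=> T0 lf lg; pose c (p : R * R) : R := ((p.1 <= p.2)%R)%:R.
have lc : locbm2 c.
  split; first exact: measurable_le_ind.
  by move=> r; exists 1 => t x _ _; rewrite /c normr_nat lern1 leq_b1.
have lF : locbm2 (fun p => c p * (f p.1 * g p.2)).
  by apply: locbm2M => //; apply: locbm2M; [exact: locbm2_fst|exact: locbm2_snd].
have := intv_fubini 0 T 0 T lF => /= E.
transitivity (intv 0 T (fun t => intv 0 T (fun x => c (t, x) * (f t * g x)))).
  apply: (intv_eq T0) => t /andP[t0 tT].
  have lc1 : locbm (fun x => c (t, x) * (f t * g x)) := locbm2_slice1 t lF.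
  have Z : intv 0 t (fun x => c (t, x) * (f t * g x)) = 0.
    rewrite (intv_eq_interior t0 lc1 (locbm_cst 0)); first by rewrite intv_cst mul0r.
    by move=> x /andP[_ xt]; rewrite /c/= leNgt xt mul0r.
  rewrite -(intv_cat t 0 T lc1) Z add0r -intvZ; last exact: lg.
  apply: (intv_eq tT) => x /andP[tx _].
  by rewrite /c/= tx mul1r.
apply: (etrans E); apply: (intv_eq T0) => s /andP[s0 sT].
have lc2 : locbm (fun t => c (t, s) * (f t * g s)) := locbm2_slice2 s lF.
have Z : intv s T (fun t => c (t, s) * (f t * g s)) = 0.
  rewrite (intv_eq_interior sT lc2 (locbm_cst 0)); first by rewrite intv_cst mul0r.
  by move=> t /andP[st _]; rewrite /c/= leNgt st mul0r.
rewrite -(intv_cat s 0 T lc2) Z addr0 -intvZ; last exact: lf.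
by apply: (intv_eq s0) => t /andP[_ ts]; rewrite /c/= ts mul1r mulrC.
Qed.

(** Integration by parts for the primitive of a function that is only measurable and locally
    bounded: Fubini on the triangle replaces its derivative. *)
Lemma intv_primitive_parts T f g g' : 0 <= T -> locbm f -> continuous g' ->
  (forall t : R, is_derive t 1 g (g' t)) -> g T = 0 ->
  intv 0 T (fun t => intv 0 t f * g' t) = - intv 0 T (fun t => f t * g t).
Proof.
move=> T0 lf cg' dg gT; have lg' := locbm_cont cg'.
have lg := locbm_cont (derive_cont dg).
under eq_fun do rewrite mulrC.
rewrite -(intv_triangle_swap T0 lf lg') -intvN; last exact: locbmM.
by apply: intv_ext => t; rewrite (intv_FTC t T cg' dg) gT sub0r mulrN.
Qed.

Lemma intv_periodic_parts f f' g g' : (forall x : R, is_derive x 1 f (f' x)) ->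
  (forall x : R, is_derive x 1 g (g' x)) -> continuous f' -> continuous g' ->
  (forall x, f (x + 1) = f x) -> (forall x, g (x + 1) = g x) ->
  intv 0 1 (fun x => f' x * g x) = - intv 0 1 (fun x => f x * g' x).
Proof.
move=> df dg cf' cg' pf pg.
have cf := derive_cont df; have cg := derive_cont dg.
have c1 : continuous (fun x => f' x * g x) by move=> x; apply: cvgM; [exact: cf'|exact: cg].
have c2 : continuous (fun x => f x * g' x) by move=> x; apply: cvgM; [exact: cf|exact: cg'].
apply/eqP; rewrite -subr_eq0 opprK -intvD; [|exact: locbm_cont..].
have c3 : continuous (fun x => f' x * g x + f x * g' x).
  by move=> x; apply: cvgD; [exact: c1|exact: c2].
have d3 (x : R) : is_derive x 1 (fun x => f x * g x) (f' x * g x + f x * g' x).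
  have := is_deriveM (df x) (dg x).
  move/is_derive_congr; apply=> //.
  by change (f x * g' x + g x * f' x = f' x * g x + f x * g' x); ring.
apply/eqP; apply: (etrans (intv_FTC 0 1 c3 d3)).
by rewrite -(add0r (1 : R)) pf pg subrr.
Qed.

End Triangle.

Lemma differentiable_classD (R : realType) n (f g : R * R -> R) : differentiable_class n f ->
  differentiable_class n g -> differentiable_class n (fun p => f p + g p).
Proof.
elim: n f g => [|n IH] f g.
  by move=> [cf _] [cg _]; split=> // p; apply: cvgD; [exact: cf|exact: cg].
move=> [cf [d1 d2 c1 c2]] [cg [e1 e2 b1 b2]].
apply: (@differentiable_class_step _ _ _ (fun p => dt f p + dt g p) (fun p => dx f p + dx g p)).
- by move=> p; apply: cvgD; [exact: cf|exact: cg].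
- by move=> t x; apply: (is_deriveD (is_derive_dt (d1 (t, x))) (is_derive_dt (e1 (t, x)))).
- by move=> t x; apply: (is_deriveD (is_derive_dx (d2 (t, x))) (is_derive_dx (e2 (t, x)))).
- exact: IH.
- exact: IH.
Qed.

(** * Space-time integrals and uniform vanishing near the final time *)

Section DoubleIntegral.
Context {R : realType}.
Implicit Types (F G : R * R -> R).

Definition dint (T : R) F := intv 0 T (fun t => intv 0 1 (fun x => F (t, x))).

Lemma dintD T F G : locbm2 F -> locbm2 G -> dint T (fun p => F p + G p) = dint T F + dint T G.
Proof.
move=> hF hG; rewrite /dint -(intvD 0 T (locbm2_intv2 0 1 hF) (locbm2_intv2 0 1 hG)).
by apply: intv_ext => t; exact: intvD (locbm2_slice1 t hF) (locbm2_slice1 t hG).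
Qed.

Lemma dintZ T c F : locbm2 F -> dint T (fun p => c * F p) = c * dint T F.
Proof.
move=> hF; rewrite /dint -(intvZ 0 T c (locbm2_intv2 0 1 hF)).
by apply: intv_ext => t; exact: intvZ (locbm2_slice1 t hF).
Qed.

Lemma eq_dint T F G : 0 <= T -> (forall t x, 0 <= t <= T -> F (t, x) = G (t, x)) ->
  dint T F = dint T G.
Proof. by move=> T0 FG; apply: intv_eq => // t tT; apply: intv_ext => x; exact: FG. Qed.

Lemma le_dint T F G : 0 <= T -> locbm2 F -> locbm2 G ->
  (forall t x, 0 <= t <= T -> F (t, x) <= G (t, x)) -> dint T F <= dint T G.
Proof.
move=> T0 hF hG FG; apply: (le_intv T0 (locbm2_intv2 0 1 hF) (locbm2_intv2 0 1 hG)) => t tT.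
apply: (le_intv ler01 (locbm2_slice1 t hF) (locbm2_slice1 t hG)) => x _; exact: FG.
Qed.

Lemma dint_swap T F : locbm2 F -> dint T F = intv 0 1 (fun x => intv 0 T (fun t => F (t, x))).
Proof. exact: intv_fubini. Qed.

Lemma dint_fst T (a : R -> R) F : locbm2 F ->
  dint T (fun p => a p.1 * F p) = intv 0 T (fun t => a t * intv 0 1 (fun x => F (t, x))).
Proof. by move=> hF; apply: intv_ext => t; exact: (intvZ 0 1 (a t) (locbm2_slice1 t hF)). Qed.

Definition vanishes_late (T d : R) F := forall t x, T - d <= t <= T -> F (t, x) = 0.

Lemma vanishes_near_of_late T d F : 0 < d -> vanishes_late T d F -> vanishes_near_final_time T F.
Proof.
move=> d0 hF [t x] [/= -> _]; apply/nbhs_ballP; exists d => //= -[s y] [/= hs _] [/= + _].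
rewrite in_itv/= => /andP[_ sT]; apply: hF; rewrite sT andbT.
by move: hs; rewrite /ball/= ltr_norml => /andP[_]; lra.
Qed.

(** Compactness of one period makes the neighbourhood of the final time uniform in x, and
    periodicity extends it to the line. *)
Lemma late_of_vanishes_near T F : 0 < T -> space_periodic T F -> vanishes_near_final_time T F ->
  exists2 d, 0 < d < T & vanishes_late T d F.
Proof.
move=> T0 pF hF.
have /compact_near_coveringP K : compact (`[0, 1] : set R) by exact: segment_compact.
have : \forall t \near T, `[0, 1]%classic `<=` (fun x : R => strip T (t, x) -> F (t, x) = 0).
  apply: (K _ (nbhs T) (fun t x : R => strip T (t, x) -> F (t, x) = 0)) => x _; have [[/= A B] [nA nB] AB] : nbhs (T, x) [set p | strip T p -> F p = 0].
    by apply: hF; split.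
  by exists (B, A) => //= -[y s] [/= By As]; exact: (AB (s, y)).
move=> /nbhs_ballP[d /= d0 hd].
pose d' := Num.min (d / 2) (T / 2).
have d'0 : 0 < d' by rewrite lt_min !divr_gt0.
have d'd : d' <= d / 2 by rewrite ge_min lexx.
have d'T : d' <= T / 2 by rewrite ge_min lexx orbT.
exists d'; first by rewrite d'0/=; lra.
move=> t x /andP[t1 t2].
have tT : 0 <= t <= T by rewrite t2 andbT; lra.
rewrite -(space_periodic_frac x pF tT).
have /andP[f0 f1] := frac_itv x.
apply: hd; last by split => //=; rewrite in_itv.
  by rewrite /ball/= ger0_norm ?subr_ge0//; lra.
by rewrite /= in_itv/= f0 ltW.
Qed.

Lemma strip_bounded T F : continuous F -> space_periodic T F ->
  exists2 M, 0 <= M & forall t x, 0 <= t <= T -> `|F (t, x)| <= M.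
Proof.
move=> cF pF; have [M hM] := cont2_bounded (`|T| + 1) cF.
exists M => [|t x tT].
  by apply: le_trans (normr_ge0 _) (hM 0 0 _ _); rewrite normr0 addr_ge0.
rewrite -(space_periodic_frac x pF tT); have /andP[f0 f1] := frac_itv x.
case/andP: tT => t0 tT; apply: hM.
  rewrite (ger0_norm t0); apply: (le_trans tT); apply: (le_trans (ler_norm _)).
  by rewrite lerDl.
by rewrite (ger0_norm f0); apply: (le_trans (ltW f1)); rewrite lerDr.
Qed.

End DoubleIntegral.

(** * The potential of an entropy solution and its identification with the Hopf-Lax evolution *)

Section Entropy.
Context {R : realType}.

Fact weak_arith (a b c : R) : -1 * a + 2^-1 * b + - c = 0 -> a = - (c + - 2^-1 * b).
Proof. lra. Qed.

Fact mollified_arith (A K a c t m : R) : A - K * a <= K * m ->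
  A + c * K * t <= K * (a + c * t + m).
Proof. lra. Qed.

Fact weighted_arith1 (A K g P m M : R) : `|A - K * g| <= K * m -> `|P| <= M ->
  K * (g * P) + - (K * m * M) <= P * A.
Proof.
move=> h1 h2; have := ler_pM (normr_ge0 _) (normr_ge0 _) h1 h2; rewrite -normrM -normrN.
by move=> /(le_trans (ler_norm _)); lra.
Qed.

Fact weighted_arith2 (K g l r M s L I e : R) : 0 < K ->
  K * g - K * (l * r) * M <= K * (s + L * r * I) -> (L * I + l * M) * r <= e -> g <= s + e.
Proof. by move=> K0 h1 h2; rewrite -(ler_pM2l K0); have := ler_wpM2l (ltW K0) h2; lra. Qed.

Fact convex_arith (T p x y a b : R) : p * (x + T * a) <= p * (y + T * b) -> (T - p) * x <= (T - p) * y ->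
  T * (x + p * a) <= T * (y + p * b).
Proof. lra. Qed.

Fact midpoint_arith (p T : R) : p < T -> p + (T - p) / 2 < T. Proof. lra. Qed.

Fact energy_arith (W W' E S p h e : R) : 0 <= - W + E * S -> W' <= W -> E * S <= E * (p + h) ->
  E * h <= e -> W' <= p * E + e.
Proof. lra. Qed.

Fact mass_arith (S F W E p : R) : S - F <= - (p / 2 * E) -> W <= p * E -> S <= F - 2^-1 * W.
Proof. lra. Qed.

Fact pairing_arith (M P S a b : R) : M * S <= M * P -> M * P + 1 * a <= M * S + 1 * b ->
  M * P + -1 * a <= M * S + -1 * b -> a = b.
Proof. by move=> h1 h2 h3; apply/eqP; rewrite eq_le; apply/andP; split; lra. Qed.

Fact square_arith (c v g : R) : 0 <= g ->
  - (c ^+ 2 / 2) * g <= 2^-1 * (v ^+ 2 * g) + - c * (v * g).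
Proof. by move=> g0; have := mulr_ge0 g0 (sqr_ge0 (v - c)); lra. Qed.

Fact average_arith (a b c d g m K p h e F A La : R) :
  a + - c * b = - F + 2^-1 * d -> A = - b -> - (c ^+ 2 / 2) * g <= 2^-1 * d + - c * A ->
  a <= - (m - La * h) -> c ^+ 2 / 2 * g <= c ^+ 2 / 2 * (K * (p + h)) ->
  (La + c ^+ 2 / 2 * K) * h <= e -> m <= F + c ^+ 2 / 2 * K * p + e.
Proof. by move=> h1 -> h3 h4 h5 h6; lra. Qed.

Variables (T Cv L : R) (w : R * R -> R) (f u0 : R -> R).
Hypotheses (T0 : 0 < T) (hw : locbm2 w) (bw : forall p, `|w p| <= Cv).
Hypotheses (lf : lip L f) (df : forall x : R, is_derive x 1 f (u0 x)) (cu0 : continuous u0).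
Hypothesis pf : forall x, f (x + 1) = f x.
Hypothesis weak : forall theta, test_function T theta -> vanishes_near_final_time T theta ->
  (forall p, strip T p -> 0 <= theta p) ->
  dint T (fun p => w p * dt theta p + 2^-1 * w p ^+ 2 * dx theta p) +
  intv 0 1 (fun x => u0 x * theta (0, x)) = 0.
Hypothesis energy : forall theta, test_function T theta -> vanishes_near_final_time T theta ->
  (forall p, strip T p -> 0 <= theta p) ->
  0 <= dint T (fun p => w p ^+ 2 * dt theta p + 2 / 3 * w p ^+ 3 * dx theta p) +
  intv 0 1 (fun x => u0 x ^+ 2 * theta (0, x)).

Let w2 p := w p ^+ 2.
Let hw2 : locbm2 w2. Proof. exact: locbm2M. Qed.
Let w2_ge0 p : 0 <= w2 p. Proof. exact: sqr_ge0. Qed.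
Let Cv0 : 0 <= Cv. Proof. exact: le_trans (normr_ge0 _) (bw (0, 0)). Qed.
Let w2_le p : w2 p <= Cv ^+ 2.
Proof. by rewrite /w2 -(real_normK (num_real (w p))) ler_sqr ?nnegrE. Qed.

(* [potential] is a weak primitive of the pair [(- w^2/2, w)]: its x-derivative is [w] by [weak_space]
   and its t-derivative is [- w^2/2] by [potential_time]. *)
Definition elapsed (p : R * R) := intv 0 T (fun s => ((s <= p.1)%R)%:R * w2 (s, p.2)).

Definition potential (p : R * R) := f p.2 - 2^-1 * elapsed p.

Let indic_le1 (b : bool) : 0 <= (b%:R : R) <= 1.
Proof. by rewrite ler0n lern1 leq_b1. Qed.

Let hslice p : locbm (fun s => ((s <= p.1)%R)%:R * w2 (s, p.2)).
Proof.
apply: locbmM; last exact: locbm2_slice2.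
split; last by move=> a b; exists 1 => x _; rewrite normr_nat lern1 leq_b1.
change (measurable_fun setT (fun s : R => le_ind (s, p.1))).
by apply: (measurableT_comp (@measurable_le_ind R)); exact: measurable_fun_pair.
Qed.

Lemma elapsedE t x : 0 <= t <= T -> elapsed (t, x) = intv 0 t (fun s => w2 (s, x)).
Proof.
move=> /andP[t0 tT]; rewrite /elapsed -(intv_cat t 0 T (hslice (t, x))).
have Z : intv t T (fun s => ((s <= (t, x).1)%R)%:R * w2 (s, (t, x).2)) = 0.
  rewrite (intv_eq_interior tT (hslice (t, x)) (locbm_cst 0)); first by rewrite intv_cst mul0r.
  by move=> s /andP[ts _]; rewrite /= leNgt ts mul0r.
by rewrite Z addr0; apply: (intv_eq t0) => s /andP[_ st]; rewrite /= st mul1r.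
Qed.

Lemma elapsed_itv p : 0 <= elapsed p <= Cv ^+ 2 * T.
Proof.
have H s : 0 <= ((s <= p.1)%R)%:R * w2 (s, p.2) <= Cv ^+ 2.
  have /andP[b0 b1] := indic_le1 (s <= p.1)%R.
  rewrite mulr_ge0 ?w2_ge0//=; apply: le_trans (w2_le (s, p.2)).
  by rewrite ler_piMl.
apply/andP; split; first by apply: (intv_ge0 (ltW T0)) => s _; have /andP[] := H s.
rewrite -[X in _ * X]subr0 -intv_cst.
by apply: (le_intv (ltW T0) (hslice p) (locbm_cst _)) => s _; have /andP[] := H s.
Qed.

Lemma locbm2_elapsed : locbm2 elapsed.
Proof.
split; last first.
  move=> r; exists (Cv ^+ 2 * T) => t x _ _.
  by have /andP[h1 h2] := elapsed_itv (t, x); rewrite ger0_norm.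
have E : elapsed = fun p => \int[@lebesgue_measure R]_(s in `[0, T]) (((s <= p.1)%R)%:R * w2 (s, p.2)).
  by apply/funext => p; rewrite /elapsed intvE// ltW.
(* The indicator of s <= t turns the moving upper limit into part of a jointly measurable integrand
   over a fixed interval. *)
rewrite E; apply: (@measurable_param _ _ (plane R) `[0, T]
  (fun q : plane R * measurableTypeR R => ((q.2 <= q.1.1)%R)%:R * w2 (q.2, q.1.2))).
  exact: measurable_itv.
have m11 : measurable_fun setT (fun q : plane R * measurableTypeR R => q.1.1).
  exact: (measurableT_comp measurable_fst measurable_fst).
have m12 : measurable_fun setT (fun q : plane R * measurableTypeR R => q.1.2).
  exact: (measurableT_comp measurable_snd measurable_fst).
apply: measurable_funM.
  exact: (measurableT_comp (@measurable_le_ind R) (measurable_fun_pair measurable_snd m11)).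
exact: (measurableT_comp (proj1 hw2) (measurable_fun_pair measurable_snd m12)).
Qed.

Let cf := lip_cont lf.

Lemma locbm2_potential : locbm2 potential.
Proof.
apply: locbm2B; last exact: locbm2Z locbm2_elapsed.
exact: locbm2_snd (locbm_cont cf).
Qed.

Lemma potential_bound : exists2 M, 0 <= M & forall p, `|potential p| <= M.
Proof.
have [M M0 hM] := periodic_bounded cf pf.
exists (M + Cv ^+ 2 * T) => [|p]; first by rewrite addr_ge0// mulr_ge0 ?sqr_ge0// ltW.
apply: (le_trans (ler_normB _ _)); apply: lerD; first exact: hM.
have /andP[h1 h2] := elapsed_itv p.
by rewrite normrM (ger0_norm h1) ger0_norm ?invr_ge0//; lra.
Qed.

Lemma potential_step t s x : 0 <= t -> t <= s -> s <= T ->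
  potential (t, x) - Cv ^+ 2 * (s - t) <= potential (s, x).
Proof.
move=> t0 ts sT; rewrite /potential !elapsedE ?t0 ?(le_trans ts sT) ?(le_trans t0 ts)//=.
rewrite -(intv_cat t 0 s (locbm2_slice2 x hw2)).
have h1 : intv t s (fun s => w2 (s, x)) <= Cv ^+ 2 * (s - t).
  rewrite -intv_cst; apply: (le_intv ts (locbm2_slice2 x hw2) (locbm_cst _)) => y _; exact: w2_le.
have h2 : 0 <= intv t s (fun s => w2 (s, x)) by apply: (intv_ge0 ts).
by lra.
Qed.

(** The time integral theta of g from t to T is admissible and has theta_t = - g, so the weak
    formulation expresses the integral of w g through w^2 and theta_x. Exchanging the two time
    integrals produces [elapsed], and integration by parts in x turns the boundary term at t = 0
    into the contribution of f. *)
Lemma weak_space d g : 0 < d -> test_function T g -> (forall p, strip T p -> 0 <= g p) ->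
  vanishes_late T d g ->
  dint T (fun p => w p * g p) = - dint T (fun p => potential p * dx g p).
Proof.
move=> d0 tg g0 vg.
have cg := test_cont tg; have cdx := test_dx_cont tg.
pose th := antideriv T g; have tth : test_function T th := antideriv_test (ltW T0) tg.
have Et : dt th = fun p => - g p by apply: dtE => t x; exact: (antideriv_dt T t x cg).
pose A := antideriv T (dx g).
have Ex : dx th = A by apply: dxE => t x; exact: (antideriv_dx T t x cg cdx (test_dx tg)).
have cA : continuous A by rewrite -Ex; exact: test_dx_cont tth.
have vth : vanishes_near_final_time T th.
  apply: (vanishes_near_of_late d0) => t x /andP[t1 t2]; rewrite /th /antideriv/=.
  rewrite (intv_eq t2 (g := fun=> 0)); first by rewrite intv_cst mul0r.
  by move=> s /andP[ts sT]; apply: vg; rewrite sT (le_trans t1 ts).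
have th0 p : strip T p -> 0 <= th p.
  move=> [/= ]; rewrite in_itv/= => /andP[t0 tT] _; apply: (intv_ge0 tT) => s /andP[ts sT].
  by apply: g0; split=> //=; rewrite in_itv/= sT (le_trans t0 ts).
have := weak tth vth th0; rewrite Et Ex.
have lg := locbm2_cont cg; have lA := locbm2_cont cA; have ldx := locbm2_cont cdx.
have l1 := locbm2M hw lg; have l2 := locbm2M hw2 lA.
have E1 : dint T (fun p => w p * - g p + 2^-1 * w p ^+ 2 * A p) =
    -1 * dint T (fun p => w p * g p) + 2^-1 * dint T (fun p => w2 p * A p).
  rewrite -(dintZ T (-1) l1) -(dintZ T 2^-1 l2) -(dintD T (locbm2Z (-1) l1) (locbm2Z 2^-1 l2)).
  by apply: (eq_dint (ltW T0)) => t x _; rewrite /w2; ring.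
have E2 : dint T (fun p => w2 p * A p) = dint T (fun p => elapsed p * dx g p).
  rewrite (dint_swap T l2) (dint_swap T (locbm2M locbm2_elapsed ldx)); apply: intv_ext => x.
  apply: (etrans (intv_triangle_swap (ltW T0) (locbm2_slice2 x hw2) (locbm2_slice2 x ldx))).
  by apply: (intv_eq (ltW T0)) => s sT; rewrite elapsedE// mulrC.
have lfx : locbm2 (fun p : R * R => f p.2) := locbm2_snd (locbm_cont cf).
have [pth _] := tth; have [pdth _] := test_dx_test tth.
have z01 : (0 : R) \in `[0, T] by rewrite in_itv/= lexx ltW.
have E3 : intv 0 1 (fun x => u0 x * th (0, x)) = - dint T (fun p => f p.2 * dx g p).
  rewrite (dint_swap T (locbm2M lfx ldx)).
  rewrite (intv_periodic_parts df (fun x => test_dx tth 0 x) cu0 (cont_slice1 0 (test_dx_cont tth)) pf).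
    congr (- _); apply: intv_ext => x.
    apply: (etrans _ (esym (intvZ 0 T (f x) (locbm2_slice2 x ldx)))).
    by rewrite Ex.
  by move=> x; exact: pth.
have E4 : dint T (fun p => potential p * dx g p) =
    dint T (fun p => f p.2 * dx g p) + - 2^-1 * dint T (fun p => elapsed p * dx g p).
  have l3 := locbm2M lfx ldx; have l4 := locbm2M locbm2_elapsed ldx.
  rewrite -(dintZ T (- 2^-1) l4) -(dintD T l3 (locbm2Z (- 2^-1) l4)).
  by apply: (eq_dint (ltW T0)) => t x _; rewrite /potential/=; ring.
rewrite E1 E2 E3 E4; exact: weak_arith.
Qed.

Lemma potential_time g g' : continuous g -> continuous g' ->
  (forall t x : R, is_derive t 1 (fun s => g (s, x)) (g' (t, x))) -> (forall x, g (T, x) = 0) ->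
  dint T (fun p => potential p * g' p) =
  - intv 0 1 (fun x => f x * g (0, x)) + 2^-1 * dint T (fun p => w2 p * g p).
Proof.
move=> cg cg' dg gT.
have lg := locbm2_cont cg; have lg' := locbm2_cont cg'.
have lfx : locbm2 (fun p : R * R => f p.2) := locbm2_snd (locbm_cont cf).
have l3 := locbm2M lfx lg'; have l4 := locbm2M locbm2_elapsed lg'.
have -> : dint T (fun p => potential p * g' p) =
    dint T (fun p => f p.2 * g' p) + - 2^-1 * dint T (fun p => elapsed p * g' p).
  rewrite -(dintZ T (- 2^-1) l4) -(dintD T l3 (locbm2Z (- 2^-1) l4)).
  by apply: (eq_dint (ltW T0)) => t x _; rewrite /potential/=; ring.
have -> : dint T (fun p => f p.2 * g' p) = - intv 0 1 (fun x => f x * g (0, x)).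
  rewrite (dint_swap T l3) -intvN; last exact: locbmM (locbm_cont cf) (locbm2_slice1 0 lg).
  apply: intv_ext => x; apply: (etrans (intvZ 0 T (f x) (locbm2_slice2 x lg'))).
  by rewrite (intv_FTC 0 T (cont_slice2 x cg') (fun t => dg t x)) gT sub0r mulrN.
have -> : dint T (fun p => elapsed p * g' p) = - dint T (fun p => w2 p * g p).
  have l5 := locbm2M hw2 lg.
  rewrite (dint_swap T l4) (dint_swap T l5) -intvN; last exact: (locbm2_intv2 0 T (locbm2_swap l5)).
  apply: intv_ext => x.
  rewrite -(intv_primitive_parts (ltW T0) (locbm2_slice2 x hw2) (cont_slice2 x cg') (fun t => dg t x) (gT x)).
  by apply: (intv_eq (ltW T0)) => s sT; rewrite elapsedE.
by rewrite mulrNN.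
Qed.

Section Average.
Variables (k : R -> R) (a c p : R).
Hypotheses (sk : smooth k) (k0 : forall x, 0 <= k x) (pk : forall x, k (x + 1) = k x).
Hypothesis ek : forall x, k (- x) = k x.
Hypotheses (p0 : 0 <= p) (pT : p < T).

Let ck := smooth_cont sk.
Let m t := intv 0 1 (fun y => k (a + c * t - y) * potential (t, y)).
Let F0 := intv 0 1 (fun y => k (a - y) * f y).
Let K := intv 0 1 k.

Let K0 : 0 <= K. Proof. by apply: intv_ge0. Qed.

Let lm (t s : R) : locbm (fun y => k (a + c * s - y) * potential (t, y)).
Proof.
apply: locbmM; last exact: (locbm2_slice1 t locbm2_potential).
by apply: locbm_cont; exact: cont_shift_opp.
Qed.

(** One-sided control in time: the potential decreases at a bounded rate and the smooth kernel moves
    with speed c. *)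
Let m_step : exists2 La, 0 <= La & forall t, p <= t <= T -> m p - La * (t - p) <= m t.
Proof.
have [Mk Mk0 hMk] := periodic_bounded ck pk.
have pk' := is_derive_periodic (fun x => smooth_is_derive x sk) pk.
have [Lk Lk0 hLk] := periodic_bounded (smooth_cont (smooth_derive1 sk)) pk'.
have lk := derive_lip (fun x => smooth_is_derive x sk) hLk.
have [MP MP0 hMP] := potential_bound.
pose La := Mk * Cv ^+ 2 + Lk * `|c| * MP.
exists La => [|t /andP[pt tT]].
  by rewrite addr_ge0// !mulr_ge0// sqr_ge0.
rewrite lerBlDr -[La * _](_ : intv 0 1 (fun=> La * (t - p)) = _); last by rewrite intv_cst subr0 mulr1.
rewrite -(intvD _ _ (lm t t) (locbm_cst _)).
apply: (le_intv ler01 (lm p p)) => [|y _]; first exact: locbmD (lm t t) (locbm_cst _).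
have h1 := potential_step y p0 pt tT.
have h2 := le_trans (ler_norm _) (lk (a + c * p - y) (a + c * t - y)).
have h3 : `|a + c * p - y - (a + c * t - y)| = `|c| * (t - p).
  rewrite (_ : _ - _ = - (c * (t - p))); last by ring.
  by rewrite normrN normrM (ger0_norm (_ : 0 <= t - p)) ?subr_ge0.
have h4 : k (a + c * t - y) <= Mk := le_trans (ler_norm _) (hMk _).
have h5 : `|(k (a + c * p - y) - k (a + c * t - y)) * potential (p, y)| <= Lk * `|c| * (t - p) * MP.
  by rewrite normrM ler_pM// (le_trans (lk _ _))// h3 mulrA.
have {}h5 := le_trans (ler_norm _) h5.
have h6 : k (a + c * t - y) * (potential (p, y) - potential (t, y)) <= Mk * (Cv ^+ 2 * (t - p)).
  apply: (@le_trans _ _ (k (a + c * t - y) * (Cv ^+ 2 * (t - p)))).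
    by rewrite ler_wpM2l//; lra.
  by rewrite ler_wpM2r// mulr_ge0 ?sqr_ge0// subr_ge0.
by rewrite /La; lra.
Qed.

Let slice_mass t : intv 0 1 (fun y => k (a + c * t - y)) = K.
Proof. exact: (intv_kernel_shift ck pk ek). Qed.

(* Tested against s(t) k(a + c t - y), the potential grows along the line of slope c at a rate at most
   c^2/2, because w^2/2 - c w >= - c^2/2. *)
Lemma average_characteristic : m p <= F0 + c ^+ 2 / 2 * K * p.
Proof.
have [La La0 hLa] := m_step.
apply/ler_addgt0Pr => e e0.
pose B := La + c ^+ 2 / 2 * K.
have B0 : 0 <= B by rewrite addr_ge0// mulr_ge0// divr_ge0// sqr_ge0.
(* Width of the layer [p, p + h] in which the cut-off drops from 1 to 0; [B] collects the two errors
   proportional to this width. *)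
pose h := Num.min ((T - p) / 2) (e / (B + 1)).
have h0 : 0 < h by rewrite lt_min !divr_gt0 ?subr_gt0// ltr_wpDl.
have hT : h <= (T - p) / 2 by rewrite ge_min lexx.
have hB : B * h <= e.
  apply: (@le_trans _ _ ((B + 1) * h)); first by rewrite ler_wpM2r ?(ltW h0)//; lra.
  by rewrite mulrC -ler_pdivlMr ?ltr_wpDl// ge_min lexx orbT.
pose q := p + h; have pq : p < q by rewrite ltrDl.
have qT : q < T by rewrite /q; lra.
have [s [s' [[ss ss' ds s'0] [s01 s1 sz s'z]]]] := smooth_step pq.
pose kk y := k (a + y).
have skk : smooth kk.
  by apply: (@smooth_comp R k (fun y => a + y) sk); apply: smoothD; [exact: smooth_cst|exact: smooth_id].
pose g (z : R * R) := s z.1 * kk (c * z.1 + -1 * z.2).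
have s2g : smooth2 g by apply: smooth2_mul; [exact: smooth2_fst|exact: smooth2_lin].
have gE t y : g (t, y) = s t * k (a + c * t - y) by rewrite /g /kk/= mulN1r addrA.
have tg : test_function T g.
  apply: smooth2_test => // t x _; rewrite !gE -(pk (a + c * t - (x + 1))).
  by rewrite opprD addrA subrK.
have g0 z : strip T z -> 0 <= g z by move=> _; case: z => t y; rewrite gE mulr_ge0//; case/andP: (s01 t).
have late : vanishes_late T (T - q) g.
  by move=> t x /andP[qt _]; rewrite gE sz ?mul0r//; lra.
pose k' := derive1 k.
have dk (x : R) : is_derive x 1 k (k' x) := smooth_is_derive x sk.
have lin (x b al : R) : is_derive x 1 (fun x : R => b + al * x) al.
  have := is_deriveD (is_derive_cst b x 1) (is_deriveZ al (is_derive_id x 1)).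
  by move/is_derive_congr; apply=> //; change (0 + al * 1 = al); rewrite add0r mulr1.
have Ex t0 y0 : dx g (t0, y0) = - (s t0 * k' (a + c * t0 - y0)).
  have H (t y : R) : is_derive y 1 (fun y => g (t, y)) (- (s t * k' (a + c * t - y))).
    have := is_deriveZ (s t) (@is_derive1_comp R k _ y _ _ (dk _) (lin y (a + c * t) (-1))).
    move/is_derive_congr; apply=> [z|].
      by change (s t * k (a + c * t + -1 * z) = g (t, z)); rewrite gE mulN1r.
    by change (s t * (k' (a + c * t + -1 * y) * -1) = - (s t * k' (a + c * t - y))); rewrite mulN1r; ring.
  pose G (z : R * R) := - (s z.1 * k' (a + c * z.1 - z.2)).
  exact: (congr1 (@^~ (t0, y0)) (dxE (g := G) H)).
have Et t0 y0 : dt g (t0, y0) = s' t0 * k (a + c * t0 - y0) + - c * dx g (t0, y0).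
  rewrite Ex.
  have H (t y : R) : is_derive t 1 (fun t => g (t, y))
      (s' t * k (a + c * t - y) + - c * - (s t * k' (a + c * t - y))).
    have := is_deriveM (ds t) (@is_derive1_comp R k _ t _ _ (dk _) (lin t (a - y) c)).
    move/is_derive_congr; apply=> [z|].
      by change (s z * k (a - y + c * z) = g (z, y)); rewrite gE addrAC.
    by change (s t * (k' (a - y + c * t) * c) + k (a - y + c * t) * s' t =
      s' t * k (a + c * t - y) + - c * - (s t * k' (a + c * t - y))); rewrite addrAC; ring.
  pose G (z : R * R) := s' z.1 * k (a + c * z.1 - z.2) + - c * - (s z.1 * k' (a + c * z.1 - z.2)).
  exact: (congr1 (@^~ (t0, y0)) (dtE (g := G) H)).
have lg := locbm2_cont (test_cont tg); have ldx := locbm2_cont (test_dx_cont tg).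
have lP := locbm2_potential.
pose kP (z : R * R) := k (a + c * z.1 - z.2) * potential z.
have lkP : locbm2 kP.
  apply: locbm2M => //; apply: locbm2_cont => z.
  apply: (@continuous_comp _ _ _ (fun z : R * R => a + c * z.1 - z.2) k); last exact: ck.
  apply: cvgB; last exact: cvg_snd.
  by apply: cvgD; [exact: cvg_cst|apply: cvgM; [exact: cvg_cst|exact: cvg_fst]].
have ls' : locbm2 (fun z : R * R => s' z.1) := locbm2_fst (locbm_cont (smooth_cont ss')).
have l1 := locbm2M ls' lkP; have l2 := locbm2M lP ldx.
have gT x : g (T, x) = 0 by rewrite gE sz ?mul0r// ltW.
have H1 := potential_time (test_cont tg) (test_dt_cont tg) (test_dt tg) gT.
have dT : 0 < T - q by rewrite subr_gt0.
have H2 := weak_space dT tg g0 late.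
have H3 : dint T (fun z => potential z * dt g z) =
    dint T (fun z => s' z.1 * kP z) + - c * dint T (fun z => potential z * dx g z).
  rewrite -(dintZ T (- c) l2) -(dintD T l1 (locbm2Z (- c) l2)).
  by apply: (eq_dint (ltW T0)) => t y _; rewrite Et /kP/=; ring.
have H4 : intv 0 1 (fun x => f x * g (0, x)) = F0.
  by apply: intv_ext => y; rewrite gE s1// mul1r mulr0 addr0 mulrC.
have H5 : - (c ^+ 2 / 2) * dint T g <=
    2^-1 * dint T (fun z => w2 z * g z) + - c * dint T (fun z => w z * g z).
  have m1 := locbm2M hw2 lg; have m2 := locbm2M hw lg.
  rewrite -(dintZ T _ lg) -(dintZ T _ m1) -(dintZ T _ m2).
  rewrite -(dintD T (locbm2Z _ m1) (locbm2Z _ m2)).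
  apply: (le_dint (ltW T0) (locbm2Z _ lg) (locbm2D (locbm2Z _ m1) (locbm2Z _ m2))) => t y tT.
  have gg : 0 <= g (t, y) by apply: g0; split => //=; rewrite in_itv.
  exact: (square_arith c (w (t, y)) gg).
have H6 : dint T g <= K * q.
  have -> : dint T g = intv 0 T (fun t => K * s t).
    apply: intv_ext => t; under eq_fun do rewrite gE.
    rewrite intvZ; last by apply: locbm_cont; exact: cont_shift_opp.
    by rewrite slice_mass mulrC.
  have lsm := locbm_cont (smooth_cont ss).
  rewrite intvZ// ler_wpM2l// -(intv_cat q 0 T lsm).
  have -> : intv q T s = 0.
    rewrite (intv_eq (ltW qT) (g := fun=> 0)); first by rewrite intv_cst mul0r.
    by move=> x /andP[qx _]; exact: sz.
  have q0 : 0 <= q by apply: le_trans (ltW pq).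
  rewrite addr0; have -> : q = intv 0 q (fun=> 1) by rewrite intv_cst mul1r subr0.
  rewrite {1}(_ : intv 0 q (fun=> 1) = q); last by rewrite intv_cst mul1r subr0.
  by apply: (le_intv q0 lsm (locbm_cst _)) => x _; case/andP: (s01 x).
(* The function - s' is a probability density on [p, q], and there the averages are at least m p -
   La h. *)
have H7 : dint T (fun z => s' z.1 * kP z) <= - (m p - La * h).
  rewrite (dint_fst T s' lkP).
  have <- : intv 0 T (fun t => (m p - La * h) * s' t) = - (m p - La * h).
    rewrite intvZ; last exact: locbm_cont (smooth_cont ss').
    rewrite (intv_FTC 0 T (smooth_cont ss') ds) (sz T (ltW qT)) (s1 0 p0); ring.
  apply: (le_intv (ltW T0)).
  - apply: locbmM; first exact: locbm_cont (smooth_cont ss').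
    exact: (locbm2_intv2 0 1 lkP).
  - exact: locbmZ (locbm_cont (smooth_cont ss')).
  move=> t /andP[t0 tT].
  have [/andP[pt tq]|/s'z ->] := boolP (p <= t <= q); last by rewrite mul0r mulr0.
  rewrite [leRHS]mulrC ler_wnM2l//.
  have := hLa t; rewrite pt tT => /(_ isT); apply: le_trans.
  by rewrite lerD2l lerN2 (ler_wpM2l La0)// lerBlDl.
have H8 : c ^+ 2 / 2 * dint T g <= c ^+ 2 / 2 * (K * q).
  by rewrite ler_wpM2l// divr_ge0// sqr_ge0.
rewrite H3 H4 in H1.
exact: (average_arith H1 H2 H5 H7 H8 hB).
Qed.

End Average.

Let L0 : 0 <= L.
Proof. by have := le_trans (normr_ge0 _) (lf 1 0); rewrite subr0 normr1 mulr1. Qed.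

Let lS t : 0 <= t -> continuous (hopf_lax t f).
Proof. by move=> t0; exact: lip_cont (hopf_lax_lip t0 lf). Qed.

(** The line that reaches x at time t is started from a Hopf-Lax minimizer a, with slope (x - a)/t.
    The growth c^2 t/2 along it is then exactly the Hopf-Lax cost. *)
Lemma mollified_potential_le k r t x : smooth k -> (forall x, 0 <= k x) ->
  (forall x, k (x + 1) = k x) -> (forall x, k (- x) = k x) -> 0 <= r ->
  (forall x, k x != 0 -> exists m : int, `|x - m%:~R| <= r) -> 0 < t < T ->
  intv 0 1 (fun y => k (x - y) * potential (t, y)) <= intv 0 1 k * (hopf_lax t f x + L * r).
Proof.
move=> sk k0 pk ek r0 supp /andP[t0 tT].
have [a Ea] := hopf_lax_attained t0 lf x.
have := average_characteristic a ((x - a) / t) sk k0 pk ek (ltW t0) tT.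
have -> : a + (x - a) / t * t = x by rewrite divfK ?gt_eqF// addrC subrK.
move=> H; apply: (le_trans H).
have := kernel_average L0 (smooth_cont sk) k0 pk ek supp lf pf a.
move=> /(le_trans (ler_norm _)); rewrite Ea.
have -> : (x - a) ^+ 2 / (2 * t) = ((x - a) / t) ^+ 2 / 2 * t by field; rewrite gt_eqF.
exact: mollified_arith.
Qed.

(** The potential has no regularity in x, so the approximation is put on the weight. The double
    integral of G(x) k(x - y) P(t, y) is read in two ways: integrating in y first, it is bounded by
    [mollified_potential_le]; integrating in x first, the kernel average of G replaces G up to LG r.
    Both errors vanish with r. *)
Lemma potential_weighted_le t G LG : 0 < t < T -> lip LG G -> (forall x, G (x + 1) = G x) ->
  (forall x, 0 <= G x) ->
  intv 0 1 (fun y => G y * potential (t, y)) <= intv 0 1 (fun y => G y * hopf_lax t f y).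
Proof.
move=> tT lG pG G0; apply/ler_addgt0Pr => e e0.
have cG := lip_cont lG; have lbG := locbm_cont cG.
have LG0 : 0 <= LG by have := le_trans (normr_ge0 _) (lG 1 0); rewrite subr0 normr1 mulr1.
have [MP MP0 hMP] := potential_bound.
have lPt := locbm2_slice1 t locbm2_potential.
have t0 : 0 <= t by case/andP: tT => /ltW.
have lSt := locbm_cont (lS t0).
pose IG := intv 0 1 G; have IG0 : 0 <= IG by apply: intv_ge0.
pose Bd := L * IG + LG * MP.
have Bd0 : 0 <= Bd by rewrite addr_ge0// mulr_ge0.
pose r := Num.min (1 / 4) (e / (Bd + 1)).
have r0 : 0 < r by rewrite lt_min !divr_gt0// ltr_wpDl.
have r1 : r < 1 / 2 by apply: (@le_lt_trans _ _ (1 / 4)); [rewrite ge_min lexx|lra].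
have hB : Bd * r <= e.
  apply: (@le_trans _ _ ((Bd + 1) * r)); first by rewrite ler_wpM2r ?(ltW r0)//; lra.
  by rewrite mulrC -ler_pdivlMr ?ltr_wpDl// ge_min lexx orbT.
have [k [[sk k0 pk ek K0] supp]] := periodic_kernel r0 r1.
have ck := smooth_cont sk.
pose K := intv 0 1 k.
pose F (z : R * R) := G z.1 * (k (z.1 - z.2) * potential (t, z.2)).
have lk2 : locbm2 (fun z : R * R => k (z.1 - z.2)).
  apply: locbm2_cont => z.
  apply: (@continuous_comp _ _ _ (fun z : R * R => z.1 - z.2) k); last exact: ck.
  by apply: cvgB; [exact: cvg_fst|exact: cvg_snd].
have lF : locbm2 F.
  exact: (locbm2M (locbm2_fst lbG) (locbm2M lk2 (locbm2_snd lPt))).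
have H1 : dint 1 F <= K * (intv 0 1 (fun y => G y * hopf_lax t f y) + L * r * IG).
  have -> : K * (intv 0 1 (fun y => G y * hopf_lax t f y) + L * r * IG) =
      intv 0 1 (fun x => K * (G x * hopf_lax t f x + L * r * G x)).
    have lGS := locbmM lbG lSt.
    rewrite (intvZ 0 1 K (locbmD lGS (locbmZ (L * r) lbG))).
    by rewrite (intvD 0 1 lGS (locbmZ (L * r) lbG)) (intvZ 0 1 (L * r) lbG).
  apply: (le_intv ler01 (locbm2_intv2 0 1 lF)).
    exact: locbmZ (locbmD (locbmM lbG lSt) (locbmZ (L * r) lbG)).
  move=> x _; rewrite /F/= intvZ; last first.
    by apply: (locbmM _ lPt); apply: locbm_cont; exact: cont_shift_opp.
  have -> : K * (G x * hopf_lax t f x + L * r * G x) = G x * (K * (hopf_lax t f x + L * r)) by ring.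
  exact: (ler_wpM2l (G0 x) (mollified_potential_le x sk k0 pk ek (ltW r0) supp tT)).
have H2 : K * intv 0 1 (fun y => G y * potential (t, y)) - K * (LG * r) * MP <= dint 1 F.
  rewrite (dint_swap 1 lF).
  have lGP := locbmM lbG lPt.
  have -> : K * intv 0 1 (fun y => G y * potential (t, y)) - K * (LG * r) * MP =
      intv 0 1 (fun y => K * (G y * potential (t, y)) + - (K * (LG * r) * MP)).
    by rewrite (intvD 0 1 (locbmZ K lGP) (locbm_cst _)) (intvZ 0 1 K lGP) intv_cst subr0 mulr1.
  apply: (le_intv ler01 (locbmD (locbmZ K lGP) (locbm_cst _)) (locbm2_intv2 0 1 (locbm2_swap lF))).
  move=> y _; have -> : intv 0 1 (fun x => F (x, y)) = potential (t, y) * intv 0 1 (fun x => k (y - x) * G x).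
    rewrite -intvZ; last by apply: (locbmM _ lbG); apply: locbm_cont; exact: cont_shift_opp.
    by apply: intv_ext => x; rewrite /F/= -(ek (y - x)) opprB; ring.
  apply: weighted_arith1 (hMP (t, y)).
  exact: (kernel_average LG0 ck k0 pk ek supp lG pG y).
exact: (weighted_arith2 K0 (le_trans H2 H1) hB).
Qed.

Hypothesis mono : forall x y, x <= y -> x + T * u0 x <= y + T * u0 y.

(** The mass of P(p) is that of f minus half the energy spent up to time p, which the entropy
    inequality for y^2 bounds by half of p times the initial energy. Since characteristics do not
    cross before T, this is exactly the loss of mass of the Hopf-Lax evolution. *)
Lemma potential_mass_ge p : 0 <= p < T ->
  intv 0 1 (hopf_lax p f) <= intv 0 1 (fun y => potential (p, y)).
Proof.
move=> /andP[p0 pT].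
have pu0 := is_derive_periodic df pf.
have cu2 : continuous (fun x => u0 x ^+ 2) by move=> x; apply: cvgM; exact: cu0.
pose E0 := intv 0 1 (fun x => u0 x ^+ 2).
have E00 : 0 <= E0 by apply: (intv_ge0 ler01) => x _; exact: sqr_ge0.
(* The map at time p is a convex combination of the maps at times 0 and T. *)
have mono_p x y : x <= y -> x + p * u0 x <= y + p * u0 y.
  move=> xy; rewrite -(ler_pM2l T0).
  have h1 := ler_wpM2l p0 (mono xy); have h2 : 0 <= T - p by rewrite subr_ge0 ltW.
  have h3 := ler_wpM2l h2 xy; exact: (convex_arith h1 h3).
have lff := locbm_cont cf; have lSp := locbm_cont (lS p0).
have D0 := hopf_lax_energy_le p0 lf df cu0 pu0 mono_p.
rewrite (intvB 0 1 lSp lff) -/E0 in D0.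
have e_le : intv 0 p (fun t => intv 0 1 (fun x => w2 (t, x))) <= p * E0.
  apply/ler_addgt0Pr => e e0.
  pose h := Num.min ((T - p) / 2) (e / (E0 + 1)).
  have h0 : 0 < h by rewrite lt_min !divr_gt0 ?subr_gt0// ltr_wpDl.
  have hB : E0 * h <= e.
    apply: (@le_trans _ _ ((E0 + 1) * h)); first by rewrite (ler_wpM2r (ltW h0))// lerDl.
    by rewrite mulrC -ler_pdivlMr ?ltr_wpDl// ge_min lexx orbT.
  pose q := p + h; have pq : p < q by rewrite ltrDl.
  have qT : q < T.
    apply: (@le_lt_trans _ _ (p + (T - p) / 2)); first by rewrite lerD2l ge_min lexx.
    exact: midpoint_arith.
  have [s [s' [[ss ss' ds s'0] [s01 s1 sz s'z]]]] := smooth_step pq.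
  pose g (z : R * R) := s z.1.
  have tg : test_function T g by apply: smooth2_test => //; exact: smooth2_fst.
  have cg := test_cont tg.
  have Edx : dx g = fun=> 0 := dxE (g := fun=> 0) (fun t x => is_derive_cst (s t) x 1).
  (* A function of t alone with derivative - s: the energy inequality then bounds the integral of s
     times the energy by [E0] times the integral of s. *)
  pose th := antideriv T g; have tth : test_function T th := antideriv_test (ltW T0) tg.
  have Et : dt th = fun p => - g p by apply: dtE => t x; exact: (antideriv_dt T t x cg).
  have Ex : dx th = fun=> 0.
    have c0 : continuous (dx g) by rewrite Edx => z; exact: cvg_cst.
    apply: dxE => t x; have := antideriv_dx T t x cg c0 (test_dx tg).
    by rewrite Edx /antideriv intv_cst mul0r.
  have q0 : 0 <= q by apply: le_trans (ltW pq).
  have dq : 0 < T - q by rewrite subr_gt0.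
  have vth : vanishes_near_final_time T th.
    apply: (vanishes_near_of_late dq) => t x /andP[t1 t2]; rewrite /th /antideriv/=.
    rewrite (intv_eq t2 (g := fun=> 0)); first by rewrite intv_cst mul0r.
    move=> y /andP[ty _]; apply: sz; apply: le_trans ty.
    by rewrite opprB addrCA subrr addr0 in t1.
  have th0 z : strip T z -> 0 <= th z.
    move=> [/= ]; rewrite in_itv/= => /andP[_ tT] _; apply: (intv_ge0 tT) => y _.
    by case/andP: (s01 y).
  have lsm := locbm_cont (smooth_cont ss).
  have Is : intv 0 T s <= q.
    rewrite -(intv_cat q 0 T lsm).
    have -> : intv q T s = 0.
      rewrite (intv_eq (ltW qT) (g := fun=> 0)); first by rewrite intv_cst mul0r.
      by move=> x /andP[qx _]; exact: sz.
    rewrite addr0 -[leRHS](_ : intv 0 q (fun=> 1) = q); last by rewrite intv_cst mul1r subr0.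
    by apply: (le_intv q0 lsm (locbm_cst _)) => x _; case/andP: (s01 x).
  have := energy tth vth th0; rewrite Et Ex.
  have lw2s : locbm (fun t => intv 0 1 (fun x => w2 (t, x))) := locbm2_intv2 0 1 hw2.
  have -> : dint T (fun p => w p ^+ 2 * - g p + 2 / 3 * w p ^+ 3 * 0) =
      - intv 0 T (fun t => s t * intv 0 1 (fun x => w2 (t, x))).
    rewrite -(dint_fst T s hw2) -mulN1r -(dintZ T (-1)); last exact: (locbm2M (locbm2_fst lsm) hw2).
    by apply: (eq_dint (ltW T0)) => t x _; rewrite /w2 /g/=; ring.
  have -> : intv 0 1 (fun x => u0 x ^+ 2 * th (0, x)) = E0 * intv 0 T s.
    rewrite [RHS]mulrC -(intvZ 0 1 (intv 0 T s) (locbm_cont cu2)).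
    by apply: intv_ext => x; rewrite mulrC.
  have Hs : intv 0 p (fun t => intv 0 1 (fun x => w2 (t, x))) <=
      intv 0 T (fun t => s t * intv 0 1 (fun x => w2 (t, x))).
    have lsw := locbmM lsm lw2s.
    rewrite -(intv_cat p 0 T lsw).
    have I0 t : 0 <= intv 0 1 (fun x => w2 (t, x)) by apply: (intv_ge0 ler01) => x _; exact: w2_ge0.
    have : 0 <= intv p T (fun t => s t * intv 0 1 (fun x => w2 (t, x))).
      by apply: (intv_ge0 (ltW pT)) => t _; rewrite mulr_ge0//; case/andP: (s01 t).
    rewrite (intv_eq p0 (f := fun t => s t * _) (g := fun t => intv 0 1 (fun x => w2 (t, x)))).
      by rewrite lerDl.
    by move=> t /andP[_ tp]; rewrite s1// mul1r.
  move=> Hen; have h5 := ler_wpM2l E00 Is.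
  exact: (energy_arith Hen Hs h5 hB).
have -> : intv 0 1 (fun y => potential (p, y)) =
    intv 0 1 f - 2^-1 * intv 0 p (fun t => intv 0 1 (fun x => w2 (t, x))).
  have lE := locbm2_slice1 p locbm2_elapsed.
  have <- : intv 0 1 (fun x => elapsed (p, x)) = intv 0 p (fun t => intv 0 1 (fun x => w2 (t, x))).
    rewrite (intv_fubini 0 p 0 1 hw2); apply: intv_ext => x; apply: elapsedE.
    by rewrite p0 ltW.
  by rewrite -(intvZ 0 1 2^-1 lE) -(intvB 0 1 lff (locbmZ 2^-1 lE)).
exact: (mass_arith D0 e_le).
Qed.

(** Both M + G and M - G are admissible nonnegative weights. Their two upper bounds add up to one
    for 2 M times the mass, where the opposite inequality holds, so both are equalities and the
    pairings with G agree. *)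
Lemma potential_pairing t G LG M : 0 <= t < T -> lip LG G -> (forall x, G (x + 1) = G x) ->
  (forall x, `|G x| <= M) ->
  intv 0 1 (fun y => G y * potential (t, y)) = intv 0 1 (fun y => G y * hopf_lax t f y).
Proof.
move=> /andP[t0 tT] lG pG hM.
move: (t0); rewrite le_eqVlt => /predU1P[<-|t0'].
  apply: intv_ext => y; rewrite hopf_lax0 /potential elapsedE ?lexx ?(ltW T0)//.
  by rewrite intvxx mulr0 subr0.
have mass := potential_mass_ge (introT andP (conj t0 tT)).
have cG := lip_cont lG; have lbG := locbm_cont cG.
have lPt := locbm2_slice1 t locbm2_potential.
have lSt := locbm_cont (lS t0).
have tT' : 0 < t < T by rewrite t0'.
have W a : a = 1 \/ a = -1 ->
    M * intv 0 1 (fun y => potential (t, y)) + a * intv 0 1 (fun y => G y * potential (t, y)) <=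
    M * intv 0 1 (hopf_lax t f) + a * intv 0 1 (fun y => G y * hopf_lax t f y).
  move=> ha; pose H x := M + a * G x.
  have lH : lip (`|a| * LG) H.
    move=> x y; rewrite /H opprD addrACA subrr add0r -mulrBr normrM -mulrA ler_wpM2l//.
  have pH x : H (x + 1) = H x by rewrite /H pG.
  have H0 x : 0 <= H x.
    have := hM x; rewrite ler_norml /H => /andP[h1 h2].
    by case: ha => ->; rewrite ?mul1r ?mulN1r -lerBlDr; lra.
  have E g : locbm g -> intv 0 1 (fun y => H y * g y) =
      M * intv 0 1 g + a * intv 0 1 (fun y => G y * g y).
    move=> lg; rewrite -(intvZ 0 1 M lg) -(intvZ 0 1 a (locbmM lbG lg)).
    rewrite -(intvD 0 1 (locbmZ M lg) (locbmZ a (locbmM lbG lg))).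
    by apply: intv_ext => y; rewrite /H; ring.
  have := potential_weighted_le tT' lH pH H0.
  by rewrite !E.
have M0 : 0 <= M := le_trans (normr_ge0 _) (hM 0).
apply: (pairing_arith (ler_wpM2l M0 mass)); first by apply: (W 1); left.
by apply: (W (-1)); right.
Qed.

(** Adding a multiple of a time cut-off makes psi nonnegative without changing its x-derivative, so
    [weak_space] applies to the sum and to the cut-off separately, and subtracting gives the
    identity for psi. *)
Lemma entropy_hopf_lax psi : test_function T psi -> vanishes_near_final_time T psi ->
  dint T (fun p => psi p * w p) = - dint T (fun p => hopf_lax p.1 f p.2 * dx psi p).
Proof.
move=> tpsi vpsi.
have [d /andP[d0 dT] late] := late_of_vanishes_near T0 (proj1 tpsi) vpsi.
have cpsi := test_cont tpsi; have cdx := test_dx_cont tpsi.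
have [M M0 hM] := strip_bounded cpsi (proj1 tpsi).
have pq : T - d < T - d / 2 by rewrite ltrD2l ltrN2 ltr_pdivrMr// ltr_pMr// ltr1n.
have [s [s' [[ss ss' ds s'0] [s01 s1 sz s'z]]]] := smooth_step pq.
pose h (z : R * R) := M * s z.1; pose g z := psi z + h z.
have s2h : smooth2 h by apply: (@smooth2_fst R (fun t => M * s t)); exact: smoothZ.
have th : test_function T h by exact: smooth2_test.
have dxh : dx h = fun=> 0 := dxE (g := fun=> 0) (fun t x => is_derive_cst (M * s t) x 1).
have dxg : dx g = dx psi.
  apply: dxE => t x; have := is_deriveD (test_dx tpsi t x) (is_derive_cst (M * s t) x 1).
  by rewrite addr0.
have tg : test_function T g.
  split; last first.
    move=> n; have [_ h1] := tpsi; have [_ h2] := th; exact: differentiable_classD.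
  by move=> t x tT; rewrite /g (proj1 tpsi)// (proj1 th).
have d20 : 0 < d / 2 by rewrite divr_gt0.
have late' t : T - d / 2 <= t <= T -> T - d <= t <= T.
  by move=> /andP[t1 ->]; rewrite andbT (le_trans (ltW pq)).
have h_late : vanishes_late T (d / 2) h by move=> t x /andP[t1 _]; rewrite /h /= sz// mulr0.
have g_late : vanishes_late T (d / 2) g.
  by move=> t x tT; rewrite /g h_late// addr0; apply: late; exact: late'.
have h_ge0 z : 0 <= h z by rewrite /h mulr_ge0//; case/andP: (s01 z.1).
have g_ge0 z : strip T z -> 0 <= g z.
  case: z => t x [/= + _]; rewrite in_itv/= => /andP[t0 tT]; rewrite /g.
  have [td|td] := leP t (T - d).
    rewrite /h/= s1// mulr1 -lerBlDr sub0r; apply: (lerNnormlW _).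
    by apply: hM; rewrite t0.
  by rewrite late ?add0r// tT andbT ltW.
have Eg := weak_space d20 tg g_ge0 g_late.
have Eh := weak_space d20 th (fun z _ => h_ge0 z) h_late.
have lh := locbm2M hw (locbm2_cont (test_cont th)).
have lpsi := locbm2M hw (locbm2_cont cpsi).
have Z : dint T (fun p => potential p * dx h p) = 0.
  rewrite dxh -[RHS](mul0r T) -[T in RHS]subr0 -intv_cst; apply: intv_ext => t.
  rewrite -[RHS](mulr1 0) -[1 in RHS]subr0 -intv_cst; apply: intv_ext => x.
  by rewrite mulr0.
have E1 : dint T (fun p => w p * g p) = dint T (fun p => psi p * w p) + dint T (fun p => w p * h p).
  have -> : dint T (fun p => psi p * w p) = dint T (fun p => w p * psi p).
    by apply: (eq_dint (ltW T0)) => t x _; rewrite mulrC.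
  rewrite -(dintD T lpsi lh).
  by apply: (eq_dint (ltW T0)) => t x _; rewrite -mulrDr.
rewrite Eh Z oppr0 addr0 Eg dxg in E1.
rewrite -E1; apply: (congr1 -%R); apply: (intv_eq (ltW T0)) => t /andP[t0 tT].
have [pdx _] := test_dx_test tpsi.
have tTi : t \in `[0, T] by rewrite in_itv/= t0.
have swapmul (a : R * R -> R) : intv 0 1 (fun x => a (t, x) * dx psi (t, x)) =
    intv 0 1 (fun x => dx psi (t, x) * a (t, x)).
  by apply: intv_ext => x; rewrite mulrC.
rewrite (swapmul potential) (swapmul (fun p => hopf_lax p.1 f p.2)).
(* The identification of the potential holds before T; at t = T the x-derivative of psi vanishes. *)
move: tT; rewrite le_eqVlt => /predU1P[tT|tT].
  have Z0 x : dx psi (t, x) = 0.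
    have psi0 y : psi (t, y) = 0 by apply: late; rewrite tT lexx andbT lerBlDr lerDl ltW.
    have := is_derive_congr (test_dx tpsi t x) psi0 erefl => -[_ <-].
    exact: derive_cst.
  by apply: intv_ext => x; rewrite Z0 !mul0r.
have tG := test_dx_test tpsi.
have [LG LG0 hLG] := strip_bounded (test_dx_cont tG) (proj1 (test_dx_test tG)).
have [M' M'0 hM'] := strip_bounded cdx pdx.
apply: (@potential_pairing t (fun x => dx psi (t, x)) LG M').
- by rewrite t0.
- apply: (derive_lip (fun x => test_dx tG t x)) => x; apply: hLG; by rewrite t0 ltW.
- by move=> x; exact: pdx.
- by move=> x; apply: hM'; rewrite t0 ltW.
Qed.

End Entropy.

(** * Perturbed profiles *)

Section RiemannSums.
Context {R : realType}.

Lemma riemann_sum (g : R -> R) (La tau : R) (n : nat) : 0 <= tau -> locbm g ->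
  (forall s t, 0 <= s -> s <= t -> t <= n%:R * tau -> `|g t - g s| <= La * (t - s)) ->
  `|tau * \sum_(i < n) g (i%:R * tau) - intv 0 (n%:R * tau) g| <= n%:R * (La * tau ^+ 2).
Proof.
move=> tau0 lg; elim: n => [|n IH] hg.
  by rewrite big_ord0 !mul0r mulr0 intvxx subrr normr0.
have nn : n%:R * tau <= n.+1%:R * tau by rewrite ler_wpM2r// ler_nat.
have n0 : 0 <= n%:R * tau by rewrite mulr_ge0.
have {}IH := IH (fun s t s0 st tn => hg s t s0 st (le_trans tn nn)).
have E : n.+1%:R * tau - n%:R * tau = tau by rewrite -natr1; ring.
rewrite big_ord_recr/= mulrDr -(intv_cat (n%:R * tau) 0 _ lg) opprD addrACA.
apply: (le_trans (ler_normD _ _)); rewrite -[n.+1%:R]natr1 [leRHS]mulrDl mul1r; apply: lerD => //.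
have -> : tau * g (n%:R * tau) = intv (n%:R * tau) (n.+1%:R * tau) (fun=> g (n%:R * tau)).
  by rewrite intv_cst E mulrC.
rewrite natr1 -(intvB _ _ (locbm_cst _) lg).
have -> : La * tau ^+ 2 = La * tau * (n.+1%:R * tau - n%:R * tau) by rewrite E; ring.
apply: (intv_norm_le nn (locbmB (locbm_cst _) lg)) => s /andP[s1 s2].
have La0 : 0 <= La \/ tau = 0.
  move: tau0; rewrite le_eqVlt => /predU1P[->|tau0]; first by right.
  have := le_trans (normr_ge0 _) (hg (n%:R * tau) (n.+1%:R * tau) n0 nn (lexx _)).
  by rewrite E pmulr_lge0//; left.
rewrite distrC; apply: (le_trans (hg _ _ n0 s1 s2)).
case: La0 => [La0|t0]; first by rewrite ler_wpM2l// -[leRHS]E lerD2r.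
by move: s1 s2; rewrite t0 !mulr0 => s1 s2; rewrite (le_anti (introT andP (conj s2 s1))) subrr mulr0.
Qed.

End RiemannSums.

(** * Layers restarted with a perturbed slope *)

Section Layers.
Context {R : realType}.
Variables (T L M : R) (phi f u0 : R -> R).
Hypotheses (T0 : 0 < T) (lphi : lip L phi) (lf : lip L f) (M0 : 0 <= M).
Hypotheses (df : forall x : R, is_derive x 1 f (u0 x)) (pf : forall x, f (x + 1) = f x).
Hypothesis sup : forall x h, f x + u0 x * h - T^-1 / 2 * h ^+ 2 <= f (x + h).
Hypothesis sd : forall x h, f (x + h) + f (x - h) - 2 * f x <= M * h ^+ 2.
Hypothesis fphi : forall x, f x <= phi x.
Hypothesis Sfphi : forall y, hopf_lax T phi y <= hopf_lax T f y.
Hypothesis pphi : forall x, phi (x + 1) = phi x.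

Local Notation S := (fun t => hopf_lax t f).

Let L0 : 0 <= L.
Proof. by have := le_trans (normr_ge0 _) (lf 1 0); rewrite subr0 normr1 mulr1. Qed.

Lemma hopf_lax_time s t x : 0 <= s -> s <= t ->
  S t x <= S s x /\ S s x <= S t x + L ^+ 2 / 2 * (t - s).
Proof.
move=> s0; rewrite le_eqVlt => /predU1P[<-|st].
  by split; rewrite ?subrr ?mulr0 ?addr0.
have r0 : 0 < t - s by rewrite subr_gt0.
have E : s + (t - s) = t by rewrite addrC subrK.
split.
  have := hopf_lax_line x 0 s0 r0 lf.
  by rewrite E mul0r addr0 expr0n/= !mul0r addr0.
have h1 := hopf_lax_semigroup x s0 (ltW r0) lf; rewrite E in h1.
have h2 := hopf_lax_ge_self x (ltW r0) (hopf_lax_lip s0 lf).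
by move: h1 h2; move: (hopf_lax _ (hopf_lax _ _) _) => z; lra.
Qed.

(** The other half of the semigroup property, read off from [hopf_lax_line] along the segment that
    joins a competitor a at time t to y at time T. *)
Lemma hopf_lax_restart t y : 0 <= t < T -> S T y <= hopf_lax (T - t) (S t) y.
Proof.
move=> /andP[t0 tT]; have r0 : 0 < T - t by rewrite subr_gt0.
apply: hopf_lax_glb => // a.
have := hopf_lax_line a ((y - a) / (T - t)) t0 r0 lf.
have -> : a + (y - a) / (T - t) * (T - t) = y by rewrite divfK ?gt_eqF// addrC subrK.
have -> : t + (T - t) = T by rewrite addrC subrK.
have -> // : ((y - a) / (T - t)) ^+ 2 * (T - t) / 2 = (y - a) ^+ 2 / (2 * (T - t)).
by field; rewrite gt_eqF.
Qed.

(* The perturbation [b * H] need not be periodic, but the restarted evolution minus [b * H] is. *)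
Lemma layer_energy t b H h K : 0 <= t < T -> (forall x : R, is_derive x 1 H (h x)) ->
  continuous h -> (forall x, h (x + 1) = h x) -> (forall x, `|h x| <= K) ->
  exists u, [/\ forall x : R, is_derive x 1 (S t) (u x), continuous u, forall x, u (x + 1) = u x &
  intv 0 1 (hopf_lax T phi) - b * (T - t) * intv 0 1 (fun x => u x * h x) - T / 2 * b ^+ 2 * K ^+ 2 <=
  intv 0 1 (fun x => hopf_lax (T - t) (fun x => S t x + b * H x) x - b * H x)].
Proof.
move=> tT dH ch ph hK; have [u [du cu pu mu]] := hopf_lax_C11 tT M0 lf df pf sup sd.
exists u; split=> //; case/andP: (tT) => t0 tT'.
have r0 : 0 <= T - t by rewrite subr_ge0 ltW.
pose F x := S t x + b * H x; pose F' x := u x + b * h x.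
have lSt := hopf_lax_lip t0 lf.
have lH : lip K H := derive_lip dH hK.
have lF : lip (L + `|b| * K) F by apply: lipD => //; exact: lipZ.
have dF (x : R) : is_derive x 1 F (F' x) := is_deriveD (du x) (is_deriveZ b (dH x)).
have cF' : continuous F' by move=> x; apply: cvgD; [exact: cu|apply: cvgM; [exact: cvg_cst|exact: ch]].
have pF' x : F' (x + 1) = F' x by rewrite /F' pu ph.
have K0 : 0 <= K := le_trans (normr_ge0 _) (hK 0).
(* The perturbed profile only has the lower energy bound, while [S t] has the upper one because its
   characteristics do not cross before T. In the difference of the two, the squares of u cancel and
   leave the cross term in b and a remainder of order b^2. *)
have h1 := hopf_lax_energy_ge r0 lF dF cF' pF'.
have h2 := hopf_lax_energy_le r0 lSt du cu pu mu.
have m1 := locbm_cont (lip_cont (hopf_lax_lip r0 lSt)).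
have m2 := locbm_cont (lip_cont lSt).
have m3 := locbm_cont (lip_cont (hopf_lax_lip r0 lF)).
have m4 := locbm_cont (lip_cont lF).
have m5 := locbm_cont (lip_cont (hopf_lax_lip (ltW T0) lphi)).
have mu' := locbm_cont cu; have mh := locbm_cont ch.
have h3 : intv 0 1 (hopf_lax T phi) <= intv 0 1 (hopf_lax (T - t) (S t)).
  apply: (le_intv ler01 m5 m1) => y _; apply: (le_trans (Sfphi y)); exact: hopf_lax_restart.
have h4 : intv 0 1 (fun x => hopf_lax (T - t) F x - b * H x) =
    intv 0 1 (fun x => hopf_lax (T - t) F x - F x) + intv 0 1 (S t).
  rewrite -(intvD 0 1 (locbmB m3 m4) m2); apply: intv_ext => x.
  by rewrite /F; ring.
have h5 : intv 0 1 (fun x => F' x ^+ 2) = intv 0 1 (fun x => u x ^+ 2) +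
    2 * b * intv 0 1 (fun x => u x * h x) + b ^+ 2 * intv 0 1 (fun x => h x ^+ 2).
  have n1 : locbm (fun x => u x ^+ 2) := locbmM mu' mu'.
  have n2 := locbmM mu' mh; have n3 : locbm (fun x => h x ^+ 2) := locbmM mh mh.
  rewrite -(intvZ 0 1 (2 * b) n2) -(intvZ 0 1 (b ^+ 2) n3) -(intvD 0 1 n1 (locbmZ _ n2)).
  rewrite -(intvD 0 1 (locbmD n1 (locbmZ _ n2)) (locbmZ _ n3)).
  by apply: intv_ext => x; rewrite /F'; ring.
have h6 : intv 0 1 (fun x => h x ^+ 2) <= K ^+ 2.
  rewrite -[leRHS]mulr1 -[X in _ * X]subr0 -intv_cst.
  have n3 : locbm (fun x => h x ^+ 2) := locbmM mh mh.
  apply: (le_intv ler01 n3 (locbm_cst _)) => x _.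
  by rewrite /= -(real_normK (num_real (h x))) ler_sqr ?nnegrE.
rewrite (intvB 0 1 m1 m2) in h2; rewrite h5 in h1.
rewrite -/F h4; move: h1 h2 h3 h6.
move: (intv 0 1 (fun x => hopf_lax (T - t) F x - F x)) (intv 0 1 (S t)) (intv 0 1 (hopf_lax T phi)).
move: (intv 0 1 (hopf_lax (T - t) (S t))) (intv 0 1 (fun x => u x ^+ 2)).
move: (intv 0 1 (fun x => u x * h x)) (intv 0 1 (fun x => h x ^+ 2)) => A1 A2 A3 A4 A5 A6 A7.
move=> h1 h2 h3 h6.
have h7 : (T - t) / 2 * b ^+ 2 * A2 <= T / 2 * b ^+ 2 * K ^+ 2.
  have b0 := sqr_ge0 b; have K20 := sqr_ge0 K.
  apply: (@le_trans _ _ ((T - t) / 2 * b ^+ 2 * K ^+ 2)).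
    by rewrite ler_wpM2l// mulr_ge0// divr_ge0.
  by have bK := mulr_ge0 b0 K20; have := mulr_ge0 t0 bK; lra.
by lra.
Qed.

Section Step.
Variables (tau : R) (b : R) (n : nat) (H h : nat -> R -> R) (K Lx : R).
Hypotheses (tau0 : 0 < tau) (dH : forall i (x : R), is_derive x 1 (H i) (h i x)).
Hypotheses (hK : forall i x, `|h i x| <= K) (lh : forall i, lip Lx (h i)).
Hypothesis ph : forall i x, h i (x + 1) = h i x.

(* Layer i follows the Hopf-Lax evolution of f until time i tau and then that of the profile perturbed
   by [b * H i], from which [b * H i] is subtracted again.  Averaged over i, the slopes of the [H i]
   with i <= j form a Riemann sum. *)
Definition layer (i j : nat) x := if (j <= i)%N then S (j%:R * tau) x else
  hopf_lax ((j - i)%:R * tau) (fun x => S (i%:R * tau) x + b * H i x) x - b * H i x.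

Let tn (j : nat) : 0 <= j%:R * tau. Proof. by rewrite mulr_ge0// ltW. Qed.
Let lS (j : nat) : lip L (S (j%:R * tau)). Proof. exact: hopf_lax_lip (tn j) lf. Qed.
Let lF i : lip (L + `|b| * K) (fun x => S (i%:R * tau) x + b * H i x).
Proof. by apply: lipD => //; apply: lipZ; exact: derive_lip (dH i) (hK i). Qed.
Let K0 : 0 <= K. Proof. exact: le_trans (normr_ge0 _) (hK 0 0). Qed.

Lemma layer_lip i j : lip (L + 2 * (`|b| * K)) (layer i j).
Proof.
move=> x y; rewrite /layer; case: ifP => _.
  by apply: (lip_le _ (lS j)); rewrite lerDl mulr_ge0// mulr_ge0.
have := lipD (hopf_lax_lip (tn (j - i)) (lF i)) (lipZ (- b) (derive_lip (dH i) (hK i))).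
rewrite normrN (_ : L + `|b| * K + `|b| * K = L + 2 * (`|b| * K)); last by ring.
by move=> h1; rewrite -!mulNr; exact: h1.
Qed.

Lemma primitive_shift i : exists m, forall x, H i (x + 1) = H i x + m.
Proof.
exists (H i 1 - H i 0) => x.
pose g x := H i (x + 1) - H i x.
have dg (x0 : R) : is_derive x0 1 g 0.
  have dl : is_derive x0 1 (fun x : R => x + 1) 1.
    have := is_deriveD (is_derive_id x0 1) (is_derive_cst (1 : R) x0 1).
    by move/is_derive_congr; apply=> //; rewrite addr0.
  have := is_deriveB (@is_derive1_comp R (H i) _ x0 _ _ (dH i _) dl) (dH i x0).
  by rewrite ph mulr1 subrr.
have := derive_eq0_cst dg x 0; rewrite /g add0r => <-.
by rewrite addrCA subrr addr0.
Qed.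

(** Over one period [H i] grows by a constant; the Hopf-Lax evolution commutes with adding
    constants, and subtracting [b * H i] removes this one. *)
Lemma layer_periodic i j x : layer i j (x + 1) = layer i j x.
Proof.
rewrite /layer; case: ifP => ji; first exact: hopf_lax_periodic.
have [m hm] := primitive_shift i.
have r0 : 0 < (j - i)%:R * tau by rewrite mulr_gt0// ltr0n subn_gt0 ltnNge ji.
set F := fun x => S (i%:R * tau) x + b * H i x.
have pF y : F (y + 1) = F y + b * m.
  by rewrite /F hm (hopf_lax_periodic y (tn i) lf pf) mulrDr addrA.
have lFF : lip (L + `|b| * K) F := lF i.
suff -> : hopf_lax ((j - i)%:R * tau) F (x + 1) = hopf_lax ((j - i)%:R * tau) F x + b * m.
  by rewrite hm; ring.
apply/eqP; rewrite eq_le; apply/andP; split.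
  have [a ->] := hopf_lax_attained r0 lFF x.
  have := hopf_lax_le r0 lFF (x + 1) (a + 1); rewrite pF.
  by rewrite (_ : x + 1 - (a + 1) = x - a); [lra|ring].
have [a ->] := hopf_lax_attained r0 lFF (x + 1).
have h1 := hopf_lax_le r0 lFF x (a - 1).
have h2 := pF (a - 1); rewrite subrK in h2.
by move: h1; rewrite h2 (_ : x - (a - 1) = x + 1 - a); [lra|ring].
Qed.

(** The line inequality for the restarted profile yields c^2 tau/2. Subtracting [b * H i] at the two
    ends of the step adds - b c tau h up to a Taylor remainder. A layer with i > j has not been
    restarted yet and has no linear term. *)
Lemma layer_step i j x c C : `|c| <= C ->
  layer i j.+1 (x + c * tau) <= layer i j x + c ^+ 2 / 2 * tau +
    (i <= j)%N%:R * (- b * c * tau * h i x + `|b| * Lx * C ^+ 2 * tau ^+ 2).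
Proof.
move=> cC; rewrite /layer.
have [ij|ij] := leqP i j; last first.
  rewrite (ltnW ij) mul0r addr0 -natr1 mulrDl mul1r.
  by have := hopf_lax_line x c (tn j) tau0 lf; lra.
rewrite mul1r subSn// -natr1 mulrDl mul1r.
set F := fun x => _ + b * H i x.
(* At j = i both branches agree, since the perturbation is added and subtracted after zero time;
   hence the linear term is already present for i = j. *)
have E : (if (j <= i)%N then S (j%:R * tau) x else hopf_lax ((j - i)%:R * tau) F x - b * H i x) =
    hopf_lax ((j - i)%:R * tau) F x - b * H i x.
  case: ifP => // ji; have -> : j = i by apply/eqP; rewrite eqn_leq ji.
  by rewrite subnn mul0r hopf_lax0 /F addrK.
rewrite E.
have h1 := hopf_lax_line x c (tn (j - i)) tau0 (lF i); rewrite -/F in h1.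
have h2 := taylor_lip x (c * tau) (dH i) (lh i).
have h3 : `|b * (H i (x + c * tau) - H i x - c * tau * h i x)| <= `|b| * Lx * C ^+ 2 * tau ^+ 2.
  rewrite normrM (_ : `|b| * Lx * C ^+ 2 * tau ^+ 2 = `|b| * (Lx * (C ^+ 2 * tau ^+ 2))); last by ring.
  rewrite ler_wpM2l//; apply: (le_trans h2).
  have Lx0 : 0 <= Lx by have := le_trans (normr_ge0 _) (lh i 1 0); rewrite subr0 normr1 mulr1.
  rewrite ler_wpM2l// exprMn ler_wpM2r ?sqr_ge0// -(real_normK (num_real c)).
  by rewrite ler_sqr ?nnegrE// (le_trans _ cC).
rewrite -normrN in h3; have {}h3 := le_trans (ler_norm _) h3.
move: h1 h3; move: (hopf_lax _ _ _) (hopf_lax _ _ _) => A1 A2; lra.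
Qed.

(** Slice 0 is phi itself, as the condition Psi(0, .) = 0 requires, whereas the layers start from
    phi^T. The jump to the layers goes downwards because phi^T <= phi, so it preserves the
    subsolution inequality. *)
Definition profile (j : nat) : R -> R :=
  if j is j'.+1 then fun x => n%:R^-1 * \sum_(i < n) layer i j x else phi.

Hypothesis n0 : (0 < n)%N.
Let nR : 0 < n%:R :> R. Proof. by rewrite ltr0n. Qed.

Let average_le (a c : 'I_n -> R) : (forall i, a i <= c i) ->
  n%:R^-1 * \sum_(i < n) a i <= n%:R^-1 * \sum_(i < n) c i.
Proof. by move=> ac; rewrite ler_pM2l ?invr_gt0//; apply: ler_sum => i _; exact: ac. Qed.

Let average_cst (a : R) : n%:R^-1 * \sum_(i < n) a = a.
Proof. by rewrite sumr_const card_ord -[a *+ n]mulr_natl mulKf// gt_eqF. Qed.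

Lemma profile_periodic j x : profile j (x + 1) = profile j x.
Proof.
by case: j => [|j] //=; congr (_ * _); apply: eq_bigr => i _; exact: layer_periodic.
Qed.

Lemma profile_lip j : lip (L + 2 * (`|b| * K)) (profile j).
Proof.
case: j => [|j] /=; first by apply: lip_le lphi; rewrite lerDl mulr_ge0// mulr_ge0.
move=> x y; rewrite -mulrBr -sumrB normrM ger0_norm ?invr_ge0//.
rewrite -[leRHS]average_cst ler_pM2l ?invr_gt0//.
by apply: (le_trans (ler_norm_sum _ _ _)); apply: ler_sum => i _; exact: layer_lip.
Qed.

(** Average of [layer_step] over i. The slopes of the layers with i <= j, multiplied by b/n, form
    the Riemann sum that approximates eps Phi at time j tau. *)
Lemma profile_step j x c C : (j < n)%N -> `|c| <= C ->
  profile j.+1 (x + c * tau) <= profile j x + c ^+ 2 / 2 * tau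
    - b * c * tau * (n%:R^-1 * \sum_(i < j.+1) h i x) + `|b| * Lx * C ^+ 2 * tau ^+ 2.
Proof.
move=> jn cC.
have C0 : 0 <= C by exact: le_trans cC.
have Lx0 : 0 <= Lx by have := le_trans (normr_ge0 _) (lh 0 1 0); rewrite subr0 normr1 mulr1.
have avg : n%:R^-1 * \sum_(i < n) layer i j x <= profile j x.
  case: j {jn} => [|j] //=.
  rewrite -[leRHS]average_cst; apply: average_le => i.
  by rewrite /layer leq0n mul0r hopf_lax0.
have average_split (A B : R) (a g : 'I_n -> R) : n%:R^-1 * \sum_i (a i + A + B * g i) =
    n%:R^-1 * \sum_i a i + A + B * (n%:R^-1 * \sum_i g i).
  by rewrite !big_split/= !mulrDr average_cst -mulr_sumr mulrCA.
apply: (@le_trans _ _ (n%:R^-1 * \sum_(i < n) (layer i j x + (c ^+ 2 / 2 * tau +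
   `|b| * Lx * C ^+ 2 * tau ^+ 2) + - (b * c * tau) * ((i < j.+1)%N%:R * h i x)))).
  apply: average_le => i; apply: (le_trans (layer_step i j x cC)).
  rewrite ltnS; case: (i <= j)%N; rewrite ?mul1r ?mul0r; first lra.
  by rewrite mulr0 !addr0 addrA lerDl !mulr_ge0// ?exprn_ge0// ltW.
rewrite average_split.
have -> : \sum_(i < n) ((i < j.+1)%N%:R * h i x) = \sum_(i < j.+1) h i x.
  rewrite (big_ord_widen n (fun i => h i x))// [RHS]big_mkcond/=; apply: eq_bigr => i _.
  by case: ifP; rewrite ?mul1r ?mul0r.
by move: avg; move: (n%:R^-1 * _) (n%:R^-1 * _) => A1 A2; lra.
Qed.

End Step.

End Layers.

(** * The weight psi/(T - t) and its time integral *)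

Section Weight.
Context {R : realType}.

(** Division by e and passage to the limit from both sides: a first-order bound valid for both signs
    is an identity. *)
Lemma eq_of_linear_bound (a b C : R) : 0 <= C ->
  (forall e, `|e| <= 1 -> e * a <= e * b + C * e ^+ 2) -> a = b.
Proof.
move=> C0 H; have S e : 0 < e -> exists2 x, 0 < x <= 1 & C * x <= e.
  move=> e0; exists (Num.min 1 (e / (C + 1))).
    by rewrite lt_min ltr01 divr_gt0 ?ltr_wpDl//= ge_min lexx.
  apply: (@le_trans _ _ ((C + 1) * Num.min 1 (e / (C + 1)))).
    by rewrite ler_wpM2r ?lerDl// le_min ler01 divr_ge0 ?addr_ge0// ltW.
  by rewrite mulrC -ler_pdivlMr ?ltr_wpDl// ge_min lexx orbT.
apply/eqP; rewrite eq_le; apply/andP; split; apply/ler_addgt0Pr => e /S[x /andP[x0 x1] hx].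
  rewrite -(ler_pM2l x0); have := H x; rewrite gtr0_norm// => /(_ x1).
  have := ler_wpM2l (ltW x0) hx; lra.
rewrite -(ler_pM2l x0); have := H (- x); rewrite normrN gtr0_norm// => /(_ x1).
have := ler_wpM2l (ltW x0) hx; lra.
Qed.

Lemma clamp_lip (T : R) : lip 1 (clamp T).
Proof.
move=> x y; apply: (le_trans (pos_lip _ _)); rewrite mul1r.
have -> : T - pos (T - x) - (T - pos (T - y)) = pos (T - y) - pos (T - x) by ring.
by rewrite mul1r; apply: (le_trans (pos_lip _ _)); rewrite mul1r (_ : T - y - (T - x) = x - y)//; ring.
Qed.

Lemma locbm_sum (n : nat) (F : nat -> R -> R) : (forall i, locbm (F i)) ->
  locbm (fun x => \sum_(i < n) F i x).
Proof.
move=> hF; elim: n => [|n IH].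
  by under eq_fun do rewrite big_ord0; exact: locbm_cst.
by under eq_fun do rewrite big_ord_recr/=; exact: locbmD.
Qed.

Lemma intv_sum (n : nat) (a b : R) (F : nat -> R -> R) : (forall i, locbm (F i)) ->
  intv a b (fun x => \sum_(i < n) F i x) = \sum_(i < n) intv a b (F i).
Proof.
move=> hF; elim: n => [|n IH].
  by rewrite big_ord0 (intv_ext _ _ (g := fun=> 0)) ?intv_cst ?mul0r// => x; rewrite big_ord0.
rewrite big_ord_recr/= -IH -(intvD a b (locbm_sum n hF) (hF n)).
by apply: intv_ext => x; rewrite big_ord_recr.
Qed.

Variables (T d : R) (psi : R * R -> R).
Hypotheses (T0 : 0 < T) (d0 : 0 < d) (tpsi : test_function T psi) (late : vanishes_late T d psi).

(** This is the maximum of T - t and d. It equals T - t up to time T - d, after which psi vanishes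
    on the strip, and it stays away from zero, so the quotient is defined on the whole plane and its
    time factor is Lipschitz. *)
Let den (t : R) := d + pos (T - t - d).

Let den_ge t : d <= den t. Proof. by rewrite lerDl pos_ge0. Qed.
Let den_gt0 t : 0 < den t. Proof. exact: lt_le_trans (den_ge t). Qed.
Let iden_le t : 0 <= (den t)^-1 <= d^-1.
Proof. by rewrite invr_ge0 (ltW (den_gt0 t)) lef_pV2 ?posrE ?den_gt0 ?den_ge. Qed.

Let den_lip t s : `|den t - den s| <= `|t - s|.
Proof.
rewrite /den opprD addrACA subrr add0r; apply: (le_trans (pos_lip _ _)).
by rewrite mul1r (_ : T - t - d - (T - s - d) = - (t - s)) ?normrN//; ring.
Qed.

Let iden_lip : lip (d ^- 2) (fun t => (den t)^-1).
Proof.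
move=> t s; have -> : (den t)^-1 - (den s)^-1 = (den t)^-1 * (den s)^-1 * (den s - den t).
  by field; rewrite !gt_eqF.
rewrite normrM distrC; apply: ler_pM => //.
have /andP[a0 a1] := iden_le t; have /andP[b0 b1] := iden_le s.
by rewrite ger0_norm ?mulr_ge0// expr2 invfM ler_pM.
Qed.

Definition weight (p : R * R) := psi p * (den p.1)^-1.

Let cont_over (g : R * R -> R) : continuous g -> continuous (fun p => g p * (den p.1)^-1).
Proof.
move=> cg p; apply: cvgM; first exact: cg.
apply: (@continuous_comp _ _ _ (fun p : R * R => p.1) (fun t => (den t)^-1)); first exact: cvg_fst.
exact: (lip_cont iden_lip).
Qed.

Lemma weight_cont : continuous weight.
Proof. exact: cont_over (test_cont tpsi). Qed.

Lemma weight_periodic : space_periodic T weight.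
Proof. by move=> t x tT; rewrite /weight (proj1 tpsi). Qed.

Lemma weightE (t x : R) : 0 <= t <= T -> (T - t) * weight (t, x) = psi (t, x).
Proof.
move=> /andP[t0 tT]; rewrite /weight /=.
have [td|td] := leP t (T - d).
  have tlt : 0 < T - t by rewrite subr_gt0 (le_lt_trans td)// ltrBlDr ltrDl.
  rewrite /den (_ : pos (T - t - d) = T - t - d); last by rewrite pos_id// subr_ge0 lerBrDl -lerBrDr.
  rewrite (_ : d + (T - t - d) = T - t); last by ring.
  by rewrite mulrCA mulfV ?mulr1// gt_eqF.
by rewrite late ?mul0r ?mulr0// tT andbT ltW.
Qed.

(** At t = T the quotient is 0 by the convention for division by zero, and the weight vanishes there
    too because psi does. *)
Lemma weight_quotient (t x : R) : 0 <= t <= T -> psi (t, x) / (T - t) = weight (t, x).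
Proof.
move=> tT; have [E|E] := eqVneq (T - t) 0.
  rewrite E invr0 mulr0 /weight/= late ?mul0r//.
  by case/andP: tT => _ ->; rewrite andbT lerBlDr -lerBlDl E ltW.
by rewrite -(weightE x tT) mulrAC mulfV// mul1r.
Qed.

Let over_bound M (g : R * R -> R) t x : `|g (t, x)| <= M -> `|g (t, x) * (den t)^-1| <= M / d.
Proof.
move=> hg; have /andP[a0 a1] := iden_le t.
by rewrite normrM ler_pM// ger0_norm.
Qed.

Lemma weight_bounds : exists K Kt Kx Lx, [/\ 0 <= K, 0 <= Kt & 0 <= Kx] /\
  [/\ forall t x, 0 <= t <= T -> `|weight (t, x)| <= K,
      forall s t x, 0 <= s -> s <= t -> t <= T -> `|weight (t, x) - weight (s, x)| <= Kt * (t - s),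
      forall t, 0 <= t <= T -> lip Kx (fun x => weight (t, x)) &
      exists k' : R * R -> R, forall t, 0 <= t <= T ->
        (forall x : R, is_derive x 1 (fun x => weight (t, x)) (k' (t, x))) /\ lip Lx (fun x => k' (t, x))].
Proof.
have tdx := test_dx_test tpsi; have tdxx := test_dx_test tdx.
have pdt : space_periodic T (dt psi).
  by apply: (space_periodic_dt T0 (proj1 tpsi)); [exact: (test_dt_cont tpsi)|exact: (test_dt tpsi)].
have [M M0 hM] := strip_bounded (test_cont tpsi) (proj1 tpsi).
have [Mt Mt0 hMt] := strip_bounded (test_dt_cont tpsi) pdt.
have [Mx Mx0 hMx] := strip_bounded (test_dx_cont tpsi) (proj1 tdx).
have [Mxx Mxx0 hMxx] := strip_bounded (test_dx_cont tdx) (proj1 tdxx).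
have dover (g : R * R -> R) (t x l : R) : is_derive x 1 (fun x => g (t, x)) l ->
    is_derive x 1 (fun x => g (t, x) * (den t)^-1) (l * (den t)^-1).
  move/(is_deriveZ (den t)^-1)/is_derive_congr; apply=> [y|].
    by change ((den t)^-1 * g (t, y) = g (t, y) * (den t)^-1); rewrite mulrC.
  by change ((den t)^-1 * l = l * (den t)^-1); rewrite mulrC.
exists (M / d), (Mt / d + M * d ^- 2), (Mx / d), (Mxx / d); split.
  by split; rewrite ?addr_ge0 ?mulr_ge0 ?invr_ge0 ?exprn_ge0 ?(ltW d0).
split.
- by move=> t x tT; apply: (over_bound (g := psi)); exact: hM.
- move=> s t x s0 st tT; rewrite /weight/=.
  have sT : 0 <= s <= T by rewrite s0 (le_trans st).
  have -> : psi (t, x) / den t - psi (s, x) / den s =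
      (psi (t, x) - psi (s, x)) * (den t)^-1 + psi (s, x) * ((den t)^-1 - (den s)^-1) by ring.
  apply: (le_trans (ler_normD _ _)); rewrite [leRHS]mulrDl; apply: lerD.
    have /andP[a0 a1] := iden_le t.
    rewrite normrM (ger0_norm a0) mulrAC ler_pM//.
    have cdt := cont_slice2 x (test_dt_cont tpsi).
    have <- := intv_FTC s t cdt (fun y => test_dt tpsi y x).
    apply: (intv_norm_le st (locbm_cont cdt)) => y /andP[sy yt]; apply: hMt.
    by rewrite (le_trans s0 sy) (le_trans yt tT).
  rewrite normrM -mulrA ler_pM//; first exact: hM.
  by apply: (le_trans (iden_lip t s)); rewrite ger0_norm ?subr_ge0.
- move=> t tT; apply: (derive_lip (fun x => dover psi t x _ (test_dx tpsi t x))) => x.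
  by apply: (over_bound (g := dx psi)); exact: hMx.
- exists (fun p => dx psi p * (den p.1)^-1) => t tT; split.
    by move=> x; exact: dover (test_dx tpsi t x).
  apply: (derive_lip (fun x => dover (dx psi) t x _ (test_dx tdx t x))) => x.
  by apply: (over_bound (g := dx (dx psi))); exact: hMxx.
Qed.

Definition weight_integral (p : R * R) := intv 0 p.1 (fun s => weight (s, p.2)).

Lemma weight_integral_cont : continuous weight_integral.
Proof.
have -> : weight_integral = fun p => - intv p.1 0 (fun s => weight (s, p.2)).
  by apply/funext => p; exact: intvC.
by move=> p; apply: cvgN; exact: (@cont_antideriv _ weight 0 weight_cont).
Qed.

Lemma weight_integral_periodic : space_periodic T weight_integral.
Proof.
move=> t x; rewrite in_itv/= => /andP[t0 tT]; apply: (intv_eq t0) => s /andP[s0 st].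
by apply: weight_periodic; rewrite in_itv/= s0 (le_trans st).
Qed.

Lemma weight_integral_lip K Kx : 0 <= K -> 0 <= Kx ->
  (forall t x, 0 <= t <= T -> `|weight (t, x)| <= K) ->
  (forall t, 0 <= t <= T -> lip Kx (fun x => weight (t, x))) ->
  forall t s x y, 0 <= t <= T -> 0 <= s <= T ->
  `|weight_integral (t, x) - weight_integral (s, y)| <= (K + Kx * T) * (`|t - s| + `|x - y|).
Proof.
move=> K0 Kx0 hK hKx.
have lw x : locbm (fun s => weight (s, x)) := locbm_cont (cont_slice2 x weight_cont).
have A t s x : 0 <= s -> s <= t -> t <= T -> `|weight_integral (t, x) - weight_integral (s, x)| <= K * (t - s).
  move=> s0 st tT; rewrite /weight_integral/= -(intv_cat s 0 t (lw x)) addrAC subrr add0r.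
  apply: (intv_norm_le st (lw x)) => z /andP[sz zt]; apply: hK.
  by rewrite (le_trans s0 sz) (le_trans zt tT).
move=> t s x y /andP[t0 tT] /andP[s0 sT].
have h1 : `|weight_integral (t, x) - weight_integral (s, x)| <= K * `|t - s|.
  have [st|/ltW ts] := leP s t; first by rewrite (ger0_norm (_ : 0 <= t - s)) ?subr_ge0// A.
  by rewrite distrC (distrC t s) (ger0_norm (_ : 0 <= s - t)) ?subr_ge0// A.
have h2 : `|weight_integral (s, x) - weight_integral (s, y)| <= Kx * T * `|x - y|.
  rewrite /weight_integral/= -(intvB 0 s (lw x) (lw y)).
  apply: (@le_trans _ _ (Kx * `|x - y| * (s - 0))).
    apply: (intv_norm_le s0 (locbmB (lw x) (lw y))) => z /andP[z0 zs].
    by apply: hKx; rewrite z0 (le_trans zs).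
  by rewrite subr0 mulrAC ler_wpM2r// ler_wpM2l.
have -> : weight_integral (t, x) - weight_integral (s, y) = (weight_integral (t, x) - weight_integral (s, x)) +
    (weight_integral (s, x) - weight_integral (s, y)) by ring.
apply: (le_trans (ler_normD _ _)).
have p1 := mulr_ge0 (mulr_ge0 Kx0 (ltW T0)) (normr_ge0 (t - s)).
have p2 := mulr_ge0 K0 (normr_ge0 (x - y)).
by move: h1 h2 p1 p2; move: `|t - s| `|x - y| => a b; lra.
Qed.

Lemma weight_integral_sum K Kt x j (tau : R) : 0 <= tau -> 0 <= Kt -> j.+1%:R * tau <= T ->
  (forall t x, 0 <= t <= T -> `|weight (t, x)| <= K) ->
  (forall s t x, 0 <= s -> s <= t -> t <= T -> `|weight (t, x) - weight (s, x)| <= Kt * (t - s)) ->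
  `|tau * \sum_(i < j.+1) weight (i%:R * tau, x) - weight_integral (j%:R * tau, x)| <= (Kt * T + K) * tau.
Proof.
move=> tau0 Kt0 jT hK hKt.
have jt : j%:R * tau <= j.+1%:R * tau by rewrite ler_wpM2r// ler_nat.
have jT' := le_trans jt jT.
have j0 : 0 <= j%:R * tau by rewrite mulr_ge0.
have lw : locbm (fun s => weight (s, x)) := locbm_cont (cont_slice2 x weight_cont).
have H := riemann_sum (n := j) tau0 lw (fun s t s0 st tj => hKt s t x s0 st (le_trans tj jT')).
(* The sum runs up to i = j, one term more than the Riemann sum over [0, j tau]; this extra term
   costs K tau. *)
rewrite big_ord_recr/= mulrDr addrAC mulrDl; apply: (le_trans (ler_normD _ _)); apply: lerD.
  apply: (le_trans H); rewrite expr2 (_ : j%:R * (Kt * (tau * tau)) = Kt * (j%:R * tau) * tau); last by ring.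
  by rewrite ler_wpM2r// ler_wpM2l.
by rewrite normrM (ger0_norm tau0) mulrC ler_wpM2r// hK// j0.
Qed.

End Weight.

(** * First variation of the certificate and the value of the flux pairing *)

Section FluxWeight.
Context {R : realType}.

Fact profile_integral_arith (I P s e D Z a : R) : I + e * s - Z * e ^+ 2 <= P ->
  `|s - D| <= a -> `|e| <= 1 -> I + e * D - Z * e ^+ 2 - a <= P.
Proof.
move=> h1 h2 h3; have : `|e * (s - D)| <= a.
  by rewrite normrM; apply: (le_trans _ h2); rewrite ler_piMl.
rewrite -normrN => /(le_trans (ler_norm _)); rewrite mulrBr; lra.
Qed.

Fact profile_rearrange (I s e K t : R) :
  I + e * s - t / 2 * t ^+ 2 * K ^+ 2 * e ^+ 2 <= I - t / 2 * (e * t) ^+ 2 * K ^+ 2 + e * s.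
Proof. by rewrite exprMn; lra. Qed.

Fact layer_lower_arith (I b r w B Z : R) : r * w = - B -> I - b * r * w - Z = I + b * B - Z.
Proof. by move=> E; rewrite -mulrA E mulrN opprK. Qed.

Fact flux_weight_arith (e l I U eta T D Z a g : R) : e * l <= I - U + eta * T + g ->
  I + e * D - Z * e ^+ 2 - a <= U -> eta * T + a <= g -> e * l <= e * - D + Z * e ^+ 2 + 2 * g.
Proof. lra. Qed.

Fact eta_arith (C A X T La tau : R) : (C * (A * tau) + X * tau) * T + La * T * tau <=
  ((C * A + X) * T + La * T) * tau.
Proof. lra. Qed.

Fact step_arith (U P c tau e s A X C L eta Ph : R) : 0 < tau ->
  U <= P + c ^+ 2 / 2 * tau - e * c * tau * s + X -> `|s - Ph| <= A -> `|e| <= 1 -> `|c| <= C ->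
  0 <= A -> X <= tau * L -> eta = C * A + L ->
  U <= P + tau * (c ^+ 2 / 2 - c * (e * Ph) + eta).
Proof.
move=> tau0 h1 h2 h3 h4 A0 h5 ->.
have h6 : `|e * c * (s - Ph)| <= C * A.
  rewrite 2!normrM; apply: ler_pM => //.
  by rewrite -[C]mul1r ler_pM.
rewrite -normrN in h6; have {}h6 := le_trans (ler_norm _) h6.
have := ler_wpM2l (ltW tau0) h6; lra.
Qed.

Variables (T d L M Lv : R) (phi f u0 v0 : R -> R) (psi : R * R -> R).
Hypotheses (T0 : 0 < T) (lphi : lip L phi) (lf : lip L f) (M0 : 0 <= M).
Hypotheses (df : forall x : R, is_derive x 1 f (u0 x)) (pf : forall x, f (x + 1) = f x).
Hypothesis sup : forall x h, f x + u0 x * h - T^-1 / 2 * h ^+ 2 <= f (x + h).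
Hypothesis sd : forall x h, f (x + h) + f (x - h) - 2 * f x <= M * h ^+ 2.
Hypothesis fphi : forall x, f x <= phi x.
Hypothesis Sfphi : forall y, hopf_lax T phi y <= hopf_lax T f y.
Hypothesis pphi : forall x, phi (x + 1) = phi x.
Hypotheses (d0 : 0 < d) (tpsi : test_function T psi) (late : vanishes_late T d psi).

Local Notation S := (fun t => hopf_lax t f).
Local Notation k := (weight T d psi).

Let pairing_at t := intv 0 1 (fun x => S t x * dx psi (t, x)).
Let I0 := intv 0 1 (hopf_lax T phi).

Let tdx : test_function T (dx psi) := test_dx_test tpsi.

Let lS t : 0 <= t -> locbm (S t).
Proof. by move=> t0; apply: locbm_cont; exact: lip_cont (hopf_lax_lip t0 lf). Qed.

Lemma pairing_at_lip : exists2 La, 0 <= La & forall s t, 0 <= s -> s <= t -> t <= T ->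
  `|pairing_at t - pairing_at s| <= La * (t - s).
Proof.
have pdt : space_periodic T (dt (dx psi)).
  by apply: (space_periodic_dt T0 (proj1 tdx)); [exact: (test_dt_cont tdx)|exact: (test_dt tdx)].
have [Mx Mx0 hMx] := strip_bounded (test_cont tdx) (proj1 tdx).
have [Mt Mt0 hMt] := strip_bounded (test_dt_cont tdx) pdt.
have [Mf Mf0 hMf] := periodic_bounded (lip_cont lf) pf.
pose L2 := L ^+ 2 / 2; have L20 : 0 <= L2 by rewrite divr_ge0 ?sqr_ge0.
exists (L2 * Mx + (Mf + L2 * T) * Mt) => [|s t s0 st tT].
  by rewrite addr_ge0// mulr_ge0// addr_ge0// mulr_ge0// ltW.
have t0 := le_trans s0 st; have sT := le_trans st tT.
have lp y : 0 <= y -> locbm (fun x => S y x * dx psi (y, x)).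
  by move=> y0; apply: locbmM (lS y0) (locbm_cont (cont_slice1 y (test_cont tdx))).
rewrite -(intvB 0 1 (lp t t0) (lp s s0)) -[leRHS]mulr1 -[X in _ * X](subr0 1).
apply: (intv_norm_le ler01 (locbmB (lp t t0) (lp s s0))) => x _.
have -> : S t x * dx psi (t, x) - S s x * dx psi (s, x) =
    (S t x - S s x) * dx psi (t, x) + S s x * (dx psi (t, x) - dx psi (s, x)) by ring.
have [a1 a2] := hopf_lax_time lf x s0 st.
have [b1 b2] := hopf_lax_time lf x (lexx 0) s0.
rewrite hopf_lax0 subr0 in b1 b2.
have h1 : `|S t x - S s x| <= L2 * (t - s).
  by rewrite distrC ger0_norm ?subr_ge0// lerBlDl; exact: a2.
have h2 : `|S s x| <= Mf + L2 * T.
  have := hMf x; rewrite ler_norml => /andP[c1 c2].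
  have h := ler_wpM2l L20 sT.
  rewrite ler_norml; apply/andP; split; last by apply: (le_trans b1); rewrite (le_trans c2)// lerDl mulr_ge0// ltW.
  rewrite opprD lerBlDr; apply: (le_trans c1); apply: (le_trans b2).
  by rewrite lerD2l.
have h3 : `|dx psi (t, x) - dx psi (s, x)| <= Mt * (t - s).
  have cdt := cont_slice2 x (test_dt_cont tdx).
  rewrite -(intv_FTC s t cdt (fun y => test_dt tdx y x)).
  apply: (intv_norm_le st (locbm_cont cdt)) => y /andP[sy yt]; apply: hMt.
  by rewrite (le_trans s0 sy) (le_trans yt tT).
apply: (le_trans (ler_normD _ _)); rewrite [leRHS]mulrDl; apply: lerD.
  rewrite normrM [leRHS]mulrAC; apply: ler_pM => //; apply: hMx; by rewrite t0.
by rewrite normrM -[leRHS]mulrA; apply: ler_pM.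
Qed.

Section Profiles.
Variables (n : nat) (eps K Kx Lx : R) (k' : R * R -> R).
Hypothesis n0 : (0 < n)%N.
Hypothesis hK : forall t x, 0 <= t <= T -> `|k (t, x)| <= K.
Hypothesis hk' : forall t, 0 <= t <= T ->
  (forall x : R, is_derive x 1 (fun x => k (t, x)) (k' (t, x))) /\ lip Lx (fun x => k' (t, x)).
Hypothesis hKx : forall t, 0 <= t <= T -> lip Kx (fun x => k (t, x)).

Let nR : 0 < n%:R :> R. Proof. by rewrite ltr0n. Qed.
Let tau := T / n%:R.
Let tau0 : 0 < tau. Proof. exact: divr_gt0. Qed.
Let b := eps * T.

Let ntau : n%:R * tau = T.
Proof. by rewrite /tau mulrC divfK// gt_eqF. Qed.

(** Clamped so that the slopes are bounded and periodic for every index, also beyond n. *)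
Let time i := clamp T (i%:R * tau).
Let time_itv i : 0 <= time i <= T. Proof. exact: clamp_itv. Qed.
Let timeE i : (i <= n)%N -> time i = i%:R * tau.
Proof.
move=> iN; apply: clamp_id; rewrite mulr_ge0 ?(ltW tau0)//= -[leRHS]ntau.
by rewrite ler_pM2r// ler_nat.
Qed.

Definition slope (i : nat) (x : R) := k (time i, x).
Definition slope_primitive (i : nat) (x : R) := intv 0 x (slope i).

Lemma slope_cont i : continuous (slope i).
Proof. exact: cont_slice1 (weight_cont d0 tpsi). Qed.

Lemma is_derive_slope_primitive i (x : R) : is_derive x 1 (slope_primitive i) (slope i x).
Proof. exact: (intv_is_derive 0 (locbm_cont (@slope_cont i)) (@slope_cont i x)). Qed.

Lemma slope_periodic i x : slope i (x + 1) = slope i x.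
Proof. by apply: (weight_periodic d tpsi); rewrite in_itv/= time_itv. Qed.

Lemma slope_bound i x : `|slope i x| <= K.
Proof. exact: hK. Qed.

Lemma slope_lip i : lip Kx (slope i).
Proof. exact: hKx. Qed.

Lemma layer_lower i : (i < n)%N ->
  I0 + b * pairing_at (i%:R * tau) - T / 2 * b ^+ 2 * K ^+ 2 <=
  intv 0 1 (layer f tau b slope_primitive i n).
Proof.
move=> iN; pose t := i%:R * tau.
have tT : 0 <= t < T.
  by rewrite mulr_ge0 ?(ltW tau0)//= -[ltRHS]ntau ltr_pM2r// ltr_nat.
have tT' : 0 <= t <= T by case/andP: tT => -> /ltW.
have [u [du cu pu Hu]] := layer_energy T0 lphi lf M0 df pf sup sd Sfphi b tT
  (is_derive_slope_primitive i) (@slope_cont i) (slope_periodic i) (slope_bound i).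
have -> : intv 0 1 (layer f tau b slope_primitive i n) =
    intv 0 1 (fun x => hopf_lax (T - t) (fun x => S t x + b * slope_primitive i x) x - b * slope_primitive i x).
  apply: intv_ext => x; rewrite /layer leqNgt iN /=.
  by rewrite natrB ?(ltnW iN)// mulrBl ntau.
(* The remaining time T - t cancels the denominator of the weight and leaves psi; integration by
   parts then moves the derivative from the Hopf-Lax function to psi. *)
have E : (T - t) * intv 0 1 (fun x => u x * slope i x) = - pairing_at t.
  have lus : locbm (fun x => u x * slope i x) := locbmM (locbm_cont cu) (locbm_cont (@slope_cont i)).
  rewrite -(intvZ 0 1 (T - t) lus).
  have -> : intv 0 1 (fun x => (T - t) * (u x * slope i x)) = intv 0 1 (fun x => u x * psi (t, x)).
    by apply: intv_ext => x; rewrite mulrCA /slope timeE ?(ltnW iN)// (weightE d0 late).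
  apply: (intv_periodic_parts du (test_dx tpsi t) cu (cont_slice1 t (test_dx_cont tpsi))).
    by move=> x; apply: (hopf_lax_periodic x _ lf pf); case/andP: tT.
  by move=> x; apply: (proj1 tpsi); rewrite in_itv.
by rewrite -(layer_lower_arith I0 b (T / 2 * b ^+ 2 * K ^+ 2) E).
Qed.

Lemma profile_integral La : 0 <= La ->
  (forall s t, 0 <= s -> s <= t -> t <= T -> `|pairing_at t - pairing_at s| <= La * (t - s)) ->
  `|eps| <= 1 ->
  I0 + eps * intv 0 T pairing_at - T / 2 * T ^+ 2 * K ^+ 2 * eps ^+ 2 - La * T * tau <=
  intv 0 1 (profile phi f tau b n slope_primitive n).
Proof.
move=> La0 hLa e1.
pose B t := pairing_at (clamp T t).
have BE t : 0 <= t <= T -> B t = pairing_at t by move=> tT; rewrite /B clamp_id.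
have lB : locbm B.
  have H s t : clamp T s <= clamp T t -> `|B t - B s| <= La * `|t - s|.
    move=> st; have /andP[s0 _] := clamp_itv T0 s; have /andP[_ tT] := clamp_itv T0 t.
    apply: (le_trans (hLa _ _ s0 st tT)); rewrite ler_wpM2l//.
    by apply: (le_trans (ler_norm _)); apply: (le_trans (clamp_lip T t s)); rewrite mul1r.
  apply: locbm_cont; apply: (@lip_cont _ La) => s t.
  by have [st|/ltW ts] := leP (clamp T t) (clamp T s); [exact: H|rewrite distrC (distrC s t); exact: H].
have -> : intv 0 T pairing_at = intv 0 T B.
  by apply: (intv_eq (ltW T0)) => t tT; rewrite BE.
have hB s t : 0 <= s -> s <= t -> t <= n%:R * tau -> `|B t - B s| <= La * (t - s).
  rewrite ntau => s0 st tT; rewrite !BE ?s0 ?(le_trans s0 st) ?(le_trans st tT)//; exact: hLa.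
have := riemann_sum (ltW tau0) lB hB; rewrite ntau.
have -> : n%:R * (La * tau ^+ 2) = La * T * tau by rewrite -ntau; ring.
set s := tau * _ => hs.
apply: (profile_integral_arith _ hs e1).
have lL i : locbm (layer f tau b slope_primitive i n).
  apply: locbm_cont; apply: lip_cont.
  exact: (layer_lip lf b tau0 is_derive_slope_primitive slope_bound i n).
have -> : intv 0 1 (profile phi f tau b n slope_primitive n) =
    n%:R^-1 * \sum_(i < n) intv 0 1 (layer f tau b slope_primitive i n).
  have -> : profile phi f tau b n slope_primitive n =
      fun x => n%:R^-1 * \sum_(i < n) layer f tau b slope_primitive i n x.
    by move: (n) n0 => [].
  rewrite -(intv_sum n 0 1 lL).
  exact: (intvZ 0 1 n%:R^-1 (locbm_sum n lL)).
apply: (@le_trans _ _ (n%:R^-1 * \sum_(i < n) (I0 - T / 2 * b ^+ 2 * K ^+ 2 + b * pairing_at (i%:R * tau)))).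
  rewrite big_split/= sumr_const card_ord -mulr_sumr mulrDr.
  rewrite -[X in n%:R^-1 * X](mulr_natl) mulKf ?gt_eqF//.
  (* Since b = eps T and tau = T/n, the factor b/n is eps tau, and the mean over the layers becomes
     a Riemann sum in time. *)
  have -> : n%:R^-1 * (b * \sum_(i < n) pairing_at (i%:R * tau)) = eps * s.
    have -> : s = tau * \sum_(i < n) pairing_at (i%:R * tau).
      apply: (congr1 ( *%R tau)); apply: eq_bigr => i _; apply: BE; apply/andP; split.
        exact: (mulr_ge0 (ler0n _ _) (ltW tau0)).
      by rewrite -[leRHS]ntau (ler_pM2r tau0) ler_nat ltnW.
    by rewrite /b /tau; ring.
  exact: profile_rearrange.
rewrite ler_pM2l ?invr_gt0//; apply: ler_sum => i _.
by have := layer_lower (ltn_ord i); rewrite addrAC.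
Qed.

End Profiles.

Hypotheses (dphi : forall x : R, is_derive x 1 phi (v0 x)) (cv0 : continuous v0) (lv0 : lip Lv v0).
Variables (E B : {charge set (plane R) -> \bar R}).
Hypothesis EB : dual_maximizer T v0 E B.

Lemma flux_weight :
  pairing T (weight_integral T d psi) (flux E) = - dint T (fun p => hopf_lax p.1 f p.2 * dx psi p).
Proof.
have [K [Kt [Kx [Lx [[K0 Kt0 Kx0] [hK hKt hKx [k' hk']]]]]]] := weight_bounds T0 d0 tpsi.
have [La La0 hLa] := pairing_at_lip.
pose Phi := weight_integral T d psi.
have cPhi : continuous Phi := @weight_integral_cont _ _ _ _ d0 tpsi.
have pPhi : space_periodic T Phi by move=> t x; exact: (weight_integral_periodic d tpsi).
have kPhi : cellbm T Phi by apply: locbm2_cellbm; exact: locbm2_cont.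
have lPhi := weight_integral_lip T0 d0 tpsi K0 Kx0 hK hKx.
have [M1 M10 hM1] := strip_bounded cPhi pPhi.
have Lv0 : 0 <= Lv by have := le_trans (normr_ge0 _) (lv0 1 0); rewrite subr0 normr1 mulr1.
have L0 : 0 <= L by have := le_trans (normr_ge0 _) (lf 1 0); rewrite subr0 normr1 mulr1.
(* Coefficient of eps^2 in the energy remainder T b^2 K^2/2 with b = eps T. *)
pose Z := T / 2 * T ^+ 2 * K ^+ 2.
have Z0 : 0 <= Z.
  by rewrite /Z mulr_ge0 ?sqr_ge0// mulr_ge0 ?sqr_ge0// divr_ge0// ltW.
apply: (eq_of_linear_bound Z0) => e e1.
pose LU := L + 2 * (T * K); pose C := LU + Lv + M1.
have LU0 : 0 <= LU by rewrite addr_ge0 ?mulr_ge0// ltW.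
have C0 : 0 <= C := addr_ge0 (addr_ge0 LU0 Lv0) M10.
pose KP := K + Kx * T.
have KP0 : 0 <= KP by rewrite addr_ge0 ?mulr_ge0// ltW.
pose Pe p := e * Phi p.
have cPe : continuous Pe by move=> p; apply: cvgM; [exact: cvg_cst|exact: cPhi].
have pPe : space_periodic T Pe by move=> t x tT; rewrite /Pe pPhi.
have lPe t s x y : 0 <= t <= T -> 0 <= s <= T -> `|Pe (t, x) - Pe (s, y)| <= KP * (`|t - s| + `|x - y|).
  move=> tT sT; rewrite /Pe -mulrBr normrM -[leRHS]mul1r.
  by apply: ler_pM => //; exact: lPhi.
have bPe p : strip T p -> `|Pe p| <= M1.
  case: p => t x [/= + _]; rewrite in_itv/= => tT; rewrite /Pe normrM -[M1]mul1r.
  by apply: ler_pM => //; exact: hM1.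
have EPe : pairing T Pe (flux E) = e * pairing T Phi (flux E) := pairingZ (flux E) e kPhi.
apply/ler_addgt0Pr => g' g'0; pose g := g' / 2.
have g0 : 0 < g by rewrite divr_gt0.
have [N HN] := dual_certificate T0 lphi dphi cv0 pphi EB lv0 cPe pPe KP0 lPe bPe (lexx C) g0.
pose A := Kt * T + K.
have A0 : 0 <= A by rewrite addr_ge0 ?mulr_ge0// ltW.
(* Coefficient of tau in the total error: the Riemann sum of the slopes ([A]), the Taylor remainder
   of the layers ([Kx]), and the Riemann sum of the pairings ([La]). The next choice of m meets the
   threshold of the certificate and makes Q tau at most g. *)
pose Q := (C * A + T * Kx * C ^+ 2) * T + La * T.
pose m := maxn N (Num.truncn (Q * T / g)).
have n0 : (0 < m.+1)%N by [].
have nR : 0 < m.+1%:R :> R by rewrite ltr0n.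
pose tau := T / m.+1%:R; have tau0 : 0 < tau by rewrite divr_gt0.
have hQ : Q * tau <= g.
  rewrite /tau mulrA ler_pdivrMr// [leRHS]mulrC -ler_pdivrMr//; apply: ltW.
  by apply: (lt_le_trans (truncnS_gt _)); rewrite ler_nat ltnS leq_maxr.
pose b := e * T; pose H := slope_primitive m.+1; pose h := slope m.+1.
have dH i (x : R) : is_derive x 1 (H i) (h i x) := is_derive_slope_primitive m.+1 i x.
have hh i x : `|h i x| <= K := slope_bound m.+1 hK i x.
have lh i : lip Kx (h i) := slope_lip m.+1 hKx i.
have ph i x : h i (x + 1) = h i x := slope_periodic m.+1 i x.
pose U := profile phi f tau b m.+1 H.
have bT : `|b| <= T by rewrite normrM (ger0_norm (ltW T0)) ler_piMl// ltW.
have lU j : lip LU (U j).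
  apply: lip_le (profile_lip lphi lf b tau0 dH hh n0 j).
  by rewrite lerD2l ler_pM2l// ler_wpM2r.
have pU j x : U j (x + 1) = U j x := profile_periodic lf pf pphi b m.+1 tau0 dH hh ph j x.
pose eta := C * (A * tau) + T * Kx * C ^+ 2 * tau.
have sU j x c : (j <= m)%N -> `|c| <= C ->
    U j.+1 (x + c * tau) <= U j x + tau * (c ^+ 2 / 2 - c * Pe (j%:R * tau, x) + eta).
  move=> jm cC.
  have jT : j.+1%:R * tau <= T.
    by rewrite /tau mulrA ler_pdivrMr// mulrC ler_pM2l// ler_nat ltnS.
  have h1 := profile_step (j := j) lf fphi b tau0 dH hh lh n0 x jm cC.
  have Es : tau * \sum_(i < j.+1) weight T d psi (i%:R * tau, x) =
      T * (m.+1%:R^-1 * \sum_(i < j.+1) h i x).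
    rewrite /tau -mulrA; congr (_ * (_ * _)); apply: eq_bigr => i _; rewrite /h /slope clamp_id//.
    rewrite mulr_ge0 ?(ltW tau0)//=; apply: le_trans jT.
    by rewrite ler_pM2r// ler_nat ltnW.
  have h2 := weight_integral_sum d0 tpsi x (ltW tau0) Kt0 jT hK hKt.
  rewrite Es in h2.
  have h3 : `|b| * Kx * C ^+ 2 * tau ^+ 2 <= tau * (T * Kx * C ^+ 2 * tau).
    have -> : tau * (T * Kx * C ^+ 2 * tau) = T * (Kx * C ^+ 2 * tau ^+ 2) by ring.
    rewrite -!mulrA ler_wpM2r// !mulr_ge0 ?sqr_ge0// ltW//.
  have At0 : 0 <= A * tau by rewrite mulr_ge0// ltW.
  apply: (step_arith tau0 _ h2 e1 cC At0 h3 erefl).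
  by rewrite (_ : e * c * tau * (T * _) = b * c * tau * (m.+1%:R^-1 * \sum_(i < j.+1) h i x))//; rewrite /b; ring.
have h1 := HN m U eta (leq_maxl _ _) erefl pU lU sU.
rewrite EPe in h1.
have h2 := profile_integral n0 hK La0 hLa e1.
have h3 : eta * T + La * T * tau <= g.
  by apply: le_trans hQ; rewrite /eta /Q; apply: eta_arith.
have g2 : 2 * g = g' by rewrite /g mulrC divfK.
by have := flux_weight_arith h1 h2 h3; rewrite g2.
Qed.

End FluxWeight.

(** * The weak equation and the energy inequality from entropies, and the resulting identity *)

Fact eq0_of_signs (R : realType) (x : R) : 0 <= 1 * x -> 0 <= -1 * x -> x = 0.
Proof. by rewrite mul1r mulN1r oppr_ge0 => h1 h2; apply/eqP; rewrite eq_le h1 h2. Qed.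

Theorem proposition6p1 (R : realType) (T : R) (v0 : R -> R)
    (vT : R * R -> R) (E B : {charge set (plane R) -> \bar R})
    (psi : R * R -> R) :
  0 < T ->
  smooth v0 ->
  periodic v0 1 ->
  \int[lebesgue_measure]_(x in `[0, 1[) v0 x = 0 ->
  shock_free_substitute T v0 vT ->
  dual_maximizer T v0 E B ->
  test_function T psi ->
  vanishes_near_final_time T psi ->
  \int[Leb T]_(p in cell T) (psi p * vT p) =
  pairing T
    (fun p => \int[lebesgue_measure]_(s in `[0, p.1]) (psi (s, p.2) / (T - s)))
    (flux E).
Proof.
move=> T0 sv0 pv0 _ [phi [phiT [sphi pphi dphi env ent]]] EB tpsi vpsi.
have [u0 [L [M [[L0 M0 lphi lf] [df cu0 pu0 sup sd]]]]] := envelope_derivative T0 sphi pphi env.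
have pf := envelope_periodic T0 pphi env.
have fphi := envelope_le T0 env.
have Sf y := envelope_hopf_lax T0 env y lphi lf.
have dphi' (x : R) : is_derive x 1 phi (v0 x) by rewrite -dphi; exact: smooth_is_derive.
have [Lv Lv0 hLv] := periodic_bounded (smooth_cont (smooth_derive1 sv0))
  (is_derive_periodic (fun x => smooth_is_derive x sv0) pv0).
have lv0 := derive_lip (fun x => smooth_is_derive x sv0) hLv.
have [d /andP[d0 dT] late] := late_of_vanishes_near T0 (proj1 tpsi) vpsi.
have FW := flux_weight T0 lphi lf M0 df pf sup sd fphi Sf pphi d0 tpsi late dphi' (smooth_cont sv0) lv0 EB.
have -> : pairing T
    (fun p => \int[lebesgue_measure]_(s in `[0, p.1]) (psi (s, p.2) / (T - s))) (flux E) =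
    pairing T (weight_integral T d psi) (flux E).
  apply: eq_pairing => -[t x] [/= + _]; rewrite in_itv/= => /andP[t0 tT].
  rewrite -(intvE _ t0); apply: (intv_eq t0) => s /andP[s0 st].
  by apply: (weight_quotient d0 late); rewrite s0 (le_trans st).
rewrite FW.
have [pvT mvT [Cv hCv] ineq] := ent.
(* Extension by zero gives a function that is bounded and measurable on the whole plane and has the
   same integrals over the cell. *)
pose w := vT \_ (strip T).
have cS p : cell T p -> strip T p by case.
have wE p : cell T p -> w p = vT p by move=> /cS h; rewrite /w patchE mem_set.
have mstrip : measurable (strip T : set (plane R)).
  by apply: measurableX; [exact: measurable_itv|exact: measurableT].
have bw p : `|w p| <= `|Cv|.
  rewrite /w patchE; case: ifPn => [|_]; last by rewrite normr0.
  by rewrite inE => /hCv h; apply: (le_trans h); exact: ler_norm.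
have hw : locbm2 w.
  split; first exact/(measurable_restrictT _ mstrip).
  by move=> r; exists `|Cv| => t x _ _; exact: bw.
have Eu0 : derive1 phiT = u0 by apply/funext => x; exact: is_derive1_E.
have dual eta Q th : smooth eta -> smooth Q -> convex_function [set: R^o] eta ->
    (forall y, derive1 Q y = y * derive1 eta y) ->
    test_function T th -> vanishes_near_final_time T th -> (forall p, strip T p -> 0 <= th p) ->
    0 <= dint T (fun p => eta (w p) * dt th p + Q (w p) * dx th p) + intv 0 1 (fun x => eta (u0 x) * th (0, x)).
  move=> se sQ ce dQ tth vth th0; have := ineq eta Q th se sQ ce dQ tth vth th0.
  have le := locbm2_comp (locbm_cont (smooth_cont se)) hw.
  have lQ := locbm2_comp (locbm_cont (smooth_cont sQ)) hw.
  have ldt := locbm2_cont (test_dt_cont tth); have ldx := locbm2_cont (test_dx_cont tth).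
  have lF := locbm2D (locbm2M le ldt) (locbm2M lQ ldx).
  have -> : \int[Leb T]_(p in cell T) (eta (vT p) * dt th p + Q (vT p) * dx th p) =
      dint T (fun p => eta (w p) * dt th p + Q (w p) * dx th p).
    rewrite /dint -(Leb_integral (ltW T0) lF); apply: eq_Rintegral => p; rewrite inE => pc.
    by rewrite wE.
  rewrite Eu0 intv_co//; apply: locbmM.
    by apply: locbm_cont => x; apply: (@continuous_comp _ _ _ u0 eta); [exact: cu0|exact: (smooth_cont se)].
  exact: locbm_cont (cont_slice1 0 (test_cont tth)).
have did (x : R) : is_derive x 1 (fun y : R => y) 1 := is_derive_id x 1.
have s2 : smooth (fun y : R => y * y) := smoothM (@smooth_id R) (@smooth_id R).
have d2 (y : R) : is_derive y 1 (fun y : R => y * y) (2 * y).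
  have := is_deriveM (did y) (did y).
  by move/is_derive_congr; apply=> //; change (y * 1 + y * 1 = 2 * y); ring.
have weak th : test_function T th -> vanishes_near_final_time T th ->
    (forall p, strip T p -> 0 <= th p) ->
    dint T (fun p => w p * dt th p + 2^-1 * w p ^+ 2 * dx th p) + intv 0 1 (fun x => u0 x * th (0, x)) = 0.
  move=> tth vth th0.
  (* The linear entropies a y have flux a y^2/2 and are convex for both signs of a; a = 1 and a = -1
     turn the entropy inequality into the weak equation. *)
  have lin (a : R) : 0 <= dint T (fun p => a * w p * dt th p + a / 2 * (w p * w p) * dx th p) +
      intv 0 1 (fun x => a * u0 x * th (0, x)).
    apply: (dual (fun y => a * y) (fun y => a / 2 * (y * y)) th _ _ _ _ tth vth th0).
    - exact: smoothZ (@smooth_id R).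
    - exact: smoothZ.
    - by apply/convex_functionP => p x y _; lra.
    move=> y; rewrite (is_derive1_E (is_deriveZ (a / 2) (d2 y))) (is_derive1_E (is_deriveZ a (did y))).
    by change (a / 2 * (2 * y) = y * (a * 1)); field.
  have ldt := locbm2_cont (test_dt_cont tth); have ldx := locbm2_cont (test_dx_cont tth).
  have lF : locbm2 (fun p => w p * dt th p + 2^-1 * w p ^+ 2 * dx th p).
    exact: (locbm2D (locbm2M hw ldt) (locbm2M (locbm2Z 2^-1 (locbm2M hw hw)) ldx)).
  have lb : locbm (fun x => u0 x * th (0, x)).
    exact: locbmM (locbm_cont cu0) (locbm_cont (cont_slice1 0 (test_cont tth))).
  have scale a : dint T (fun p => a * w p * dt th p + a / 2 * (w p * w p) * dx th p) +
      intv 0 1 (fun x => a * u0 x * th (0, x)) =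
      a * (dint T (fun p => w p * dt th p + 2^-1 * w p ^+ 2 * dx th p) + intv 0 1 (fun x => u0 x * th (0, x))).
    have -> : dint T (fun p => a * w p * dt th p + a / 2 * (w p * w p) * dx th p) =
        a * dint T (fun p => w p * dt th p + 2^-1 * w p ^+ 2 * dx th p).
      by rewrite -(dintZ T a lF); apply: (eq_dint (ltW T0)) => t x _; ring.
    have -> : intv 0 1 (fun x => a * u0 x * th (0, x)) = a * intv 0 1 (fun x => u0 x * th (0, x)).
      by rewrite -(intvZ 0 1 a lb); apply: intv_ext => x; ring.
    exact: (esym (mulrDr _ _ _)).
  apply: eq0_of_signs; [rewrite -(scale 1)|rewrite -(scale (-1))]; exact: lin.
have s3 : smooth (fun y : R => y * (y * y)) := smoothM (@smooth_id R) s2.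
have energy th : test_function T th -> vanishes_near_final_time T th ->
    (forall p, strip T p -> 0 <= th p) ->
    0 <= dint T (fun p => w p ^+ 2 * dt th p + 2 / 3 * w p ^+ 3 * dx th p) +
      intv 0 1 (fun x => u0 x ^+ 2 * th (0, x)).
  move=> tth vth th0.
  have H : 0 <= dint T (fun p => w p * w p * dt th p + 2 / 3 * (w p * (w p * w p)) * dx th p) +
      intv 0 1 (fun x => u0 x * u0 x * th (0, x)).
    (* The quadratic entropy, with flux 2 y^3/3 because Q' = y eta' = 2 y^2. *)
    apply: (dual (fun y => y * y) (fun y => 2 / 3 * (y * (y * y))) th s2 _ _ _ tth vth th0).
    - exact: smoothZ.
    - apply/convex_functionP => p x y /andP[p0 p1].
      have := mulr_ge0 (mulr_ge0 p0 (_ : 0 <= 1 - p)) (sqr_ge0 (x - y)); rewrite subr_ge0 => /(_ p1).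
      by lra.
    move=> y; rewrite (is_derive1_E (is_deriveZ (2 / 3) (is_deriveM (did y) (d2 y)))) (is_derive1_E (d2 y)).
    by change (2 / 3 * (y * (2 * y) + y * y * 1) = y * (2 * y)); field.
  exact: H.
(* At t = 0 the last clause of [hopf_lax_C11] says that the characteristics of phi^T do not cross
   before T. *)
have mono x y : x <= y -> x + T * u0 x <= y + T * u0 y.
  have t0 : 0 <= (0 : R) < T by rewrite lexx.
  have [u [du _ _ mu]] := hopf_lax_C11 t0 M0 lf df pf sup sd.
  have E0 z : u z = u0 z.
    by have [_ <-] := du z; have [_ <-] := df z; rewrite hopf_lax0.
  by move=> /mu; rewrite !subr0 !E0.
rewrite -(entropy_hopf_lax T0 hw bw lf df cu0 pf weak energy mono tpsi vpsi).
have lF := locbm2M (locbm2_cont (test_cont tpsi)) hw.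
rewrite /dint -(Leb_integral (ltW T0) lF); apply: eq_Rintegral => p; rewrite inE => pc.
by rewrite wE.
Qed.
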